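(* Let $A_1,A_2\in\mathbb{R}^{3\times3}$ be Metzler matrices with zero row sums. Fix arbitrary $x_0\in\mathbb{R}^3$ and $T\ge0$, and consider the problem of minimizing $V(x(T,u))$ over $u\in\mathcal{U}$, where $x(\cdot,u)$ is the solution of $$\dot x=(u_1A_1+u_2A_2)x,\qquad x(0)=x_0 .$$ There exists an optimal control $u^*=\begin{bmatrix}u_1^*&1-u_1^*\end{bmatrix}'$ satisfying $$u_1^*\in\mathcal{W}:=(\mathcal{B}_0*\mathcal{BP})\cup(\mathcal{B}_0*\mathcal{PC}_2).$$
   Context: Prime denotes transpose. A matrix is Metzler if its off-diagonal entries are nonnegative. $V(x):=\sum_{i=1}^3(x_i-\frac13(x_1+x_2+x_3))^2$. $\mathcal{U}$ is the set of measurable $u:[0,T]\to\mathbb{R}^2$ with $u_1(t),u_2(t)\ge0$ and $u_1(t)+u_2(t)=1$ for all $t\in[0,T]$; $u^*\in\mathcal{U}$ is optimal if $V(x(T,u^* ))=\min_{u\in\mathcal{U}}V(x(T,u))$. The following sets consist of scalar controls, i.e. measurable functions from bounded intervals $[0,T_1]$ to $[0,1]$; the condition $u_1^*\in\mathcal{W}$ concerns functions on $[0,T]$. Concatenation: for $v_1:[0,T_1]\to[0,1]$ and $v_2:[0,T_2]\to[0,1]$, the control $v_2*v_1$ on $[0,T_1+T_2]$ is defined by $(v_2*v_1)(t)=v_1(t)$ for $t\in[0,T_1)$ and $(v_2*v_1)(t)=v_2(t-T_1)$ for $t\in[T_1,T_1+T_2]$. For sets of controls $\mathcal{U}_1,\mathcal{U}_2$,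 $\mathcal{U}_2*\mathcal{U}_1$ is the set of all concatenations $v_2*v_1$ where for $i=1,2$ either $v_i\in\mathcal{U}_i$ or $v_i$ is trivial (its domain is a single point). $\mathcal{B}_k$: piecewise constant bang-bang controls (values in $\{0,1\}$) with no more than $k$ discontinuities; so $\mathcal{B}_0$ consists of controls identically $0$ or identically $1$. $\mathcal{PC}_k$: piecewise constant controls with values in $[0,1]$ and no more than $k$ discontinuities. $\mathcal{BP}$: bang-bang controls that are periodic after three switches, i.e. (restrictions to bounded intervals $[0,T_1']$ of) functions $u:[0,\infty)\to\{0,1\}$ with switching times $T_1<T_2<T_3<\cdots$, so that for some $v\in\{0,1\}$, $u=v$ on $[0,T_1)$, $u=1-v$ on $[T_1,T_2)$, $u=v$ on $[T_2,T_3)$, and so on, such that $T_2-T_1=T_4-T_3=T_6-T_5=\cdots$ and $T_3-T_2=T_5-T_4=T_7-T_6=\cdots$. *)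

(* Defs.v *)
From HB Require Import structures.
From mathcomp Require Import all_boot all_order all_algebra.
From mathcomp Require Import all_classical all_reals all_analysis.

Set Implicit Arguments.
Unset Strict Implicit.
Unset Printing Implicit Defensive.

Import Order.TTheory GRing.Theory Num.Theory.
Import numFieldNormedType.Exports.

Local Open Scope classical_set_scope.
Local Open Scope ring_scope.

Section MatricesAndCost.
Variable R : realType.

Definition metzler n (A : 'M[R]_n) : Prop :=
  forall i j, i != j -> 0 <= A i j.

Definition zero_row_sums n (A : 'M[R]_n) : Prop :=
  forall i, \sum_j A i j = 0.

Definition V (x : 'cV[R]_3) : R :=
  \sum_(i < 3) (x i 0 - 3^-1 * \sum_(j < 3) x j 0) ^+ 2.

End MatricesAndCost.

(* R with the Lebesgue (Caratheodory) sigma-algebra, i.e. the domain of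
   [completed_lebesgue_measure]; the sigma-algebra on R itself is Borel. *)
Notation lebesgueType R :=
  (caratheodory_type (((wlength (@idfun R))^*)%mu)).

Definition lebesgue_measurable_on (R : realType) (D : set R) (f : R -> R) :
    Prop :=
  measurable_fun (D : set (lebesgueType R)) (f : lebesgueType R -> R).

Section ControlProblem.
Variable R : realType.

(* Functions on [0, T] are represented by functions on R of which only the
   values on [0, T] are ever used. *)

Definition admissible (T : R) (u : R -> 'cV[R]_2) : Prop :=
  (forall i, lebesgue_measurable_on `[0, T] (fun t => u t i 0)) /\
  (forall t, t \in `[0, T] ->
     [/\ 0 <= u t 0 0, 0 <= u t 1 0 & u t 0 0 + u t 1 0 = 1]).

(* Solution on [0, T] in the sense of Caratheodory:
   x(t) = x0 + int_0^t (u_1 A1 + u_2 A2) x ds, for x continuous. *)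
Definition trajectory (A1 A2 : 'M[R]_3) (x0 : 'cV[R]_3) (T : R)
    (u : R -> 'cV[R]_2) (x : R -> 'cV[R]_3) : Prop :=
  {within `[0, T], continuous x} /\
  (forall t, t \in `[0, T] -> forall i,
     x t i 0 = x0 i 0 +
       \int[@completed_lebesgue_measure R]_(s in `[0, t])
         ((u s 0 0 *: A1 + u s 1 0 *: A2) *m x s) i 0).

Definition optimal (A1 A2 : 'M[R]_3) (x0 : 'cV[R]_3) (T : R)
    (u : R -> 'cV[R]_2) : Prop :=
  admissible T u /\
  exists2 x, trajectory A1 A2 x0 T u x &
    forall v y, admissible T v -> trajectory A1 A2 x0 T v y ->
      V (x T) <= V (y T).

Definition control_of (u1 : R -> R) (t : R) : 'cV[R]_2 :=
  \col_(i < 2) if i == 0 then u1 t else 1 - u1 t.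

End ControlProblem.

Section ScalarControls.
Variable R : realType.

Definition scalar_control (L : R) (v : R -> R) : Prop :=
  [/\ 0 <= L, lebesgue_measurable_on `[0, L] v &
      forall t, t \in `[0, L] -> 0 <= v t <= 1].

(* [U L v] says that the restriction of v to [0, L] is a member of U. *)
Definition control_set := R -> set (R -> R).

(* v2 * v1, where v1 has domain [0, T1]; v1 comes first in time. *)
Definition concat (T1 : R) (v2 v1 : R -> R) (t : R) : R :=
  if t < T1 then v1 t else v2 (t - T1).

Definition concat_set (U2 U1 : control_set) : control_set :=
  fun L => [set w | exists T1 T2 v1 v2,
    [/\ L = T1 + T2,
        U1 T1 v1 \/ (T1 = 0 /\ scalar_control T1 v1),
        U2 T2 v2 \/ (T2 = 0 /\ scalar_control T2 v2) &
        forall t, t \in `[0, L] -> w t = concat T1 v2 v1 t]].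

(* s is a finite list of breakpoints; it may be larger than the set of
   discontinuities. *)
Definition piecewise_constant (L : R) (v : R -> R) : Prop :=
  exists s : seq R, forall a b, 0 <= a -> a <= b -> b <= L ->
    (forall c, c \in s -> c \notin `[a, b]) -> v a = v b.

Definition discontinuities (L : R) (v : R -> R) : set R :=
  [set t | t \in `[0, L] /\
     ~ (v s @[s --> within `[0, L] (nbhs t)] --> v t)].

Definition PC (k : nat) : control_set :=
  fun L => [set v | [/\ scalar_control L v, piecewise_constant L v &
                        (discontinuities L v #<= `I_k)%card]].

Definition B (k : nat) : control_set :=
  fun L => [set v | PC k L v /\
                    forall t, t \in `[0, L] -> v t = 0 \/ v t = 1].

(* The switching time T_(n+1) is [tau n]; the two interlaced chains of
   equalities T_2 - T_1 = T_4 - T_3 = ... and T_3 - T_2 = T_5 - T_4 = ...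
   are the even and odd cases of the third condition. *)
Definition periodic_after_three_switches (u : R -> R) : Prop :=
  exists (tau : nat -> R) (v : R),
    [/\ 0 < tau 0%N,
        forall n, tau n < tau n.+1,
        forall n, tau n.+3 - tau n.+2 = tau n.+1 - tau n,
        v = 0 \/ v = 1 &
        (forall t, 0 <= t < tau 0%N -> u t = v) /\
        (forall n t, tau n <= t < tau n.+1 ->
           u t = if odd n then v else 1 - v)].

Definition BP : control_set :=
  fun L => [set w | scalar_control L w /\
    exists2 u, periodic_after_three_switches u &
      forall t, t \in `[0, L] -> w t = u t].

Definition W : control_set :=
  fun L => concat_set (B 0) BP L `|` concat_set (B 0) (PC 2) L.

End ScalarControls.

(* Main.v *)
Require Import Defs.
From mathcomp Require Import all_boot all_order all_algebra.
From mathcomp Require Import all_classical all_reals all_analysis.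
From mathcomp Require Import measurable_realfun.
From mathcomp Require Import ring lra zify.

(* Subtracting the third coordinate turns the system into a planar bilinear one,
   and V into a positive definite quadratic form of the planar state. A
   measurable control is a limit of bang-bang words (finite lists of arcs), so
   it suffices to compare with those. Consider a bang-bang word that is best
   among the words of at most its length and strictly better than all shorter
   ones. Sliding the junctions yields an adjoint state with constant Hamiltonian
   h, so that every junction state is a zero of the quadratic form
   q(y) = det((A2 - h) y, (A1 - h) y). If q = 0 then two arcs suffice, so in a
   word of at least three arcs the junctions lie on at most two lines. With at
   least five arcs no interior arc can return to its own line; hence interior
   arcs join the two lines alternately, and the durations of two interior arcs
   of the same type differ by a time at which the flow is scalar. A needle
   variation excludes such a time inside an interior arc of a global minimiser,
   whose interior is therefore periodic. If no bang-bang word is a global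
   minimiser, the best words become arbitrarily long; up to scalar excess times,
   which can be moved to the first two arcs, their interiors repeat two short
   arcs and are close to a single arc with a constant averaged control. The
   compact family of four-arc words (the averaged arc, two arcs before it, one
   bang arc after it) then contains a minimiser. *)

Set Implicit Arguments.
Unset Strict Implicit.
Unset Printing Implicit Defensive.

Import Order.TTheory GRing.Theory Num.Theory.
Import numFieldNormedType.Exports.

Local Open Scope classical_set_scope.
Local Open Scope ring_scope.

(** First-order conditions are only needed for words minimising among words of bounded length, where
    compactness provides a minimum; no maximum principle for measurable controls enters. The flow of
    a planar matrix B is written fa + fb B, so a state is parallel to its image after time t exactly
    when fb t = 0 (the flow is then scalar) or the state is an eigenvector. This dichotomy replaces
    a discussion of eigenvalues. Minimality of the number of arcs does the rest: pieces acting as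
    scalars on the state can be moved inside the word, which merges arcs or breaks alternation. Five
    arcs are the threshold because they give four interior junctions for two lines.

    The obstacle is that the infimum over bang-bang words may not be attained. No limit of controls
    is taken: k periods of length d cost an error O(k d^2) while k d <= T, so k times the gap
    between a best word and its four-arc replacement has a bound independent of the word. A fixed
    positive gap therefore bounds the number of arcs. The four-arc family is dictated by W: three
    arcs with free values form a PC_2 control, and the bang arc is the B_0 factor. *)

Section RealDerivatives.
Variable R : realType.
Implicit Types (f g : R -> R) (x a b : R).

Lemma is_derive_add f g x df dg : is_derive x 1 f df -> is_derive x 1 g dg ->
  is_derive x 1 (fun t => f t + g t) (df + dg).
Proof. exact: is_deriveD. Qed.

Lemma is_derive_opp f x df : is_derive x 1 f df ->
  is_derive x 1 (fun t => - f t) (- df).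
Proof. exact: is_deriveN. Qed.

Lemma is_derive_mul f g x df dg : is_derive x 1 f df -> is_derive x 1 g dg ->
  is_derive x 1 (fun t => f t * g t) (f x * dg + g x * df).
Proof. exact: is_deriveM. Qed.

Lemma is_derive_const a x : is_derive x 1 (fun=> a) (0 : R).
Proof. exact: is_derive_cst. Qed.

Lemma is_derive_self x : is_derive x 1 (fun t : R => t) (1 : R).
Proof. exact: is_derive_id. Qed.

Lemma is_derive_comp f g x df dg : is_derive (g x) 1 f df -> is_derive x 1 g dg ->
  is_derive x 1 (fun t => f (g t)) (df * dg).
Proof. by move=> hf hg; apply: is_derive1_comp. Qed.

Lemma is_derive_continuous f df x : is_derive x 1 f df -> {for x, continuous f}.
Proof. by move=> [h _]; apply/differentiable_continuous/derivable1_diffP. Qed.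

Lemma derive0_const f : (forall x, is_derive x 1 f 0) -> forall a b, f a = f b.
Proof. by move=> h a b; apply: is_derive_0_is_cst. Qed.

Lemma mean_value f df a b : (forall x, is_derive x 1 f (df x)) -> a <= b ->
  exists2 c, a <= c <= b & f b - f a = df c * (b - a).
Proof.
move=> h ab.
have [|c cab e] := @MVT_segment R f df a b ab (fun x _ => h x).
  by apply: continuous_subspaceT => x; apply: is_derive_continuous (h x).
by exists c.
Qed.

End RealDerivatives.

Ltac derive_rules :=
  repeat first
   [ eassumption
   | eapply is_derive_const
   | eapply is_derive_self
   | eapply is_derive_add
   | eapply is_derive_opp
   | eapply is_derive_mul ].

Ltac by_rules := eapply is_derive_eq; [derive_rules | cbv beta].

(** * The two scalar coefficients of the exponential of a planar matrix *)

Section FlowCoefficients.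
Variable R : realType.

(** The three types of planar matrices are separated here: trigonometric functions for k < 0,
    hyperbolic ones for k > 0, and 1 and t for k = 0. Later arguments use only the differential
    equations. *)
Lemma harmonic_pair (k : R) : exists C S : R -> R,
  [/\ C 0 = 1, S 0 = 0, forall t : R, is_derive t 1 C (k * S t) &
      forall t : R, is_derive t 1 S (C t)].
Proof.
have dlin (w x : R) : is_derive x 1 (fun t => w * t) w.
  by_rules.
  by rewrite mulr0 addr0 mulr1.
have [k_lt0|k_gt0|->] := ltgtP k 0.
- pose w := Num.sqrt (- k).
  have w_gt0 : 0 < w by rewrite sqrtr_gt0 oppr_gt0.
  have w2 : k = - (w * w) by rewrite -expr2 sqr_sqrtr ?opprK// oppr_ge0 ltW.
  exists (fun t => cos (w * t)), (fun t => sin (w * t) * w^-1).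
  split=> [||t|t]; rewrite ?mulr0 ?cos0 ?sin0 ?mul0r//.
  + eapply is_derive_eq.
      by eapply is_derive_comp; [exact: is_derive_cos|exact: dlin].
    cbv beta; rewrite w2; field; exact: lt0r_neq0.
  + eapply is_derive_eq.
      eapply is_derive_mul; last exact: is_derive_const.
      by eapply is_derive_comp; [exact: is_derive_sin|exact: dlin].
    cbv beta; field; exact: lt0r_neq0.
- pose w := Num.sqrt k.
  have w_gt0 : 0 < w by rewrite sqrtr_gt0.
  have w2 : k = w * w by rewrite -expr2 sqr_sqrtr // ltW.
  have de (v x : R) : is_derive x 1 (fun t => expR (v * t)) (expR (v * x) * v).
    by eapply is_derive_comp; [exact: is_derive_expR|exact: dlin].
  exists (fun t => (expR (w * t) + expR (- w * t)) * 2^-1),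
     (fun t => (expR (w * t) - expR (- w * t)) * (w^-1 * 2^-1)).
  split=> [||t|t]; rewrite ?mulr0 ?expR0 ?subrr ?mul0r//; first by field.
  + eapply is_derive_eq.
      eapply is_derive_mul; last exact: is_derive_const.
      by eapply is_derive_add; exact: de.
    cbv beta; rewrite w2; field; exact: lt0r_neq0.
  + eapply is_derive_eq.
      eapply is_derive_mul; last exact: is_derive_const.
      by eapply is_derive_add; [exact: de|eapply is_derive_opp; exact: de].
    cbv beta; field; exact: lt0r_neq0.
- exists (fun=> 1), id; split=> //= t; last exact: is_derive_self.
  by rewrite mul0r; exact: is_derive_const.
Qed.

(** For a matrix B with trace tr and determinant d, Cayley-Hamilton gives (B - m)^2 = m^2 - d with m
    = tr / 2. Hence exp (t B) = exp (m t) (C + S (B - m)), and the two functions are the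
    coefficients of the identity and of B. *)
Lemma flow_coefficients (tr d : R) : exists f : (R -> R) * (R -> R),
  [/\ f.1 0 = 1, f.2 0 = 0, forall t : R, is_derive t 1 f.1 (- d * f.2 t) &
      forall t : R, is_derive t 1 f.2 (f.1 t + tr * f.2 t)].
Proof.
pose m := tr / 2.
have [C [S [C0 S0 dC dS]]] := harmonic_pair (m ^+ 2 - d).
have de (x : R) : is_derive x 1 (fun t => expR (m * t)) (expR (m * x) * m).
  eapply is_derive_comp; [exact: is_derive_expR|by_rules].
  by rewrite mulr0 addr0 mulr1.
have trE : tr = m + m by rewrite /m; field.
exists (fun t => expR (m * t) * (C t + - (m * S t)), fun t => expR (m * t) * S t).
split=> /= [||t|t]; rewrite ?mulr0 ?expR0 ?C0 ?S0 ?mulr0 ?oppr0 ?mul1r ?addr0//.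
- have dCt := dC t; have dSt := dS t; have det := de t.
  by_rules.
  by ring.
- have dSt := dS t; have det := de t.
  by_rules.
  by rewrite trE; ring.
Qed.

End FlowCoefficients.

(** * Planar linear flows *)

Section PlaneAlgebra.
Variable R : realType.

Record mat2 := Mat2 { m11 : R; m12 : R; m21 : R; m22 : R }.

Implicit Types (A B : mat2) (y z : R * R) (a b k t : R).

Definition act B y : R * R :=
  (m11 B * y.1 + m12 B * y.2, m21 B * y.1 + m22 B * y.2).
Definition tr2 B := m11 B + m22 B.
Definition det2 B := m11 B * m22 B - m12 B * m21 B.
Definition cross y z := y.1 * z.2 - y.2 * z.1.
Definition lin a y b z : R * R := (a * y.1 + b * z.1, a * y.2 + b * z.2).
Definition scale k y : R * R := (k * y.1, k * y.2).

Lemma vec_eq y z : y.1 = z.1 -> y.2 = z.2 -> y = z.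
Proof. by case: y z => [? ?] [? ?] /= -> ->. Qed.

Lemma pair_neq0 y : (y != 0) = (y.1 != 0) || (y.2 != 0).
Proof. by case: y => a b; rewrite -pair_eqE /= negb_and. Qed.

Lemma crossC y z : cross y z = - cross z y.
Proof. by rewrite /cross; ring. Qed.

Lemma crossvv y : cross y y = 0.
Proof. by rewrite /cross; ring. Qed.

Lemma cross_scale k y z : cross (scale k y) z = k * cross y z.
Proof. by rewrite /cross /=; ring. Qed.

Lemma scale_scale a b y : scale a (scale b y) = scale (a * b) y.
Proof. by rewrite /scale /= !mulrA. Qed.

Lemma scale1 y : scale 1 y = y.
Proof. by apply: vec_eq; rewrite /= mul1r. Qed.

Lemma scale_neq0 k y : k != 0 -> y != 0 -> scale k y != 0.
Proof. by rewrite !pair_neq0 /= !mulf_eq0 => /negbTE ->. Qed.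

Lemma act_lin B a y b z : act B (lin a y b z) = lin a (act B y) b (act B z).
Proof. by apply: vec_eq; rewrite /=; ring. Qed.

Lemma act_scale B a y : act B (scale a y) = scale a (act B y).
Proof. by apply: vec_eq; rewrite /=; ring. Qed.

Lemma cross0_scale y z : y != 0 -> cross y z = 0 -> exists k, z = scale k y.
Proof.
rewrite pair_neq0 => /orP[] y0 /eqP; rewrite subr_eq0 => /eqP e.
  exists (z.1 / y.1); apply: vec_eq; rewrite /= ?divfK//.
  by rewrite mulrAC [z.1 * _]mulrC -e mulrAC mulfV// mul1r.
exists (z.2 / y.2); apply: vec_eq; rewrite /= ?divfK//.
by rewrite mulrAC [z.2 * _]mulrC e mulrAC mulfV// mul1r.
Qed.

(** Cramer's rule with the determinant multiplied out, so that it also holds for parallel u and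
    v. *)
Lemma cross_decomp y u v :
  scale (cross u v) y = lin (cross y v) u (cross u y) v.
Proof. by apply: vec_eq; rewrite /cross /=; ring. Qed.

End PlaneAlgebra.

Section Flow.
Variable R : realType.
Implicit Types (A B : mat2 R) (y z : R * R) (a b k s t : R).

Definition flow_coef B := projT1 (cid (flow_coefficients (tr2 B) (det2 B))).
Definition fa B := (flow_coef B).1.
Definition fb B := (flow_coef B).2.

(* Cayley-Hamilton form of the exponential of t B applied to y. *)
Definition E B t y := lin (fa B t) y (fb B t) (act B y).

Lemma flow_coefP B : [/\ fa B 0 = 1, fb B 0 = 0,
   forall t : R, is_derive t 1 (fa B) (- det2 B * fb B t) &
   forall t : R, is_derive t 1 (fb B) (fa B t + tr2 B * fb B t)].
Proof. exact: (projT2 (cid (flow_coefficients (tr2 B) (det2 B)))). Qed.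

Lemma fa0 B : fa B 0 = 1. Proof. by have [] := flow_coefP B. Qed.
Lemma fb0 B : fb B 0 = 0. Proof. by have [] := flow_coefP B. Qed.
Lemma d_fa B t : is_derive t 1 (fa B) (- det2 B * fb B t).
Proof. by have [] := flow_coefP B. Qed.
Lemma d_fb B t : is_derive t 1 (fb B) (fa B t + tr2 B * fb B t).
Proof. by have [] := flow_coefP B. Qed.

Lemma E0 B y : E B 0 y = y.
Proof. by apply: vec_eq; rewrite /= fa0 fb0; ring. Qed.

Lemma E_lin B t a y b z : E B t (lin a y b z) = lin a (E B t y) b (E B t z).
Proof. by apply: vec_eq; rewrite /=; ring. Qed.

Lemma E_scale B t k y : E B t (scale k y) = scale k (E B t y).
Proof. by apply: vec_eq; rewrite /=; ring. Qed.

Lemma act_E B t y : act B (E B t y) = E B t (act B y).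
Proof. by apply: vec_eq; rewrite /=; ring. Qed.

(* The Duhamel rule: differentiating [E B (c - s) z(s)] produces [z' - B z]. *)
Lemma d_E_sub B c s (z1 z2 : R -> R) dz1 dz2 :
  is_derive s 1 z1 dz1 -> is_derive s 1 z2 dz2 ->
  let d := E B (c - s) (lin 1 (dz1, dz2) (-1) (act B (z1 s, z2 s))) in
  is_derive s 1 (fun r => (E B (c - r) (z1 r, z2 r)).1) d.1 /\
  is_derive s 1 (fun r => (E B (c - r) (z1 r, z2 r)).2) d.2.
Proof.
move=> h1 h2.
have dc : is_derive s 1 (fun r : R => c - r) (-1).
  by by_rules; rewrite add0r.
have ha := @is_derive_comp R (fa B) (fun r => c - r) s _ _ (d_fa B (c - s)) dc.
have hb := @is_derive_comp R (fb B) (fun r => c - r) s _ _ (d_fb B (c - s)) dc.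
by split; rewrite /E /lin /act /=; by_rules; rewrite /tr2 /det2; ring.
Qed.

Lemma d_E B t y : is_derive t 1 (fun r => (E B r y).1) (act B (E B t y)).1 /\
  is_derive t 1 (fun r => (E B r y).2) (act B (E B t y)).2.
Proof.
have ha := d_fa B t; have hb := d_fb B t.
by split; rewrite /E /lin /act /=; by_rules; rewrite /tr2 /det2; ring.
Qed.

(** By the Duhamel rule, E B (s + t - r) (E B r y) does not depend on r; the values r = 0 and r = t
    are compared. *)
Lemma E_add B s t y : E B (s + t) y = E B s (E B t y).
Proof.
have H r := d_E_sub B (s + t) (d_E B r y).1 (d_E B r y).2.
have z0 r : lin 1 ((act B (E B r y)).1, (act B (E B r y)).2) (-1)
              (act B ((E B r y).1, (E B r y).2)) = (0, 0).
  by apply: vec_eq; rewrite /=; ring.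
have z1 r : E B r (0, 0) = (0, 0) by apply: vec_eq; rewrite /=; ring.
have h1 : (E B (s + t - 0) ((E B 0 y).1, (E B 0 y).2)).1 =
          (E B (s + t - t) ((E B t y).1, (E B t y).2)).1.
  apply: (@derive0_const R (fun r => (E B (s + t - r) ((E B r y).1, (E B r y).2)).1)).
  by move=> r; have [] := H r; rewrite z0 z1.
have h2 : (E B (s + t - 0) ((E B 0 y).1, (E B 0 y).2)).2 =
          (E B (s + t - t) ((E B t y).1, (E B t y).2)).2.
  apply: (@derive0_const R (fun r => (E B (s + t - r) ((E B r y).1, (E B r y).2)).2)).
  by move=> r; have [] := H r; rewrite z0 z1.
move: h1 h2; rewrite -!surjective_pairing subr0 addrK E0 => h1 h2.
exact: vec_eq.
Qed.

Lemma E_opp B t y : E B (- t) (E B t y) = y.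
Proof. by rewrite -E_add addNr E0. Qed.

Lemma E00 B t : E B t 0 = 0.
Proof. by apply: vec_eq; rewrite /=; ring. Qed.

Lemma E_neq0 B t y : y != 0 -> E B t y != 0.
Proof. by apply: contra_neq => h; rewrite -(E_opp B t y) h E00. Qed.

(** The determinant of the linear map [E B t], as [cross_EE] shows. *)
Definition wronskian B t := fa B t ^+ 2 + tr2 B * fa B t * fb B t + det2 B * fb B t ^+ 2.

Lemma cross_EE B t y z : cross (E B t y) (E B t z) = wronskian B t * cross y z.
Proof. by rewrite /cross /wronskian /tr2 /det2 /=; ring. Qed.

Lemma wronskianD B s t : wronskian B (s + t) = wronskian B s * wronskian B t.
Proof.
have /= := cross_EE B (s + t) (1, 0) (0, 1).
by rewrite !E_add !cross_EE /cross /= mulr1 mulr0 subr0 !mulr1 => ->.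
Qed.

(** Multiplicativity makes it the square of its value at t / 2, and invertibility of the flow makes
    it nonzero. *)
Lemma wronskian_gt0 B t : 0 < wronskian B t.
Proof.
have e : t = t / 2 + t / 2 by field.
have w1 : wronskian B (t + - t) = 1.
  by rewrite subrr /wronskian fa0 fb0; ring.
rewrite lt_def [in X in _ && X]e wronskianD -expr2 sqr_ge0 andbT.
apply/eqP => h; move: w1; rewrite wronskianD h mul0r => /eqP.
by rewrite eq_sym oner_eq0.
Qed.

(** The source of the dichotomy: an arc returns to the line it started from only at a zero of [fb]
    or along an eigenvector. *)
Lemma cross_E B t y : cross (E B t y) y = fb B t * cross (act B y) y.
Proof. by rewrite /cross /=; ring. Qed.

Lemma E_scalar B t y : fb B t = 0 -> E B t y = scale (fa B t) y.
Proof. by move=> h; apply: vec_eq; rewrite /= h; ring. Qed.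

Lemma continuous_E1 B y : continuous (fun t => (E B t y).1).
Proof. by move=> t; apply: is_derive_continuous (d_E B t y).1. Qed.

Lemma continuous_E2 B y : continuous (fun t => (E B t y).2).
Proof. by move=> t; apply: is_derive_continuous (d_E B t y).2. Qed.

(* Sturm separation: the coordinate of the flow transverse to [z] solves the
   same second order equation as [fb], and their Wronskian does not vanish. *)
Lemma flow_sweeps B e y z : 0 < e -> fb B e = 0 ->
  exists2 r, 0 <= r <= e & cross (E B r y) z = 0.
Proof.
move=> e_gt0 fbe.
pose g r := cross (E B r y) z.
have [g0|g0] := eqVneq (g 0) 0; first by exists 0; rewrite ?lexx ?ltW.
apply: contrapT => no.
have gN r : 0 <= r <= e -> g r != 0.
  by move=> re; apply/eqP => gr; apply: no; exists r.
pose dg r := cross (act B (E B r y)) z.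
have d_g (r : R) : is_derive r 1 g (dg r).
  have [h1 h2] := d_E B r y.
  by rewrite /g /cross; by_rules; rewrite /dg /cross; ring.
(* This derivative never vanishes, whereas the quotient is 0 at both ends of [0, e], against Rolle's
   theorem. *)
have d_q (r : R) : 0 <= r <= e ->
    is_derive r 1 (fun r => fb B r * (g r)^-1)
      ((g 0 * wronskian B r) / g r ^+ 2).
  move=> re; have hb := d_fb B r.
  have hi : is_derive r 1 (fun r => (g r)^-1) (- (g r) ^- 2 *: dg r).
    by apply: is_deriveV; exact: gN.
  by_rules; rewrite /GRing.scale /=.
  have gr := gN r re.
  have -> : g 0 * wronskian B r = g r * (fa B r + tr2 B * fb B r) - fb B r * dg r.
    by rewrite /g /dg /wronskian E0 /cross /tr2 /det2 /=; ring.
  by field.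
have [c ce] : exists2 c, c \in `]0, e[ &
     is_derive c 1 (fun r => fb B r * (g r)^-1) 0.
  apply: Rolle => //.
  - move=> x xe; have [] // := d_q x.
    by move: xe; rewrite in_itv /= => /andP[/ltW -> /ltW ->].
  - apply: (@derivable_within_continuous R R _ `[0, e]) => x xe.
    by have [] // := d_q x; rewrite in_itv in xe.
  - by rewrite fb0 fbe !mul0r.
have ce' : 0 <= c <= e by move: ce; rewrite in_itv /= => /andP[/ltW -> /ltW ->].
have [_ e1] := d_q c ce' => -[_]; rewrite e1 => /eqP.
rewrite !mulf_eq0 (negbTE g0) /= gt_eqF ?wronskian_gt0//=.
by rewrite invr_eq0 expf_eq0 /= (negbTE (gN c ce')).
Qed.

End Flow.

Section OneSidedMinimum.
Variable R : realType.

Lemma derive_ge0_at_right_min (f : R -> R) (r D e : R) : 0 < e -> is_derive r 1 f D ->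
  (forall s, r <= s <= r + e -> f r <= f s) -> 0 <= D.
Proof.
move=> e0 [df dfE] hmin; rewrite leNgt; apply/negP => D0.
have : h^-1 *: (f (h *: 1 + r) - f r) @[h --> (0:R)^'] --> D.
  by rewrite -dfE; exact: df.
move=> /cvgrPdist_lt /(_ (- D)); rewrite oppr_gt0 => /(_ D0) [d /= d0 hd].
pose h := Num.min (d / 2) e.
have h0 : 0 < h by rewrite lt_min e0 divr_gt0.
have hd2 : h < d.
  by rewrite gt_min; apply/orP; left; rewrite ltr_pdivrMr// ltr_pMr// ltr1n.
have := hd h; rewrite /= sub0r normrN gtr0_norm// => /(_ hd2); rewrite gt_eqF// => /(_ isT).
have hr : r <= h + r <= r + e.
  by rewrite lerDr ltW//= addrC lerD2l ge_min lexx orbT.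
have := hmin _ hr; rewrite -subr_ge0 => hge.
have : 0 <= h^-1 *: (f (h *: 1 + r) - f r).
  by apply: mulr_ge0; [rewrite invr_ge0 ltW|rewrite /GRing.scale /= mulr1].
set q := _ *: _ => q0.
rewrite ltr0_norm; last by rewrite subr_lt0 (lt_le_trans D0).
by rewrite opprB; move: q0 => q0; rewrite ltrBlDr addNr ltNge q0.
Qed.

Lemma derive_le0_at_left_min (f : R -> R) (r D e : R) : 0 < e -> is_derive r 1 f D ->
  (forall s, r - e <= s <= r -> f r <= f s) -> D <= 0.
Proof.
move=> e0 hf hmin; rewrite -oppr_ge0.
apply: (@derive_ge0_at_right_min (fun s => f (- s)) (- r) _ e e0).
  have hN : is_derive (- r) (1:R) (fun s : R => - s) (-1).
    by by_rules.
  rewrite -[X in is_derive _ _ _ X]mulrN1.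
  apply: (@is_derive_comp R f (fun s => - s) (- r) D (-1)) => //.
  by rewrite opprK.
by move=> s sr; rewrite opprK; apply: hmin; lra.
Qed.

End OneSidedMinimum.

(** * Words, the planar cost and its first variation *)

Section Words.
Variable R : realType.
Variables M1 M2 : mat2 R.
Implicit Types (y z : R * R) (c t s r : R) (p : R * R) (w : seq (R * R)).

Definition mx c := Mat2 (c * m11 M1 + (1 - c) * m11 M2) (c * m12 M1 + (1 - c) * m12 M2)
                        (c * m21 M1 + (1 - c) * m21 M2) (c * m22 M1 + (1 - c) * m22 M2).

(* A word lists pairs (control value, duration). *)
Definition flow w y := foldl (fun z p => E (mx p.1) p.2 z) y w.

Definition dur w := \sum_(p <- w) p.2.

(** [cost] is 3/2 of V in the coordinates (x_1 - x_3, x_2 - x_3), and [bil] is its polar form. *)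
Definition cost y := y.1 ^+ 2 + y.2 ^+ 2 - y.1 * y.2.
Definition bil y z := 2 * y.1 * z.1 + 2 * y.2 * z.2 - y.1 * z.2 - y.2 * z.1.

Lemma flow_cat w1 w2 y : flow (w1 ++ w2) y = flow w2 (flow w1 y).
Proof. exact: foldl_cat. Qed.

Lemma flow_cons p w y : flow (p :: w) y = flow w (E (mx p.1) p.2 y).
Proof. by []. Qed.

Lemma flow_lin w a y b z : flow w (lin a y b z) = lin a (flow w y) b (flow w z).
Proof. by elim: w y z => //= p w IH y z; rewrite E_lin IH. Qed.

Lemma flow_scale w a y : flow w (scale a y) = scale a (flow w y).
Proof. by elim: w y => //= p w IH y; rewrite E_scale IH. Qed.

Lemma flow_neq0 w y : y != 0 -> flow w y != 0.
Proof. by elim: w y => //= p w IH y y0; apply: IH; exact: E_neq0. Qed.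

Lemma flow_basis w y : flow w y = lin y.1 (flow w (1, 0)) y.2 (flow w (0, 1)).
Proof.
rewrite -flow_lin; have {1}-> // : y = lin y.1 (1, 0) y.2 (0, 1).
by apply: vec_eq; rewrite /=; ring.
Qed.

Lemma dur_cat w1 w2 : dur (w1 ++ w2) = dur w1 + dur w2.
Proof. exact: big_cat. Qed.

Lemma dur_cons p w : dur (p :: w) = p.2 + dur w.
Proof. exact: big_cons. Qed.

Lemma dur_nil : dur [::] = 0.
Proof. exact: big_nil. Qed.

Lemma bil_lin x a y b z : bil x (lin a y b z) = a * bil x y + b * bil x z.
Proof. by rewrite /bil /=; ring. Qed.

Lemma bil_scale x a y : bil x (scale a y) = a * bil x y.
Proof. by rewrite /bil /=; ring. Qed.

Lemma bilvv y : bil y y = 2 * cost y.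
Proof. by rewrite /bil /cost; ring. Qed.

Lemma cost_ge0 y : 0 <= cost y.
Proof. rewrite /cost; nra. Qed.

Lemma cost_gt0 y : y != 0 -> 0 < cost y.
Proof.
move=> y0; rewrite lt_def cost_ge0 andbT; apply: contra_neq y0 => h.
have [h1 h2] : y.1 ^+ 2 = 0 /\ y.2 ^+ 2 = 0 by move: h; rewrite /cost; split; nra.
by apply: vec_eq; apply/eqP; rewrite -sqrf_eq0; apply/eqP.
Qed.

(* The variation of the cost when the junction between the arcs c and c' slides,
   their total duration S being fixed. *)
Lemma d_transfer w c c' S y r :
  let z := E (mx c) r y in
  let v := lin 1 (act (mx c) z) (-1) (act (mx c') z) in
  is_derive r 1 (fun r => cost (flow w (E (mx c') (S - r) (E (mx c) r y))))
    (bil (flow w (E (mx c') (S - r) z)) (flow w (E (mx c') (S - r) v))).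
Proof.
move=> z v; have [h1 h2] := d_E (mx c) r y.
have [k1 k2] := @d_E_sub _ (mx c') S r _ _ _ _ h1 h2.
have eE s : E (mx c') (S - s) (E (mx c) s y) =
   E (mx c') (S - s) ((E (mx c) s y).1, (E (mx c) s y).2).
  by rewrite -surjective_pairing.
have ev : lin 1 ((act (mx c) (E (mx c) r y)).1, (act (mx c) (E (mx c) r y)).2) (-1)
   (act (mx c') ((E (mx c) r y).1, (E (mx c) r y).2)) = v.
  by rewrite /v /z -!surjective_pairing.
rewrite ev in k1 k2.
set f := (fun r : R => _).
pose g1 s := (E (mx c') (S - s) ((E (mx c) s y).1, (E (mx c) s y).2)).1.
pose g2 s := (E (mx c') (S - s) ((E (mx c) s y).1, (E (mx c) s y).2)).2.
pose a := flow w (1, 0); pose b := flow w (0, 1).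
(* Expanding the rest of the word on the standard basis makes the cost a polynomial in the
   coordinates [g1] and [g2], whose derivatives are known. *)
have -> : f = (fun s => (g1 s * a.1 + g2 s * b.1) * (g1 s * a.1 + g2 s * b.1) +
               (g1 s * a.2 + g2 s * b.2) * (g1 s * a.2 + g2 s * b.2) +
           - ((g1 s * a.1 + g2 s * b.1) * (g1 s * a.2 + g2 s * b.2))).
  apply/funext => s; rewrite /f eE flow_basis -/a -/b -/(g1 s) -/(g2 s).
  by rewrite /cost /=; ring.
rewrite /z eE (flow_basis w (E _ _ (_, _))) (flow_basis w (E _ _ v)).
rewrite -/a -/b -/(g1 r) -/(g2 r) /bil.
rewrite -/(g1) -/g2 in k1 k2.
by_rules; cbn [fst snd lin]; ring.
Qed.

End Words.

(** * The degenerate case in which two arcs suffice *)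

Section ParallelImages.
Variable R : realType.
Implicit Types (A B : mat2 R) (y z xi : R * R) (h s t : R).

Definition shift h A y := lin 1 (act A y) (- h) y.

(** Put P = A - h and Q = B - h. Evaluation at three vectors gives the polarised identities [e1],
    [e2], [e3] between columns. If the first column of P is nonzero, some Q - k P has first column 0
    and second column r times the first column of P, and [e2] becomes r det P = 0: either Q = k P,
    or P has rank one and Q maps into the same line. *)
Lemma parallel_images A B h :
  (forall y, cross (shift h A y) (shift h B y) = 0) ->
  (forall y, act A (act B y) = act B (act A y)) \/
  exists2 xi, xi != 0 &
    forall y, cross xi (shift h A y) = 0 /\ cross xi (shift h B y) = 0.
Proof.
case: A => a11 a12 a21 a22; case: B => b11 b12 b21 b22; rewrite /shift /lin /act /= => H.
have h1 := H (1, 0); have h2 := H (0, 1); have h3 := H (1, 1).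
rewrite /cross /= in h1 h2 h3.
have e1 : cross (a11 - h, a21) (b11 - h, b21) = 0 by rewrite /cross /=; lra.
have e2 : cross (a12, a22 - h) (b12, b22 - h) = 0 by rewrite /cross /=; lra.
have e3 : cross (a11 - h, a21) (b12, b22 - h) + cross (a12, a22 - h) (b11 - h, b21) = 0.
  by rewrite /cross /=; lra.
have crossE (u : R * R) (p11 p12 p21 p22 : R) y : cross u (p11, p21) = 0 ->
    cross u (p12, p22 - h) = 0 ->
    cross u (1 * ((h + p11) * y.1 + p12 * y.2) + - h * y.1,
             1 * (p21 * y.1 + p22 * y.2) + - h * y.2) = 0.
  move=> c1 c2; transitivity (y.1 * cross u (p11, p21) + y.2 * cross u (p12, p22 - h)).
    by rewrite /cross /=; ring.
  by rewrite c1 c2 !mulr0 addr0.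
have ehD (x : R) : x = h + (x - h) by ring.
have [m1|m1] := eqVneq (a11 - h, a21) 0.
  case: m1 => m11 m21; have [m2|m2] := eqVneq (a12, a22 - h) 0.
    case: m2 => m12 m22; left => y; apply: vec_eq => /=;
    by rewrite (ehD a11) (ehD a22) m11 m12 m21 m22; ring.
  right; exists (a12, a22 - h) => // y.
  rewrite m11 m21 [X in X + _]/cross /= !mul0r subrr add0r in e3.
  by rewrite {1}(ehD a11) {1}(ehD b11); split; apply: crossE;
    rewrite // /cross /= ?m11 ?m21; ring.
have [k [k1 k2]] := cross0_scale m1 e1.
have e4 : cross (a11 - h, a21) (b12 - k * a12, b22 - h - k * (a22 - h)) = 0.
  by rewrite k1 k2 in e3; rewrite /cross /= in e3 *; lra.
have [r [r1 r2]] := cross0_scale m1 e4.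
rewrite /= in k1 k2 r1 r2.
have b11E : b11 = h + k * (a11 - h) by lra.
have b12E : b12 = k * a12 + r * (a11 - h) by lra.
have b22E : b22 = h + k * (a22 - h) + r * a21 by lra.
have : r * cross (a12, a22 - h) (a11 - h, a21) = 0.
  by move: e2; rewrite b12E b22E /cross /=; lra.
move=> /eqP; rewrite mulf_eq0 => /orP[/eqP r0|/eqP m12].
  by left => y; apply: vec_eq => /=; rewrite b11E b12E b22E k2 r0; ring.
right; exists (a11 - h, a21) => // y.
rewrite {2}(ehD a11) {1}(ehD b11); split; apply: crossE.
- exact: crossvv.
- by rewrite crossC m12 oppr0.
- by rewrite /cross /= k2 k1; ring.
- rewrite b12E b22E; move: m12; rewrite /cross /= => m12.
  by transitivity (- (k * 0)); [rewrite -m12; ring|rewrite mulr0 oppr0].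
Qed.

Lemma E_commute A B s t y : (forall z, act A (act B z) = act B (act A z)) ->
  E A s (E B t y) = E B t (E A s y).
Proof.
move=> AB; have actE z : act B (E A s z) = E A s (act B z).
  by rewrite /E act_lin AB.
by rewrite [E B t y]/E E_lin -actE.
Qed.

(** Here h is an eigenvalue of B and the left side is the corresponding eigenvalue of the
    exponential. *)
Lemma exp_flow B h t : h ^+ 2 - tr2 B * h + det2 B = 0 ->
  fa B t + h * fb B t = expR (h * t).
Proof.
move=> hh; have de (x : R) : is_derive x 1 (fun t => expR (- h * t)) (- h * expR (- h * x)).
  rewrite mulrC; apply: (@is_derive_comp R expR (fun t => - h * t)).
  by by_rules; ring.
have : (fa B t + h * fb B t) * expR (- h * t) = (fa B 0 + h * fb B 0) * expR (- h * 0).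
  apply: (@derive0_const R (fun t => (fa B t + h * fb B t) * expR (- h * t))) => x.
  have ha := d_fa B x; have hb := d_fb B x; have hc := de x.
  by_rules; transitivity (- (h ^+ 2 - tr2 B * h + det2 B) * fb B x * expR (- h * x)).
    by ring.
  by rewrite hh oppr0 !mul0r.
rewrite fa0 fb0 !mulr0 addr0 expR0 mulr1 => /(congr1 ( *%R^~ (expR (h * t)))) /=.
by rewrite mul1r -mulrA -expRD mulNr addNr expR0 mulr1.
Qed.

(** A real eigenvalue h excludes oscillation: with k the other eigenvalue, fb exp (- k t) has
    derivative exp ((h - k) t). *)
Lemma fb_ge0 B h t : h ^+ 2 - tr2 B * h + det2 B = 0 -> 0 <= t -> 0 <= fb B t.
Proof.
move=> hh t0; pose k := tr2 B - h.
have de (x : R) : is_derive x 1 (fun t => expR (- k * t)) (- k * expR (- k * x)).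
  rewrite mulrC; apply: (@is_derive_comp R expR (fun t => - k * t)).
  by by_rules; ring.
have dg (x : R) : is_derive x 1 (fun t => fb B t * expR (- k * t)) (expR (h * x) * expR (- k * x)).
  have hb := d_fb B x; have hc := de x.
  by by_rules; rewrite -(exp_flow _ hh) /k; ring.
have [c _] := mean_value dg t0.
rewrite fb0 mul0r !subr0 => e.
by rewrite -(pmulr_lge0 _ (expR_gt0 (- k * t))) e !mulr_ge0 ?expR_ge0.
Qed.

Lemma IVT_between (f : R -> R) (a b v : R) : a <= b -> continuous f ->
  (f a <= v <= f b) || (f b <= v <= f a) -> exists2 c, a <= c <= b & f c = v.
Proof.
move=> ab cf hv; have [|c cab fc] := @IVT R f a b v ab (continuous_subspaceT cf).
  by rewrite ge_min le_max; case/orP: hv => /andP[-> ->]; rewrite ?orbT.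
by exists c.
Qed.

Lemma continuous_EE A B S y : continuous (fun r => (E B (S - r) (E A r y)).1) /\
  continuous (fun r => (E B (S - r) (E A r y)).2).
Proof.
have eE r : E B (S - r) (E A r y) = E B (S - r) ((E A r y).1, (E A r y).2).
  by rewrite -surjective_pairing.
split.
  have -> : (fun r => (E B (S - r) (E A r y)).1) =
    (fun r => (E B (S - r) ((E A r y).1, (E A r y).2)).1).
    by apply/funext => r; rewrite eE.
  by move=> r; apply: is_derive_continuous (d_E_sub B S (d_E A r y).1 (d_E A r y).2).1.
have -> : (fun r => (E B (S - r) (E A r y)).2) =
  (fun r => (E B (S - r) ((E A r y).1, (E A r y).2)).2).
  by apply/funext => r; rewrite eE.
by move=> r; apply: is_derive_continuous (d_E_sub B S (d_E A r y).1 (d_E A r y).2).2.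
Qed.

(* When both shifted matrices map into the line of [xi], the flows preserve up
   to the same factor the coordinate transverse to [xi], so that all endpoints
   reached at a given time lie on one line. Sliding the middle arc moves the
   endpoint monotonically along that line, hence it stays between the
   endpoints of two two-arc words. *)
Lemma two_arcs_suffice_common_image A B h xi t1 t2 t3 y :
  xi != 0 -> (forall z, cross xi (shift h A z) = 0 /\ cross xi (shift h B z) = 0) ->
  0 <= t1 -> 0 <= t2 -> 0 <= t3 ->
  exists r, [/\ 0 <= r, r <= t1 + t2 + t3 &
    E A t3 (E B t2 (E A t1 y)) = E A (t1 + t2 + t3 - r) (E B r y) \/
    E A t3 (E B t2 (E A t1 y)) = E B (t1 + t2 + t3 - r) (E A r y)].
Proof.
move=> xi0 H t10 t20 t30.
(* [xi] and [J] form an orthogonal basis; [u] and [p] are n times the coordinates along [xi] and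
   [J]. *)
pose J : R * R := (- xi.2, xi.1).
pose n := xi.1 ^+ 2 + xi.2 ^+ 2.
have n0 : n != 0.
  rewrite /n paddr_eq0 ?sqr_ge0// !sqrf_eq0 negb_and.
  by move: xi0; rewrite pair_neq0.
pose p := cross xi; pose u z := xi.1 * z.1 + xi.2 * z.2.
have pJ : p J = n by rewrite /p /cross /J /n /=; ring.
have decomp z : scale n z = lin (u z) xi (p z) J.
  by apply: vec_eq; rewrite /n /u /p /J /cross /=; ring.
have inj z z' : p z = p z' -> u z = u z' -> z = z'.
  move=> e1 e2; have : scale n z = scale n z' by rewrite !decomp e1 e2.
  by move=> [/(mulfI n0) h1 /(mulfI n0) h2]; apply: vec_eq.
have pact C z : (forall z, p (shift h C z) = 0) -> p (act C z) = h * p z.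
  move=> HC; have := HC z; rewrite /shift /p => e.
  by apply/eqP; rewrite -subr_eq0 -e; apply/eqP; rewrite /cross /=; ring.
have charC C : (forall z, p (shift h C z) = 0) -> h ^+ 2 - tr2 C * h + det2 C = 0.
  move=> HC; apply: (mulIf n0); rewrite mul0r -pJ.
  transitivity (p (act C (act C J)) - tr2 C * p (act C J) + det2 C * p J).
    by rewrite !pact//; ring.
  by rewrite /p /cross /tr2 /det2 /=; ring.
have pE C t z : (forall z, p (shift h C z) = 0) -> p (E C t z) = expR (h * t) * p z.
  move=> HC; rewrite -(exp_flow _ (charC _ HC)).
  transitivity (fa C t * p z + fb C t * p (act C z)); last by rewrite pact//; ring.
  by rewrite /p /cross /=; ring.
have HA z : p (shift h A z) = 0 by have [] := H z.
have HB z : p (shift h B z) = 0 by have [] := H z.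
have [eA AxiE] : exists eA, act A xi = scale eA xi.
  by apply: cross0_scale => //; have := pact A xi HA; rewrite /p crossvv mulr0.
have charA : eA ^+ 2 - tr2 A * eA + det2 A = 0.
  have : scale (eA ^+ 2 - tr2 A * eA + det2 A) xi = 0.
    transitivity (lin 1 (act A (act A xi)) 1 (lin (- tr2 A) (act A xi) (det2 A) xi)).
      by rewrite AxiE act_scale AxiE; apply: vec_eq => /=; ring.
    by apply: vec_eq; rewrite /tr2 /det2 /=; ring.
  move=> h0; apply/eqP; apply: contraT => ne; have := scale_neq0 ne xi0.
  by rewrite h0 eqxx.
have EAxi t : E A t xi = scale (expR (eA * t)) xi.
  by rewrite -(exp_flow _ charA) /E AxiE; apply: vec_eq => /=; ring.
have [eB BxiE] : exists eB, act B xi = scale eB xi.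
  by apply: cross0_scale => //; have := pact B xi HB; rewrite /p crossvv mulr0.
pose comm z := lin 1 (act B (act A z)) (-1) (act A (act B z)).
have comm_xi : comm xi = 0.
  by rewrite /comm AxiE BxiE !act_scale AxiE BxiE; apply: vec_eq => /=; ring.
have [k commE] : exists k, forall z, comm z = scale (k * p z) xi.
  have [k kE] : exists k, comm J = scale k xi.
    apply: cross0_scale => //; transitivity (p (act B (act A J)) - p (act A (act B J))).
      by rewrite /p /cross /=; ring.
    by rewrite !pact// subrr.
  exists (k / n) => z.
  have : scale n (comm z) = scale n (scale (k / n * p z) xi).
    transitivity (lin (u z) (comm xi) (p z) (comm J)).
      transitivity (comm (scale n z)); first by apply: vec_eq => /=; ring.
      by rewrite decomp; apply: vec_eq => /=; ring.
    by rewrite comm_xi kE; apply: vec_eq => /=; field.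
  by move=> [/(mulfI n0) h1 /(mulfI n0) h2]; apply: vec_eq.
(* The commutator maps into the line of [xi] and sees only the transverse coordinate, so exchanging
   two arcs displaces the endpoint along [xi] by a computable amount. *)
have swap s t z : E B t (E A s z) =
    lin 1 (E A s (E B t z)) (fb A s * fb B t * (k * p z)) xi.
  transitivity (lin 1 (E A s (E B t z)) (fb A s * fb B t) (comm z)).
    by rewrite /comm; apply: vec_eq => /=; ring.
  by rewrite commE; apply: vec_eq => /=; ring.
set S := t1 + t2 + t3.
pose X := E A S y; pose W := E A t3 (E B t2 (E A t1 y)).
pose W0 := E A (S - t2) (E B t2 y); pose W1 := E B t2 (E A (S - t2) y).
have StE : S - t2 = t3 + t1 by rewrite /S; ring.
pose d := k * p y.
(* [c0 * d] and [c1 * d] are the displacements of [u] from [W0] to [W] and from [W] to [W1]. Both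
   coefficients are nonnegative, so [W] lies between the two. *)
pose c0 := fb A t1 * fb B t2 * expR (eA * t3) * n.
pose c1 := fb A t3 * fb B t2 * expR (h * t1) * n.
have n_ge0 : 0 <= n by rewrite /n addr_ge0 ?sqr_ge0.
have c0_ge0 : 0 <= c0.
  by rewrite /c0 !mulr_ge0 ?expR_ge0 ?(fb_ge0 (charC _ HA)) ?(fb_ge0 (charC _ HB)).
have c1_ge0 : 0 <= c1.
  by rewrite /c1 !mulr_ge0 ?expR_ge0 ?(fb_ge0 (charC _ HA)) ?(fb_ge0 (charC _ HB)).
have u0 : u W = u W0 + c0 * d.
  rewrite /W swap E_lin EAxi -E_add -StE -/W0 /c0 /d /u /n /=; ring.
have u1 : u W1 = u W + c1 * d.
  rewrite /W1 StE E_add swap pE// -/W /c1 /d /u /n /=; ring.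
have between : (u W0 <= u W <= u W1) || (u W1 <= u W <= u W0).
  have [d0|d0] := leP 0 d; apply/orP; [left|right].
    have := mulr_ge0 c0_ge0 d0; have := mulr_ge0 c1_ge0 d0; lra.
  have := mulr_ge0_le0 c0_ge0 (ltW d0); have := mulr_ge0_le0 c1_ge0 (ltW d0); lra.
have S2 : t2 <= S by rewrite /S; lra.
have cont C D : continuous (fun r => u (E D (S - r) (E C r y))).
  move=> r; have [h1 h2] := continuous_EE C D S y.
  by apply: cvgD; apply: cvgM; [exact: cvg_cst|exact: h1|exact: cvg_cst|exact: h2].
have pW C D r : (forall z, p (shift h C z) = 0) -> (forall z, p (shift h D z) = 0) ->
    p (E D (S - r) (E C r y)) = p W.
  move=> HC HD; rewrite /W !pE// !mulrA -!expRD; congr (expR _ * _).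
  by rewrite /S; ring.
(* The one-arc endpoint [X] is common to the two families of two-arc words, which lead from it to
   [W0] and to [W1]. Wherever [X] lies on the line, one family passes through [W]. *)
have [W0X|XW1] : ((u W0 <= u W <= u X) || (u X <= u W <= u W0)) \/
                 ((u X <= u W <= u W1) || (u W1 <= u W <= u X)).
- by case/orP: between => /andP[-> ->]; have [_|/ltW ->] := leP (u X) (u W);
    rewrite ?andbT ?orbT; by [left|right].
- have [|r /andP[r0 r1] ur] := @IVT_between (fun r => u (E A (S - r) (E B r y))) 0 t2 (u W) t20 (cont B A).
    by rewrite subr0 E0 -/X -/W0 orbC.
  exists r; split=> //; first exact: le_trans S2.
  by left; apply: inj => //; rewrite pW.
- have St2 : S - t2 <= S by rewrite gerBl.
  have [|r /andP[r0 r1] ur] := @IVT_between (fun r => u (E B (S - r) (E A r y))) (S - t2) S (u W) St2 (cont A B).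
    by rewrite subKr subrr E0 -/X -/W1 orbC.
  exists r; split=> //; first by lra.
  by right; apply: inj => //; rewrite pW.
Qed.

End ParallelImages.

(** * Extremal bang-bang words *)

Section BestWords.
Variable R : realType.
Variables (M1 M2 : mat2 R) (T : R) (y0 : R * R).
Hypothesis y0_neq0 : y0 != 0.
Implicit Types (y z : R * R) (c t s r h : R) (p l : R * R) (w : seq (R * R)).
Local Notation flow := (flow M1 M2).
Local Notation mx := (mx M1 M2).

Definition is_bang c := (c == 0) || (c == 1).
Definition arc_ok p := is_bang p.1 && (0 <= p.2).
Definition isbb w := all arc_ok w && (dur w == T).
Definition val w := cost (flow w y0).

Definition best w := [/\ isbb w,
  forall w', isbb w' -> (size w' <= size w)%N -> val w <= val w' &
  forall w', isbb w' -> (size w' < size w)%N -> val w < val w'].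

Lemma isbb_perm w w' : perm_eq w w' -> isbb w -> isbb w'.
Proof.
by move=> pe; rewrite /isbb (perm_all _ pe) /dur (perm_big _ pe).
Qed.

Lemma best_perm w w' : best w -> perm_eq w w' -> flow w' y0 = flow w y0 -> best w'.
Proof.
move=> [h1 h2 h3] pe e; split; rewrite /val ?e -?(perm_size pe)//.
exact: isbb_perm pe h1.
Qed.

(** Every surgery below ends here: reaching the same endpoint with fewer arcs is impossible. *)
Lemma best_size w w' : best w -> isbb w' -> flow w' y0 = flow w y0 -> (size w <= size w')%N.
Proof.
move=> [h1 h2 h3] b e; rewrite leqNgt; apply/negP => /(h3 _ b).
by rewrite /val e ltxx.
Qed.

Lemma best_all w : best w -> all arc_ok w.
Proof. by case=> /andP[]. Qed.

Lemma bang_opp c c' : is_bang c -> is_bang c' -> c != c' -> c' = 1 - c.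
Proof.
move=> /orP[]/eqP -> /orP[]/eqP ->; rewrite ?eqxx// => _; ring.
Qed.

Lemma best_adjacent w1 p p' w2 : best (w1 ++ p :: p' :: w2) -> p'.1 = 1 - p.1.
Proof.
move=> b; have := best_all b; rewrite all_cat /= => /and4P[h1 /andP[hp hp2] /andP[hp' hp2'] h2].
apply: bang_opp => //; apply/eqP => e.
have := @best_size _ (w1 ++ (p.1, p.2 + p'.2) :: w2) b.
rewrite !size_cat /= !addnS ltnn => H; apply: (notF (H _ _)).
- have [/andP[_ /eqP d] _ _] := b.
  rewrite /isbb all_cat /= h1 h2 /arc_ok /= hp addr_ge0//=; apply/eqP.
  by rewrite -d !dur_cat !dur_cons /=; ring.
- by rewrite !flow_cat !flow_cons /= [p.2 + _]addrC E_add e.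
Qed.

Lemma best_pos w1 p w2 : best (w1 ++ p :: w2) -> 0 < p.2.
Proof.
move=> b; have := best_all b; rewrite all_cat /= => /and3P[h1 /andP[hp hp2] h2].
rewrite lt_def hp2 andbT; apply/eqP => e.
have := @best_size _ (w1 ++ w2) b.
rewrite !size_cat /= addnS ltnn => H; apply: (notF (H _ _)).
- have [/andP[_ /eqP d] _ _] := b.
  by rewrite /isbb all_cat /= h1 h2 /= -d !dur_cat dur_cons e add0r.
- by rewrite !flow_cat !flow_cons e E0.
Qed.

(** Both arcs at the junction have positive duration, so the junction may slide in either direction
    and the derivative given by [d_transfer] vanishes. *)
Lemma best_switch w1 p p' w2 (w := w1 ++ p :: p' :: w2) (y := flow (w1 ++ [:: p]) y0) :
  best w ->
  bil (flow w y0) (flow (p' :: w2) (act (mx p.1) y)) =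
  bil (flow w y0) (flow (p' :: w2) (act (mx p'.1) y)).
Proof.
case: p p' @w @y => [c t] [c' t'] w y b.
have t0 : 0 < t := best_pos b.
have t'0 : 0 < t'.
  by have := @best_pos (w1 ++ [:: (c, t)]) (c', t') w2; rewrite -catA; apply.
have := @d_transfer R M1 M2 w2 c c' (t + t') (flow w1 y0) t.
cbv zeta; set z := E (mx c) t _; set v := lin 1 _ _ _ => hd.
have tt : t + t' - t = t' by ring.
have yz : y = z by rewrite /y flow_cat.
have wz : flow w y0 = flow w2 (E (mx c') (t + t' - t) z).
  by rewrite /w flow_cat !flow_cons tt.
have hmin s : 0 <= s -> s <= t + t' ->
    cost (flow w2 (E (mx c') (t + t' - t) (E (mx c) t (flow w1 y0)))) <=
    cost (flow w2 (E (mx c') (t + t' - s) (E (mx c) s (flow w1 y0)))).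
  move=> s0 s1; have [bb bmin _] := b.
  rewrite -/z -wz; have := bmin (w1 ++ (c, s) :: (c', t + t' - s) :: w2).
  rewrite /val !flow_cat !flow_cons /= !size_cat /= leqnn => -> //.
  move: bb; rewrite /isbb !all_cat /= !dur_cat !dur_cons /arc_ok /=.
  move=> /andP[/and4P[-> /andP[-> _] /andP[-> _] ->]] /eqP <-.
  by rewrite s0 subr_ge0 s1 /=; apply/eqP; ring.
set D := bil _ _ in hd.
have D0 : D = 0.
  apply: le_anti; apply/andP; split.
    by apply: (derive_le0_at_left_min t0 hd) => s ?; apply: hmin; lra.
  by apply: (derive_ge0_at_right_min t'0 hd) => s ?; apply: hmin; lra.
apply/eqP; rewrite -subr_eq0 -D0 /D -wz tt /v E_lin flow_lin bil_lin yz !flow_cons /=.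
by apply/eqP; ring.
Qed.

Definition J w k := flow (take k w) y0.

Lemma J_neq0 w k : J w k != 0.
Proof. exact: flow_neq0. Qed.

Lemma J_drop w k : flow (drop k w) (J w k) = flow w y0.
Proof. by rewrite /J -flow_cat cat_take_drop. Qed.

Lemma J_succ w k : (k < size w)%N ->
  J w k.+1 = E (mx (nth 0 w k).1) (nth 0 w k).2 (J w k).
Proof. by move=> kw; rewrite /J (take_nth 0 kw) -cats1 flow_cat. Qed.

Lemma split_nth w k : (k < size w)%N -> w = take k w ++ nth 0 w k :: drop k.+1 w.
Proof. by move=> kw; rewrite -drop_nth// cat_take_drop. Qed.

Lemma split_nth2 w k : (k.+1 < size w)%N ->
  w = take k w ++ nth 0 w k :: nth 0 w k.+1 :: drop k.+2 w.
Proof. by move=> kw; rewrite -!drop_nth ?cat_take_drop// ltnW. Qed.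

Lemma best_nth w k : best w -> (k < size w)%N -> is_bang (nth 0 w k).1 /\ 0 < (nth 0 w k).2.
Proof.
move=> b kw; split; last first.
  by have b' := b; rewrite (split_nth kw) in b'; exact: best_pos b'.
by have /andP[] := all_nthP 0 (best_all b) _ kw.
Qed.

Lemma best_alternate w k : best w -> (k.+1 < size w)%N ->
  (nth 0 w k.+1).1 = 1 - (nth 0 w k).1.
Proof.
by move=> b kw; have b' := b; rewrite (split_nth2 kw) in b'; exact: best_adjacent b'.
Qed.

Lemma bil_gt0 w : 0 < bil (flow w y0) (flow w y0).
Proof. by rewrite bilvv mulr_gt0// cost_gt0// flow_neq0. Qed.

(* [bil (flow w y0) (flow (drop k w) z)] is the pairing of z with the adjoint
   state at the k-th junction, and h is the maximised Hamiltonian. *)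
Lemma best_hamiltonian w : best w -> exists h, forall k c, (0 < k < size w)%N -> is_bang c ->
  bil (flow w y0) (flow (drop k w) (act (mx c) (J w k))) =
  h * bil (flow w y0) (flow w y0).
Proof.
move=> b; set yT := flow w y0.
pose H c k := bil yT (flow (drop k w) (act (mx c) (J w k))).
have sw k : (0 < k < size w)%N -> forall c c', is_bang c -> is_bang c' -> H c k = H c' k.
  case: k => // k /= kw; have b2 := b; rewrite (split_nth2 kw) in b2.
  have := best_switch b2.
  rewrite -(split_nth2 kw) -/yT cats1 -take_nth; last exact: ltnW.
  rewrite -/(J w k.+1) -drop_nth// (best_alternate b kw).
  have [+ _] := best_nth b (ltnW kw).
  rewrite -/(H _ _) => /orP[]/eqP -> e c c' /orP[]/eqP -> /orP[]/eqP -> //;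
  by move: e; rewrite -/(H _ _) ?subr0 ?subrr.
(* Along an arc the flow commutes with its own generator, so the pairing for the type of that arc is
   the same at both ends; [sw] exchanges the types at each end. *)
have st k : (0 < k)%N -> (k.+1 < size w)%N -> H 0 k.+1 = H 0 k.
  move=> k0 kw; have [hc _] := best_nth b (ltnW kw).
  have z0 : is_bang 0 by rewrite /is_bang eqxx.
  rewrite (sw k.+1 _ 0 _ z0 hc)// (sw k _ 0 _ z0 hc) ?k0 1?ltnW//.
  by rewrite /H (drop_nth 0 (ltnW kw)) flow_cons -act_E -J_succ// ltnW.
have Hk k : (0 < k < size w)%N -> H 0 k = H 0 1%N.
  case: k => // k /=; elim: k => // k IH kw.
  by rewrite st// IH// ltnW.
(* Dividing by the pairing of the adjoint with the state, which is constant, turns the Hamiltonian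
   into a scalar that can be subtracted from the matrices. *)
exists (H 0 1%N / bil yT yT) => k c kw hc.
rewrite divfK ?gt_eqF ?bil_gt0// -(Hk k kw) -/(H c k).
by apply: sw => //; rewrite /is_bang eqxx.
Qed.

Definition q h z := cross (shift h (mx 0) z) (shift h (mx 1) z).

Lemma q_scale h k z : q h (scale k z) = k ^+ 2 * q h z.
Proof. by rewrite /q /shift /cross /=; ring. Qed.

(** The vectors u and v lie in the kernel of a nonzero linear functional on the plane. *)
Lemma functional_cross x w u v y :
  bil x (flow w u) = 0 -> bil x (flow w v) = 0 -> bil x (flow w y) != 0 -> cross u v = 0.
Proof.
move=> hu hv hy; have := congr1 (fun z => bil x (flow w z)) (cross_decomp y u v).
rewrite /= flow_scale bil_scale flow_lin bil_lin hu hv !mulr0 addr0 => /eqP.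
by rewrite mulf_eq0 (negbTE hy) orbF => /eqP.
Qed.

Lemma best_q w h : (forall k c, (0 < k < size w)%N -> is_bang c ->
  bil (flow w y0) (flow (drop k w) (act (mx c) (J w k))) =
  h * bil (flow w y0) (flow w y0)) ->
  forall k, (0 < k < size w)%N -> q h (J w k) = 0.
Proof.
move=> H k kw; have bJ : bil (flow w y0) (flow (drop k w) (J w k)) != 0.
  by rewrite J_drop gt_eqF// bil_gt0.
apply: (functional_cross _ _ bJ);
  by rewrite /shift flow_lin bil_lin H// ?J_drop /is_bang ?eqxx ?orbT//; ring.
Qed.

(** In the basis u, v the form is [a * b * pol]; a further zero off both axes forces [pol] to
    vanish. *)
Lemma q_three_directions h u v z : q h u = 0 -> q h v = 0 -> q h z = 0 ->
  cross u v != 0 -> cross u z != 0 -> cross v z != 0 -> forall y, q h y = 0.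
Proof.
move=> qu qv qz uv uz vz.
pose pol := cross (shift h (mx 0) u) (shift h (mx 1) v) +
            cross (shift h (mx 0) v) (shift h (mx 1) u).
have q_lin a b : q h (lin a u b v) = a * b * pol.
  transitivity (a ^+ 2 * q h u + b ^+ 2 * q h v + a * b * pol).
    by rewrite /q /pol /shift /cross /=; ring.
  by rewrite qu qv !mulr0 !add0r.
have pol0 : pol = 0.
  have := q_lin (cross z v) (cross u z); rewrite -cross_decomp q_scale qz mulr0.
  move=> /esym/eqP; rewrite mulf_eq0 => /orP[|/eqP//].
  by rewrite mulf_eq0 (crossC z) oppr_eq0 (negbTE vz) (negbTE uz).
move=> y; have := q_lin (cross y v) (cross u y).
rewrite -cross_decomp q_scale pol0 mulr0 => /eqP.
by rewrite mulf_eq0 expf_eq0 /= (negbTE uv) => /eqP.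
Qed.

(** Otherwise the first three arcs could be replaced by two with the same total duration and
    endpoint: either the matrices commute and the two arcs of equal type merge, or
    [two_arcs_suffice_common_image] applies. *)
Lemma q_neq0 w h : best w -> (2 < size w)%N -> ~ (forall y, q h y = 0).
Proof.
move=> b; case: w b => [|[a t1] [|[b t2] [|[a' t3] w]]]//= bw _ q0.
have := @best_alternate _ 1%N bw isT; have := @best_alternate _ 0%N bw isT.
rewrite /= => e2 e1; have {e1}a'E : a' = a by rewrite e1 e2; ring.
subst a'; have [/andP[al /eqP dT] _ _] := bw.
move: al => /= /and4P[/andP[/= ha t10] /andP[/= hb t20] /andP[/= _ t30] al].
have main r s c c' : is_bang c -> is_bang c' -> 0 <= r -> 0 <= s -> r + s = t1 + t2 + t3 ->
    E (mx a) t3 (E (mx b) t2 (E (mx a) t1 y0)) <> E (mx c') s (E (mx c) r y0).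
  move=> hc hc' r0 s0 rs e.
  have := @best_size _ [:: (c, r), (c', s) & w] bw.
  rewrite /= ltnn => H; apply: (notF (H _ _)).
    rewrite /isbb /= /arc_ok /= hc hc' r0 s0 al -dT !dur_cons /=; apply/eqP.
    by rewrite addrA rs; ring.
  by rewrite /= e.
have : (forall y, act (mx a) (act (mx b) y) = act (mx b) (act (mx a) y)) \/
  exists2 xi, xi != 0 & forall y, cross xi (shift h (mx a) y) = 0 /\ cross xi (shift h (mx b) y) = 0.
  have [c01|[xi xi0 H]] := parallel_images q0.
    left; move: ha hb e2 => /orP[]/eqP -> /orP[]/eqP -> //.
  by right; exists xi => // y; have [? ?] := H y;
    move: ha hb e2 => /orP[]/eqP -> /orP[]/eqP -> //.
move=> [comm|[xi xi0 H]].
  apply: (@main (t1 + t3) t2 a b) => //; first exact: addr_ge0.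
    by ring.
  by rewrite -E_commute// -E_add addrC.
have [r [r0 r1 [e|e]]] := two_arcs_suffice_common_image y0 xi0 H t10 t20 t30.
- by apply: (main _ _ _ _ hb ha r0 _ _ e); rewrite ?subr_ge0// addrC subrK.
- by apply: (main _ _ _ _ ha hb r0 _ _ e); rewrite ?subr_ge0// addrC subrK.
Qed.

(** Both [w2] and [l] only scale the state reached after [w1], so they may be exchanged and the new
    word is still best. Now [l] and the first arc of [w2] have each followed the last arc of [w1],
    hence have the same type, yet they are adjacent. *)
Lemma best_loop_before w1 w2 l w3 : best (w1 ++ w2 ++ l :: w3) ->
  w1 != [::] -> w2 != [::] ->
  cross (flow w1 y0) (flow w2 (flow w1 y0)) = 0 ->
  cross (flow w1 y0) (E (mx l.1) l.2 (flow w1 y0)) = 0 -> False.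
Proof.
move=> b n1 n2 c2 cl; have y_neq0 := flow_neq0 M1 M2 w1 y0_neq0.
have [k2 e2] := cross0_scale y_neq0 c2.
have [kl el] := cross0_scale y_neq0 cl.
have b' : best (w1 ++ l :: w2 ++ w3).
  apply: (best_perm b).
    by apply/permP => a; rewrite !(count_cat, size_cat) /= !count_cat /=; lia.
  rewrite !flow_cat !flow_cons !flow_cat el flow_scale e2 E_scale el.
  by rewrite !scale_scale mulrC.
case/lastP: w1 n1 b b' {c2 cl y_neq0 e2 el} => [//|w1 p] _.
case: w2 n2 => [//|p' w2] _; rewrite -!cats1 -!catA /= => b b'.
have h1 := best_adjacent b; have h2 := best_adjacent b'.
have := @best_adjacent (w1 ++ [:: p]) l p' (w2 ++ w3); rewrite -catA => /(_ b').
rewrite h1 h2; have := best_all b; rewrite all_cat /= => /and3P[_ /andP[/orP[]/eqP -> _] _]; lra.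
Qed.

Lemma best_loop_after w1 l w2 w3 : best (w1 ++ l :: w2 ++ w3) ->
  w2 != [::] -> w3 != [::] ->
  cross (flow w1 y0) (flow w2 (flow w1 y0)) = 0 ->
  cross (flow w1 y0) (E (mx l.1) l.2 (flow w1 y0)) = 0 -> False.
Proof.
move=> b n2 n3 c2 cl; have y_neq0 := flow_neq0 M1 M2 w1 y0_neq0.
have [k2 e2] := cross0_scale y_neq0 c2.
have [kl el] := cross0_scale y_neq0 cl.
have b' : best (w1 ++ w2 ++ l :: w3).
  apply: (best_perm b).
    by apply/permP => a; rewrite !(count_cat, size_cat) /= !count_cat /=; lia.
  rewrite !flow_cat !flow_cons !flow_cat el flow_scale e2 E_scale el flow_scale.
  by rewrite !flow_scale !scale_scale mulrC.
case/lastP: w2 n2 b b' {c2 cl y_neq0 e2 el} => [//|w2 p] _.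
case: w3 n3 => [//|p' w3] _; rewrite -!cats1 -!catA /= => b b'.
have h1 := @best_adjacent (w1 ++ l :: w2) p p' w3; rewrite -catA /= in h1.
have h2 := @best_adjacent (w1 ++ w2) p l (p' :: w3); rewrite -!catA /= in h2.
have h3 := @best_adjacent (w1 ++ w2 ++ [:: p]) l p' w3; rewrite -!catA /= in h3.
have := h1 b; have := h3 b'; rewrite (h2 b') => ->.
have := best_all b'; rewrite !all_cat /= => /and4P[_ _ /andP[/orP[]/eqP -> _] _]; lra.
Qed.

End BestWords.

(** * Junctions alternate between two lines *)

Section Alternation.
Variable R : realType.
Variables (M1 M2 : mat2 R) (T : R) (y0 : R * R).
Hypothesis y0_neq0 : y0 != 0.
Implicit Types (y z : R * R) (c t s r h : R) (p l : R * R) (w : seq (R * R)).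
Local Notation flow := (flow M1 M2).
Local Notation mx := (mx M1 M2).
Local Notation isbb := (isbb T).
Local Notation best := (best M1 M2 T y0).
Local Notation J := (J M1 M2 y0).
Local Notation Jn w k := (J_neq0 M1 M2 y0_neq0 w k).

Definition par w i j := cross (J w i) (J w j) = 0.

Lemma par_sym w i j : par w i j -> par w j i.
Proof. by rewrite /par => h; rewrite crossC h oppr0. Qed.

Lemma parP w i j : par w i j -> exists k, J w j = scale k (J w i).
Proof. exact: cross0_scale (Jn w i). Qed.

Lemma loop_same_direction A t y z : z != 0 -> cross z y = 0 -> cross z (E A t z) = 0 ->
  cross y (E A t y) = 0.
Proof.
move=> z0 /(cross0_scale z0)[k ->] h.
by rewrite E_scale cross_scale crossC cross_scale crossC h !(oppr0, mulr0).
Qed.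

Lemma cross_scaler k y z : cross y (scale k z) = k * cross y z.
Proof. by rewrite /cross /=; ring. Qed.

Lemma J_between w i j : (i <= j)%N -> flow (drop i (take j w)) (J w i) = J w j.
Proof.
by move=> ij; rewrite /J -[in RHS](cat_take_drop i (take j w)) flow_cat take_takel.
Qed.

Lemma loop_before_nth w k j : best w -> (0 < k < j)%N -> (j.+1 < size w)%N ->
  par w j j.+1 -> par w k j -> False.
Proof.
move=> b /andP[k0 kj] jw pj pk; have jw' := ltnW jw.
have e : w = take k w ++ drop k (take j w) ++ nth 0 w j :: drop j.+1 w.
  rewrite catA -[take k w](take_takel _ (ltnW kj)) cat_take_drop.
  exact: split_nth.
have b' := b; rewrite e in b'.
apply: (best_loop_before y0_neq0 b').
- by rewrite -size_eq0 size_takel -?lt0n// (leq_trans (ltnW kj))// ltnW.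
- by rewrite -size_eq0 size_drop size_takel ?subn_eq0 -?ltnNge// ltnW.
- by rewrite -/(J w k) J_between// ltnW.
- apply: (loop_same_direction (Jn w j)); first exact: par_sym.
  by rewrite -J_succ.
Qed.

Lemma loop_after_nth w j k : best w -> (j.+1 < k < size w)%N ->
  par w j j.+1 -> par w j k -> False.
Proof.
move=> b /andP[jk kw] pj pk; have jw : (j < size w)%N by lia.
have e : w = take j w ++ nth 0 w j :: drop j.+1 (take k w) ++ drop k w.
  rewrite -cat_cons catA -cat_rcons -take_nth// -catA catA.
  by rewrite -[take j.+1 w](take_takel _ (ltnW jk)) cat_take_drop cat_take_drop.
have b' := b; rewrite e in b'.
apply: (best_loop_after y0_neq0 b').
- by rewrite -size_eq0 size_drop size_takel ?subn_eq0 -?ltnNge// ltnW.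
- by rewrite -size_eq0 size_drop subn_eq0 -ltnNge.
- have [k1 e1] := parP pj; have k1n : k1 != 0.
    by apply/eqP => k10; have := Jn w j.+1; rewrite e1 k10 /scale !mul0r eqxx.
  have := pk; rewrite /par -(J_between w (ltnW jk)) e1 flow_scale.
  by rewrite cross_scaler => /eqP; rewrite mulf_eq0 (negbTE k1n) => /eqP.
- by rewrite -/(J w j) -J_succ.
Qed.

Definition hamiltonian w h := forall k c, (0 < k < size w)%N -> is_bang c ->
  bil (flow w y0) (flow (drop k w) (act (mx c) (J w k))) =
  h * bil (flow w y0) (flow w y0).

(** A loop of non-scalar duration runs along an eigenvector by [cross_E]; pairing with the adjoint
    state identifies the eigenvalue as h. *)
Lemma loop_eigenvector w h k : best w -> hamiltonian w h -> (0 < k)%N -> (k.+1 < size w)%N ->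
  par w k k.+1 -> fb (mx (nth 0 w k).1) (nth 0 w k).2 != 0 ->
  act (mx (nth 0 w k).1) (J w k) = scale h (J w k).
Proof.
move=> b H k0 kw; have kw' := ltnW kw; have [hc _] := best_nth b kw'.
rewrite /par J_succ// crossC cross_E => /eqP.
rewrite oppr_eq0 mulf_eq0 => /orP[->//|/eqP cr0] _.
have [m e] : exists m, act (mx (nth 0 w k).1) (J w k) = scale m (J w k).
  by apply: (cross0_scale (Jn w k)); rewrite crossC cr0 oppr0.
rewrite e; congr scale; have := H k _ _ hc; rewrite k0 kw' => /(_ isT).
rewrite e flow_scale bil_scale J_drop => /mulIf; apply.
by rewrite gt_eqF// bil_gt0.
Qed.

Lemma E_eigenvector A h t y : act A y = scale h y ->
  E A t y = scale (fa A t + h * fb A t) y.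
Proof. by move=> e; rewrite /E e; apply: vec_eq => /=; ring. Qed.

(* Two loops of the same type are traversed along eigenvectors with the common
   eigenvalue h, so that they can be merged into one. *)
Lemma two_loops_reducible (x0 x1 x2 x3 x4 : R * R) (w := [:: x0; x1; x2; x3; x4]) :
  best w -> par w 1 2 -> par w 3 4 -> False.
Proof.
case: x1 x3 @w => [c t1] [c3 t3] w b p12 p34; have [h H] := best_hamiltonian y0_neq0 b.
have e31 : c3 = c.
  have /= e1 := @best_alternate _ _ _ _ _ _ 1%N b isT.
  by have /= -> := @best_alternate _ _ _ _ _ _ 2%N b isT; rewrite e1; ring.
subst c3; have [/andP[al /eqP dT] _ _] := b.
move: al => /= /and5P[al0 /andP[/= hc t10] al2 /andP[/= _ t30] /andP[al4 _]].
have red w' : perm_eq w' [:: x0; (c, t1 + t3); x2; x4] -> flow w' y0 = flow w y0 -> False.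
  move=> pe e; have := best_size b _ e; rewrite (perm_size pe) /= => H0.
  apply: (notF (H0 _)); rewrite perm_sym in pe; apply: (isbb_perm pe).
  rewrite /isbb /= al0 al2 al4 /arc_ok /= hc addr_ge0//=; apply/eqP.
  by rewrite -dT !dur_cons dur_nil /=; ring.
have [f1|f1] := eqVneq (fb (mx c) t1) 0.
  apply: (red [:: x0; x2; (c, t1 + t3); x4]); first by rewrite perm_cons (perm_catCA [:: x2] [:: _] [:: x4]).
  by rewrite /= E_add !(E_scalar _ f1) !E_scale.
have [f3|f3] := eqVneq (fb (mx c) t3) 0.
  apply: (red [:: x0; (c, t1 + t3); x2; x4]); first exact: perm_refl.
  by rewrite /= addrC E_add !(E_scalar _ f3) !E_scale.
have /= e1 := @loop_eigenvector w h 1%N b H isT isT p12 f1.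
have /= e3 := @loop_eigenvector w h 3%N b H isT isT p34 f3.
apply: (red [:: x0; (c, t1 + t3); x2; x4]); first exact: perm_refl.
rewrite /J /= in e1 e3; move: e3.
rewrite (E_eigenvector t1 e1) E_scale => /(E_eigenvector t3); rewrite E_scale => e3.
rewrite /= addrC E_add (E_eigenvector t1 e1) !E_scale -[in RHS]E_scale e3.
by rewrite (E_eigenvector t3 e1) !E_scale !scale_scale mulrC.
Qed.

(* The word b a b between two parallel junctions is a full loop of the rotation
   b interrupted by a loop a; it can be started at [y0] instead. *)
Lemma nested_loop_reducible (x0 x1 x2 x3 x4 : R * R) (w := [:: x0; x1; x2; x3; x4]) :
  best w -> par w 2 3 -> par w 1 4 -> ~ par w 1 2 -> False.
Proof.
case: x0 x1 x2 x3 x4 @w => [a t0] [c t1] [a2 t2] [c3 t3] [a4 t4] w b p23 p14 p12.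
have /= e0 := @best_alternate _ _ _ _ _ _ 0%N b isT.
have /= e1 := @best_alternate _ _ _ _ _ _ 1%N b isT.
have /= e2 := @best_alternate _ _ _ _ _ _ 2%N b isT.
have /= e3 := @best_alternate _ _ _ _ _ _ 3%N b isT.
have e20 : a2 = a by rewrite e1 e0; ring.
have e31 : c3 = c by rewrite e2 e1; ring.
have e40 : a4 = a by rewrite e3 e2 e20; ring.
clear e0 e1 e2 e3; subst a2 c3 a4; have [/andP[al /eqP dT] _ _] := b.
move: al => /= /and5P[/andP[/= ha t00] /andP[/= hc _] /andP[_ /= t20] _ /andP[/andP[_ /= t40] _]].
have t1_gt0 : 0 < t1 by have [] := @best_nth _ _ _ _ _ _ 1%N b isT.
have t3_gt0 : 0 < t3 by have [] := @best_nth _ _ _ _ _ _ 3%N b isT.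
have J2E : J w 2 = E (mx c) t1 (J w 1) by rewrite /J /w /=.
have J3E : J w 3 = E (mx a) t2 (J w 2) by rewrite /J /w /=.
have J4E : J w 4 = E (mx c) t3 (J w 3) by rewrite /J /w /=.
have [k kE] := parP p23.
have kn : k != 0.
  by apply/eqP => k0; have := Jn w 3; rewrite kE k0 /scale !mul0r eqxx.
(* The arc between the two arcs of type c only scales its state, so from junction 1 to junction 4
   the state moves as under one c-arc of duration t3 + t1. It returns to its line without starting
   on an eigenvector. *)
have fP : fb (mx c) (t3 + t1) = 0.
  have := p14; rewrite /par J4E kE E_scale J2E -E_add cross_scaler => /eqP.
  rewrite mulf_eq0 (negbTE kn) /= crossC oppr_eq0 cross_E mulf_eq0.
  move=> /orP[/eqP//|/eqP cr0]; exfalso; apply: p12.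
  by rewrite /par J2E crossC cross_E cr0 mulr0 oppr0.
have P_gt0 : 0 < t3 + t1 by exact: addr_gt0.
(* Since t3 + t1 is a scalar time, the rotation started at [y0] meets the line on which the inner
   arc is a loop, at some time r. *)
have [r /andP[r0 rP] cr] := flow_sweeps y0 (J w 2) P_gt0 fP.
have [m mE] := cross0_scale (E_neq0 (mx c) r y0_neq0) cr.
have mn : m != 0.
  by apply/eqP => m0; have := Jn w 2; rewrite mE m0 /scale !mul0r eqxx.
have loop_a : E (mx a) t2 (E (mx c) r y0) = scale k (E (mx c) r y0).
  have : scale m (E (mx a) t2 (E (mx c) r y0)) = scale m (scale k (E (mx c) r y0)).
    by rewrite -E_scale -mE -J3E kE mE !scale_scale mulrC.
  by move=> [/(mulfI mn) h1 /(mulfI mn) h2]; apply: vec_eq.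
(* The full rotation from [y0], interrupted by the loop at time r, acts as a scalar; the two outer
   arcs of type a then merge and only four arcs remain. *)
have := @best_size _ _ _ _ _ w [:: (c, r); (a, t2); (c, t3 + t1 - r); (a, t4 + t0)] b.
rewrite /= => H0; apply: (notF (H0 _ _)).
  rewrite /isbb /= /arc_ok /= ha hc r0 t20 subr_ge0 rP addr_ge0//=.
  by apply/eqP; rewrite -dT !dur_cons dur_nil /=; ring.
rewrite loop_a !E_scale -E_add subrK (E_scalar _ fP) E_add.
rewrite -/(J w 1) -J2E -J3E kE J2E !E_scale -(E_add (mx c) t3) (E_scalar _ fP).
by rewrite !E_scale.
Qed.

(** If arc j is a loop, exchanging it with its neighbours keeps every junction other than j and j +
    1 off its line, so these other junctions share the second zero line of [q]. This makes a second
    loop or a loop parallel to a distant junction, which an exchange excludes when there are at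
    least six arcs. The five-arc configurations are the two reductions above. *)
Lemma best_no_loop w j : best w -> (4 < size w)%N -> (0 < j)%N -> (j.+1 < size w)%N ->
  ~ par w j j.+1.
Proof.
move=> b n5 j0 jw pj; have [h H] := best_hamiltonian y0_neq0 b.
have qJ := best_q y0_neq0 H.
have other k : (0 < k < size w)%N -> k != j -> k != j.+1 -> ~ par w j k.
  move=> /andP[k0 kw] kj kj1 pk; have [lt|ge] := ltnP k j.
    by apply: (@loop_before_nth w k j b); rewrite ?k0//; exact: par_sym.
  by apply: (@loop_after_nth w j k b); rewrite // kw andbT; lia.
have others k k' : (0 < k < size w)%N -> k != j -> k != j.+1 ->
    (0 < k' < size w)%N -> k' != j -> k' != j.+1 -> par w k k'.
  move=> h1 h2 h3 k1 k2 k3; apply: contrapT => np.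
  apply: (q_neq0 b (h := h)); first by exact: leq_trans n5.
  apply: (@q_three_directions _ _ _ _ (J w j) (J w k) (J w k')).
  - by apply: qJ; rewrite j0 ltnW.
  - exact: qJ.
  - exact: qJ.
  - exact/eqP/(other k).
  - exact/eqP/(other k').
  - exact/eqP.
have five : size w = 5%N -> exists x0 x1 x2 x3 x4, w = [:: x0; x1; x2; x3; x4].
  case: w {b n5 jw pj H qJ other others} => [|x0 [|x1 [|x2 [|x3 [|x4 []]]]]]//= _.
  by exists x0, x1, x2, x3, x4.
have [j1|j1] := eqVneq j 1%N; [|have [j2|j2] := eqVneq j 2%N].
- subst j; have p34 : par w 3 4 by apply: others => //; lia.
  have [n5'|n6] := leqP (size w) 5.
    have [|x0 [x1 [x2 [x3 [x4 e]]]]] := five _; first lia.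
    by subst w; exact: two_loops_reducible pj p34.
  apply: (@loop_after_nth w 3 5 b) => //; apply: others => //; lia.
- subst j; have [n5'|n6] := leqP (size w) 5.
    have [|x0 [x1 [x2 [x3 [x4 e]]]]] := five _; first lia.
    subst w; apply: (nested_loop_reducible b pj); first by apply: others.
    by move=> p12; apply: (other 1%N) => //; exact: par_sym.
  by apply: (@loop_before_nth w 1 4 b) => //; apply: others => //; lia.
- have p12 : par w 1 2 by apply: others; lia.
  have [j4|j3] := leqP 4 j.
    by apply: (@loop_after_nth w 1 3 b) => //; [lia|apply: others; lia].
  have j3E : j = 3%N by lia.
  subst j; have [n5'|n6] := leqP (size w) 5.
    have [|x0 [x1 [x2 [x3 [x4 e]]]]] := five _; first lia.
    by subst w; exact: two_loops_reducible p12 pj.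
  by apply: (@loop_after_nth w 1 5 b) => //; apply: others; lia.
Qed.

(** Consecutive junctions lie on different lines, and [q] has at most two. *)
Lemma best_par2 w j : best w -> (4 < size w)%N -> (0 < j)%N -> (j.+2 < size w)%N ->
  par w j j.+2.
Proof.
move=> b n5 j0 jw; have [h H] := best_hamiltonian y0_neq0 b.
have qJ := best_q y0_neq0 H; apply: contrapT => np.
apply: (q_neq0 b (h := h)); first by exact: leq_trans n5.
apply: (@q_three_directions _ _ _ _ (J w j) (J w j.+1) (J w j.+2));
  try (by apply: qJ; lia); apply/eqP => //.
- by apply: (best_no_loop b) => //; exact: ltnW.
- by apply: (best_no_loop b).
Qed.

(** Arcs j and j + 2 go from the same line to the same line under the same flow. Hence running for
    the difference of their durations preserves the second line, and this line is not an eigenline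
    because arc j is not a loop. *)
Lemma best_excess w j : best w -> (4 < size w)%N -> (0 < j)%N -> (j.+3 < size w)%N ->
  fb (mx (nth 0 w j).1) ((nth 0 w j.+2).2 - (nth 0 w j).2) = 0 /\
  fb (mx (nth 0 w j).1) ((nth 0 w j).2 - (nth 0 w j.+2).2) = 0.
Proof.
move=> b n5 j0 jw.
have e : (nth 0 w j.+2).1 = (nth 0 w j).1.
  rewrite (best_alternate b); last exact: ltnW.
  by rewrite (best_alternate b); [ring|exact/ltnW/ltnW].
have p02 := best_par2 b n5 j0 (ltnW jw).
have p13 : par w j.+1 j.+3 by exact: best_par2.
have n12 : ~ par w j j.+1 by apply: best_no_loop => //; exact/ltnW/ltnW.
set c := (nth 0 w j).1 in e *; set s := (nth 0 w j).2; set t := (nth 0 w j.+2).2.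
have J1 : J w j.+1 = E (mx c) s (J w j) by apply: J_succ; exact/ltnW/ltnW/ltnW.
have J3 : J w j.+3 = E (mx c) t (J w j.+2) by rewrite J_succ ?e//; exact: ltnW.
have cr : cross (act (mx c) (J w j.+1)) (J w j.+1) != 0.
  rewrite J1 act_E cross_EE mulf_eq0 gt_eqF ?wronskian_gt0//=.
  apply/eqP => cr; apply: n12.
  by rewrite /par J1 crossC cross_E cr mulr0 oppr0.
have fbP r : cross (J w j.+1) (E (mx c) r (J w j.+1)) = 0 -> fb (mx c) r = 0.
  rewrite crossC => /eqP; rewrite oppr_eq0 cross_E mulf_eq0 (negbTE cr) orbF.
  by move/eqP.
have [k J2] := parP p02.
have kn : k != 0.
  by apply/eqP => k0; have := Jn w j.+2; rewrite J2 k0 /scale !mul0r eqxx.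
have J3E : J w j.+3 = scale k (E (mx c) (t - s) (J w j.+1)).
  by rewrite J1 -E_add subrK -E_scale -J2.
split; apply: fbP.
  by have := p13; rewrite /par J3E cross_scaler => /eqP; rewrite mulf_eq0 (negbTE kn) => /eqP.
apply: (loop_same_direction (Jn w j.+3)); first exact: par_sym.
by rewrite {2}J3E E_scale -E_add -(opprB t) addNr E0 cross_scaler par_sym ?mulr0.
Qed.

End Alternation.

(** * Global minimisers are periodic inside *)

Section Periodicity.
Variable R : realType.
Variables (M1 M2 : mat2 R) (T : R) (y0 : R * R).
Hypothesis y0_neq0 : y0 != 0.
Implicit Types (y z : R * R) (c t s r h : R) (p l : R * R) (w : seq (R * R)).
Local Notation flow := (flow M1 M2).
Local Notation mx := (mx M1 M2).
Local Notation isbb := (isbb T).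
Local Notation val := (val M1 M2 y0).
Local Notation best := (best M1 M2 T y0).
Local Notation J := (J M1 M2 y0).
Local Notation q := (q M1 M2).
Local Notation par := (par M1 M2 y0).
Local Notation Jn w k := (J_neq0 M1 M2 y0_neq0 w k).

(* First order condition for inserting a short arc of the other type in the
   middle of an arc. *)
Lemma needle w1 c t w2 r (w := w1 ++ (c, t) :: w2) (z := E (mx c) r (flow w1 y0)) :
  isbb w -> (forall w', isbb w' -> val w <= val w') -> 0 <= r -> r < t ->
  bil (flow w y0) (flow ((c, t - r) :: w2) (act (mx c) z)) <=
  bil (flow w y0) (flow ((c, t - r) :: w2) (act (mx (1 - c)) z)).
Proof.
move=> bb wmin r0 rt; have S0 : 0 < t - r by rewrite subr_gt0.
have := @d_transfer R M1 M2 w2 (1 - c) c (t - r) z 0.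
cbv zeta; rewrite subr0 E0; set v := lin 1 _ _ _ => hd.
have wz : flow w y0 = flow w2 (E (mx c) (t - r) z).
  by rewrite /w flow_cat /= -E_add subrK.
have : 0 <= bil (flow w y0) (flow w2 (E (mx c) (t - r) v)).
  rewrite wz; apply: (derive_ge0_at_right_min S0 hd) => s s0.
  rewrite subr0 E0 -wz; have := wmin (w1 ++ [:: (c, r), (1 - c, s), (c, t - r - s) & w2]).
  rewrite /val !flow_cat /=; apply.
  move: bb; rewrite /isbb !all_cat /= /arc_ok /= => /andP[/and3P[-> /andP[hc _] ->] /eqP <-].
  have -> : is_bang (1 - c) by case/orP: hc => /eqP ->; rewrite /is_bang ?subr0 ?subrr eqxx ?orbT.
  rewrite hc r0 !dur_cat !dur_cons /=; apply/andP; split; last by apply/eqP; ring.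
  by apply/and3P; split => //; lra.
rewrite /v E_lin flow_lin bil_lin /=; lra.
Qed.

(* Before such a time e the state sweeps all directions, so the needle condition
   would make q semidefinite although it vanishes in two directions. *)
Lemma global_arc_short w j e : best w -> (forall w', isbb w' -> val w <= val w') ->
  (4 < size w)%N -> (0 < j)%N -> (j.+1 < size w)%N ->
  fb (mx (nth 0 w j).1) e = 0 -> 0 < e -> e < (nth 0 w j).2 -> False.
Proof.
move=> b wmin n5 j0 jw fe e0 et; have jw' := ltnW jw.
have [h H] := best_hamiltonian y0_neq0 b.
have npar := best_no_loop y0_neq0 b n5 j0 jw.
have [hc _] := best_nth b jw'.
have wE := split_nth jw'; have dE := drop_nth 0 jw'.
move: fe et hc wE dE (J_succ M1 M2 y0 jw'); case: (nth 0 w j) => c t /= fe et hc wE dE J1.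
pose rho z := cross (act (mx c) z) z.
pose qc z := cross (shift h (mx c) z) (shift h (mx (1 - c)) z).
have hc' : is_bang (1 - c).
  by case/orP: hc => /eqP ->; rewrite /is_bang ?subr0 ?subrr eqxx ?orbT.
(* Decompose z along its two shifted velocities and pair with the adjoint: [qc z * C] is [rho z]
   times the amount by which the Hamiltonian of the other type exceeds its stationary value. The
   needle condition makes this amount nonnegative. *)
have onarc r : 0 <= r <= e -> 0 <= rho (E (mx c) r (J w j)) * qc (E (mx c) r (J w j)).
  move=> /andP[r0 re]; set z := E (mx c) r _.
  have [bb _ _] := b; rewrite wE in bb.
  have := @needle (take j w) c t (drop j.+1 w) r bb.
  rewrite -wE -/(J w j) -/z => /(_ wmin r0 (le_lt_trans re et)).
  set lam := fun x => bil (flow w y0) (flow ((c, t - r) :: drop j.+1 w) x).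
  rewrite -!/(lam _); set C := bil (flow w y0) (flow w y0).
  have lamz : lam z = C.
    by rewrite /lam /z /= -E_add subrK -J1 J_drop.
  have lamc : lam (act (mx c) z) = h * C.
    rewrite /lam /z act_E /= -E_add subrK -(H j c) ?j0 ?jw'//.
    by rewrite dE.
  have C0 : 0 < C := bil_gt0 M1 M2 y0_neq0 w.
  rewrite lamc => ham.
  have := congr1 lam (cross_decomp z (shift h (mx c) z) (shift h (mx (1 - c)) z)).
  rewrite -/(qc z) /lam flow_scale bil_scale flow_lin bil_lin -!/(lam _) lamz.
  have -> : lam (shift h (mx c) z) = 0.
    by rewrite /lam /shift flow_lin bil_lin -!/(lam _) lamc lamz; ring.
  have -> : lam (shift h (mx (1 - c)) z) = lam (act (mx (1 - c)) z) - h * C.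
    by rewrite /lam /shift flow_lin bil_lin -!/(lam _) lamz; ring.
  have -> : cross (shift h (mx c) z) z = rho z by rewrite /rho /shift /cross /=; ring.
  rewrite mulr0 add0r => eq.
  rewrite -(pmulr_lge0 _ C0) -mulrA eq mulrA mulr_ge0// ?subr_ge0//.
  by rewrite -expr2 sqr_ge0.
have rho_neq0 : rho (J w j) != 0.
  apply/eqP => rj; apply: npar.
  by rewrite /par J1 crossC cross_E -/(rho _) rj mulr0 oppr0.
(* The sign of [rho] is constant along the arc because the determinant of the flow is positive, and
   up to time e the arc meets every line. *)
have qc_sign y : 0 <= rho (J w j) * qc y.
  have [->|y_neq0] := eqVneq y 0.
    have -> : qc 0 = 0 by rewrite /qc /shift /cross /=; ring.
    by rewrite mulr0.
  have [r re cr] := flow_sweeps (J w j) y e0 fe.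
  have [k ->] := cross0_scale (E_neq0 (mx c) r (Jn w j)) cr.
  have -> z : qc (scale k z) = k ^+ 2 * qc z by rewrite /qc /shift /cross /=; ring.
  have := onarc r re; rewrite {1}/rho act_E cross_EE -/(rho _) -mulrA.
  by rewrite pmulr_rge0 ?wronskian_gt0// mulrCA => h1; rewrite mulr_ge0 ?sqr_ge0.
have qcE y : qc y = q h y \/ qc y = - q h y.
  rewrite /qc /q; case/orP: hc => /eqP ->; rewrite ?subr0 ?subrr; first by left.
  by right; rewrite crossC.
have qj0 k : (0 < k < size w)%N -> qc (J w k) = 0.
  by move=> /(best_q y0_neq0 H) qk; case: (qcE (J w k)) => ->; rewrite qk ?oppr0.
have q1 := qj0 j; have q2 := qj0 j.+1.
rewrite j0 jw' in q1; rewrite jw /= in q2.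
set u := J w j in q1 qc_sign rho_neq0; set v := J w j.+1 in q2.
pose pol := cross (shift h (mx c) u) (shift h (mx (1 - c)) v) +
            cross (shift h (mx c) v) (shift h (mx (1 - c)) u).
have q_lin a a' : qc (lin a u a' v) = a * a' * pol.
  transitivity (a ^+ 2 * qc u + a' ^+ 2 * qc v + a * a' * pol).
    by rewrite /qc /pol /shift /cross /=; ring.
  by rewrite (q1 isT) (q2 isT) !mulr0 !add0r.
(* A multiple of the product of two coordinates takes both signs unless it is zero; the test vectors
   are u + v and u - v. *)
have pol0 : pol = 0.
  have := qc_sign (lin 1 u 1 v); have := qc_sign (lin 1 u (-1) v).
  rewrite !q_lin => h1 h2; have : rho u * pol = 0 by lra.
  by move=> /eqP; rewrite mulf_eq0 (negbTE rho_neq0) => /eqP.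
apply: (q_neq0 b (h := h)) => [|y]; first exact: leq_trans n5.
have : qc y = 0.
  have : qc (scale (cross u v) y) = 0 by rewrite cross_decomp q_lin pol0 mulr0.
  have -> : qc (scale (cross u v) y) = cross u v ^+ 2 * qc y.
    by rewrite /qc /shift /cross /=; ring.
  move=> /eqP; rewrite mulf_eq0 expf_eq0 /= => /orP[/eqP uv|/eqP //].
  by exfalso; apply: npar.
by case: (qcE y) => ->; [|move/eqP; rewrite oppr_eq0 => /eqP].
Qed.

(** If the two durations differed, their positive difference would be a scalar time shorter than the
    longer arc. *)
Lemma global_best_periodic w j : best w -> (forall w', isbb w' -> val w <= val w') ->
  (4 < size w)%N -> (0 < j)%N -> (j.+3 < size w)%N ->
  (nth 0 w j.+2).2 = (nth 0 w j).2.
Proof.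
move=> b wmin n5 j0 jw; have [] := best_excess y0_neq0 b n5 j0 jw.
have e : (nth 0 w j.+2).1 = (nth 0 w j).1.
  rewrite (best_alternate b); last exact: ltnW.
  by rewrite (best_alternate b); [ring|exact/ltnW/ltnW].
have [_ t1] := best_nth b (ltnW (ltnW (ltnW jw))).
have [_ t2] := best_nth b (ltnW jw).
set s := (nth 0 w j).2 in t1 *; set t := (nth 0 w j.+2).2 in t2 *.
have [st|ts|//] := ltgtP s t => fe fe'; exfalso.
  apply: (@global_arc_short w j.+2 (t - s) b wmin n5) => //; rewrite ?e ?subr_gt0//.
  by rewrite -/t; lra.
apply: (@global_arc_short w j (s - t) b wmin n5) => //; rewrite ?subr_gt0//.
- exact/ltnW/ltnW.
- by rewrite -/s; lra.
Qed.

End Periodicity.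

(** * Chattering *)

Section Estimates.
Variable R : realType.
Variables (M1 M2 : mat2 R).
Implicit Types (y z : R * R) (c t s r h : R) (p l : R * R) (w : seq (R * R)).
Local Notation flow := (flow M1 M2).
Local Notation mx := (mx M1 M2).

Definition n1 y := `|y.1| + `|y.2|.
Definition sub y z := lin 1 y (-1) z.
Definition sq y := y.1 ^+ 2 + y.2 ^+ 2.
(** Bounds, in the norm [n1], every mixture [mx c] with c in [0, 1] and also the difference of the
    two matrices. *)
Definition KM := (`|m11 M1| + `|m11 M2|) + (`|m12 M1| + `|m12 M2|) +
                 ((`|m21 M1| + `|m21 M2|) + (`|m22 M1| + `|m22 M2|)).

Lemma n1_ge0 y : 0 <= n1 y.
Proof. by rewrite addr_ge0. Qed.

Lemma KM_ge0 : 0 <= KM.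
Proof. by rewrite !addr_ge0. Qed.

Lemma n1_lin a y b z : n1 (lin a y b z) <= `|a| * n1 y + `|b| * n1 z.
Proof.
rewrite /n1 /=; have h1 := ler_normD (a * y.1) (b * z.1).
have h2 := ler_normD (a * y.2) (b * z.2); move: h1 h2; rewrite !normrM; lra.
Qed.

Lemma n1_scale k y : n1 (scale k y) = `|k| * n1 y.
Proof. by rewrite /n1 /= !normrM mulrDr. Qed.

Lemma n1_sub y z : n1 (sub y z) <= n1 y + n1 z.
Proof. by have := n1_lin 1 y (-1) z; rewrite normrN1 normr1 !mul1r. Qed.

Lemma n1_subC y z : n1 (sub y z) = n1 (sub z y).
Proof.
rewrite /n1 /sub; cbn [lin fst snd]; rewrite !mul1r !mulN1r.
by rewrite distrC [X in _ + X]distrC.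
Qed.

Lemma n1_triangle x y z : n1 (sub x z) <= n1 (sub x y) + n1 (sub y z).
Proof.
have -> : sub x z = lin 1 (sub x y) 1 (sub y z) by apply: vec_eq => /=; ring.
by have := n1_lin 1 (sub x y) 1 (sub y z); rewrite normr1 !mul1r.
Qed.

Lemma n1_1 y : `|y.1| <= n1 y. Proof. by rewrite lerDl. Qed.
Lemma n1_2 y : `|y.2| <= n1 y. Proof. by rewrite lerDr. Qed.

Lemma n1_sq y : sq y <= n1 y ^+ 2 /\ n1 y ^+ 2 <= 2 * sq y.
Proof.
rewrite /n1 /sq -[y.1 ^+ 2]real_normK ?num_real// -[y.2 ^+ 2]real_normK ?num_real//.
have := mulr_ge0 (normr_ge0 y.1) (normr_ge0 y.2).
have := sqr_ge0 (`|y.1| - `|y.2|); rewrite !expr2; lra.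
Qed.

Lemma norm_mix c (a b : R) : 0 <= c <= 1 -> `|c * a + (1 - c) * b| <= `|a| + `|b|.
Proof.
move=> /andP[c0 c1]; apply: le_trans (ler_normD _ _) _; rewrite !normrM.
have c1' : 0 <= 1 - c by rewrite subr_ge0.
rewrite (ger0_norm c0) (ger0_norm c1').
by have := mulr_ge0 c1' (normr_ge0 a); have := mulr_ge0 c0 (normr_ge0 b); lra.
Qed.

Lemma n1_act A y : n1 (act A y) <= (`|m11 A| + `|m12 A| + (`|m21 A| + `|m22 A|)) * n1 y.
Proof.
rewrite /n1 /=.
have h1 := ler_normD (m11 A * y.1) (m12 A * y.2).
have h2 := ler_normD (m21 A * y.1) (m22 A * y.2).
rewrite !normrM in h1 h2.
have := mulr_ge0 (normr_ge0 (m11 A)) (normr_ge0 y.2).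
have := mulr_ge0 (normr_ge0 (m12 A)) (normr_ge0 y.1).
have := mulr_ge0 (normr_ge0 (m21 A)) (normr_ge0 y.2).
have := mulr_ge0 (normr_ge0 (m22 A)) (normr_ge0 y.1).
lra.
Qed.

Lemma n1_act_mx c y : 0 <= c <= 1 -> n1 (act (mx c) y) <= KM * n1 y.
Proof.
move=> hc; apply: le_trans (n1_act _ _) _; rewrite ler_wpM2r ?n1_ge0//.
by rewrite !lerD// norm_mix.
Qed.

Lemma n1_act_diff y : n1 (sub (act M1 y) (act M2 y)) <= KM * n1 y.
Proof.
apply: le_trans (n1_sub _ _) _; apply: le_trans (lerD (n1_act _ _) (n1_act _ _)) _.
by rewrite -mulrDl ler_wpM2r ?n1_ge0// /KM; lra.
Qed.

(** A Gronwall estimate, made with the Euclidean square because [n1] is not differentiable: sq exp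
    (- 4 KM t) does not increase. *)
Lemma sq_E c t y : 0 <= c <= 1 -> 0 <= t -> sq (E (mx c) t y) <= expR (4 * KM * t) * sq y.
Proof.
move=> hc t0.
have de (x : R) : is_derive x 1 (fun t => expR (- (4 * KM) * t)) (- (4 * KM) * expR (- (4 * KM) * x)).
  rewrite [X in is_derive _ _ _ X]mulrC; apply: (@is_derive_comp R expR (fun t => - (4 * KM) * t)).
  by by_rules; ring.
pose z x := E (mx c) x y.
have dg (x : R) : is_derive x 1
    (fun t => ((z t).1 * (z t).1 + (z t).2 * (z t).2) * expR (- (4 * KM) * t))
    ((2 * ((z x).1 * (act (mx c) (z x)).1 + (z x).2 * (act (mx c) (z x)).2)
       - 4 * KM * sq (z x)) * expR (- (4 * KM) * x)).
  have [h1 h2] := d_E (mx c) x y; have hd := de x; rewrite -/(z _) in h1 h2.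
  by by_rules; rewrite /sq; ring.
have [s _] := mean_value dg t0.
set D := _ * _ * (_ - _).
have D0 : D <= 0.
  rewrite mulr_le0_ge0 ?subr_ge0// mulr_le0_ge0 ?expR_ge0// subr_le0.
  have h1 : `|(act (mx c) (z s)).1| <= KM * n1 (z s).
    exact: le_trans (n1_1 _) (n1_act_mx _ hc).
  have h2 : `|(act (mx c) (z s)).2| <= KM * n1 (z s).
    exact: le_trans (n1_2 _) (n1_act_mx _ hc).
  have k1 : (z s).1 * (act (mx c) (z s)).1 <= `|(z s).1| * (KM * n1 (z s)).
    by apply: le_trans (ler_norm _) _; rewrite normrM ler_wpM2l.
  have k2 : (z s).2 * (act (mx c) (z s)).2 <= `|(z s).2| * (KM * n1 (z s)).
    by apply: le_trans (ler_norm _) _; rewrite normrM ler_wpM2l.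
  have k3 : KM * (n1 (z s) * n1 (z s)) <= KM * (2 * sq (z s)).
    by rewrite ler_wpM2l ?KM_ge0// -expr2 (n1_sq _).2.
  by rewrite {1}/n1 in k3; lra.
rewrite mulr0 expR0 mulr1 => e.
have : sq (z t) * expR (- (4 * KM) * t) <= sq y.
  rewrite /sq !expr2; have z0 : z 0 = y by exact: E0.
  by rewrite -z0; lra.
rewrite mulNr expRN => h.
by rewrite mulrC -ler_pdivrMr ?expR_gt0.
Qed.

Definition unit_word w := all (fun p => (0 <= p.1 <= 1) && (0 <= p.2)) w.

Lemma unit_word_dur w : unit_word w -> 0 <= dur w.
Proof.
elim: w => [|p w IH]; first by rewrite dur_nil.
by rewrite dur_cons /= => /andP[/andP[_ p0] /IH]; exact: addr_ge0.
Qed.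

Lemma sq_flow w y : unit_word w -> sq (flow w y) <= expR (4 * KM * dur w) * sq y.
Proof.
elim: w y => [|p w IH] y; first by rewrite dur_nil mulr0 expR0 mul1r.
move=> /= /andP[/andP[pc pt] uw]; apply: le_trans (IH _ uw) _.
rewrite dur_cons.
have -> : expR (4 * KM * (p.2 + dur w)) * sq y =
    expR (4 * KM * dur w) * (expR (4 * KM * p.2) * sq y).
  by rewrite mulrA -expRD; congr (expR _ * _); ring.
by rewrite ler_wpM2l ?expR_ge0// sq_E.
Qed.

(** The square root of the growth factor of [sq]; the factor 2 absorbs the loss in passing between
    [n1] and [sq]. *)
Definition GM T := 2 * expR (2 * KM * T).

Lemma GM_ge0 T : 0 <= GM T.
Proof. by rewrite mulr_ge0 ?expR_ge0. Qed.

Lemma flow_bound T w y : unit_word w -> dur w <= T -> n1 (flow w y) <= GM T * n1 y.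
Proof.
move=> uw wT; rewrite -ler_sqr ?nnegrE ?n1_ge0 ?mulr_ge0 ?GM_ge0 ?n1_ge0//.
apply: le_trans (n1_sq _).2 _; rewrite exprMn.
have e4 : GM T ^+ 2 = 4 * expR (4 * KM * T).
  have -> : 4 * KM * T = 2 * KM * T + 2 * KM * T by ring.
  by rewrite expRD /GM; ring.
have e5 : expR (4 * KM * dur w) <= expR (4 * KM * T).
  by rewrite ler_expR ler_wpM2l// mulr_ge0 ?KM_ge0.
have := sq_flow y uw; have := (n1_sq y).1; rewrite e4.
have := expR_ge0 (4 * KM * T); have := sqr_ge0 (n1 y).
have sq0 : 0 <= sq y by rewrite addr_ge0 ?sqr_ge0.
move=> a b cc d.
have : expR (4 * KM * dur w) * sq y <= expR (4 * KM * T) * n1 y ^+ 2.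
  by rewrite ler_pM ?expR_ge0.
by have := mulr_ge0 b a; lra.
Qed.

Lemma E_bound T c t y : 0 <= c <= 1 -> 0 <= t <= T -> n1 (E (mx c) t y) <= GM T * n1 y.
Proof.
move=> hc /andP[t0 tT]; apply: (@flow_bound T [:: (c, t)]).
  by rewrite /unit_word /= hc t0.
by rewrite dur_cons dur_nil addr0.
Qed.

Lemma E_first_order T c t y : 0 <= c <= 1 -> 0 <= t <= T ->
  n1 (sub (E (mx c) t y) y) <= 2 * KM * GM T * t * n1 y.
Proof.
move=> hc /andP[t0 tT].
have b s : 0 <= s <= t -> n1 (act (mx c) (E (mx c) s y)) <= KM * (GM T * n1 y).
  move=> /andP[s0 st]; apply: le_trans (n1_act_mx _ hc) _.
  by rewrite ler_wpM2l ?KM_ge0// E_bound// s0 (le_trans st).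
have [s1 s1t] := mean_value (fun x => (d_E (mx c) x y).1) t0.
have [s2 s2t] := mean_value (fun x => (d_E (mx c) x y).2) t0.
rewrite E0 subr0 => e2 e1.
have -> : sub (E (mx c) t y) y =
    (t * (act (mx c) (E (mx c) s1 y)).1, t * (act (mx c) (E (mx c) s2 y)).2).
  by apply: vec_eq; cbn [lin sub fst snd]; rewrite !mul1r !mulN1r ?e1 ?e2 mulrC.
rewrite /n1 /= !normrM (ger0_norm t0).
have h1 := ler_wpM2l t0 (le_trans (n1_1 _) (b s1 s1t)).
have h2 := ler_wpM2l t0 (le_trans (n1_2 _) (b s2 s2t)).
rewrite /n1 in h1 h2; lra.
Qed.

Lemma E_second_order T c t y : 0 <= c <= 1 -> 0 <= t <= T ->
  n1 (sub (E (mx c) t y) (lin 1 y t (act (mx c) y))) <= 4 * KM ^+ 2 * GM T * t ^+ 2 * n1 y.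
Proof.
move=> hc /andP[t0 tT].
have b s : 0 <= s <= t -> n1 (act (mx c) (sub (E (mx c) s y) y)) <= KM * (2 * KM * GM T * t * n1 y).
  move=> /andP[s0 st]; apply: le_trans (n1_act_mx _ hc) _.
  rewrite ler_wpM2l ?KM_ge0//; apply: le_trans (E_first_order (T := T) _ hc _) _.
    by rewrite s0 (le_trans st).
  by rewrite ler_wpM2r ?n1_ge0// ler_wpM2l// mulr_ge0 ?GM_ge0// mulr_ge0 ?KM_ge0.
have [s1 s1t] := mean_value (fun x => (d_E (mx c) x y).1) t0.
have [s2 s2t] := mean_value (fun x => (d_E (mx c) x y).2) t0.
rewrite E0 subr0 => e2 e1.
have -> : sub (E (mx c) t y) (lin 1 y t (act (mx c) y)) =
    (t * (act (mx c) (sub (E (mx c) s1 y) y)).1, t * (act (mx c) (sub (E (mx c) s2 y) y)).2).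
  rewrite /sub !(act_lin _ 1 (E _ _ _)); apply: vec_eq; cbn [lin fst snd].
    transitivity ((E (mx c) t y).1 - y.1 - t * (act (mx c) y).1); first by ring.
    by rewrite e1; ring.
  transitivity ((E (mx c) t y).2 - y.2 - t * (act (mx c) y).2); first by ring.
  by rewrite e2; ring.
rewrite /n1 /= !normrM (ger0_norm t0).
have h1 := ler_wpM2l t0 (le_trans (n1_1 _) (b s1 s1t)).
have h2 := ler_wpM2l t0 (le_trans (n1_2 _) (b s2 s2t)).
rewrite /n1 in h1 h2; lra.
Qed.

(** The two flows are joined by E (mx c) (t - r) (E (mx c') r y), whose derivative in r carries the
    factor c' - c by the Duhamel rule. *)
Lemma E_lipschitz T c c' t y : 0 <= c <= 1 -> 0 <= c' <= 1 -> 0 <= t <= T ->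
  n1 (sub (E (mx c') t y) (E (mx c) t y)) <= 2 * KM * GM T ^+ 2 * T * `|c' - c| * n1 y.
Proof.
move=> hc hc' /andP[t0 tT].
pose z x := E (mx c') x y.
pose v x := scale (c' - c) (E (mx c) (t - x) (sub (act M1 (z x)) (act M2 (z x)))).
have dz (x : R) : is_derive x 1 (fun r => (E (mx c) (t - r) ((z r).1, (z r).2)).1) (v x).1 /\
            is_derive x 1 (fun r => (E (mx c) (t - r) ((z r).1, (z r).2)).2) (v x).2.
  have [h1 h2] := d_E (mx c') x y.
  have := d_E_sub (mx c) t h1 h2; cbv zeta; rewrite -!surjective_pairing -/(z x).
  suff -> : lin 1 (act (mx c') (z x)) (-1) (act (mx c) (z x)) =
            scale (c' - c) (sub (act M1 (z x)) (act M2 (z x))) by rewrite E_scale.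
  by apply: vec_eq => /=; ring.
have b s : 0 <= s <= t -> n1 (v s) <= `|c' - c| * (GM T * (KM * (GM T * n1 y))).
  move=> /andP[s0 st]; rewrite n1_scale ler_wpM2l//.
  apply: le_trans (E_bound (T := T) _ hc _) _; first lra.
  rewrite ler_wpM2l ?GM_ge0//; apply: le_trans (n1_act_diff _) _.
  by rewrite ler_wpM2l ?KM_ge0// E_bound// s0 (le_trans st).
have [s1 s1t] := mean_value (fun x => (dz x).1) t0.
have [s2 s2t] := mean_value (fun x => (dz x).2) t0.
rewrite -!surjective_pairing !subrr !subr0 /z !E0 => e2 e1.
rewrite {1}/n1 /sub; cbn [lin fst snd]; rewrite !mul1r !mulN1r e1 e2 !(normrM _ t) (ger0_norm t0).
have t1 : `|t| <= T by rewrite ger0_norm.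
have h1 := ler_pM (normr_ge0 _) (normr_ge0 t) (le_trans (n1_1 _) (b s1 s1t)) t1.
have h2 := ler_pM (normr_ge0 _) (normr_ge0 t) (le_trans (n1_2 _) (b s2 s2t)) t1.
rewrite (ger0_norm t0) in h1 h2; lra.
Qed.

End Estimates.

Section Chattering.
Variable R : realType.
Variables (M1 M2 : mat2 R) (T : R).
Hypothesis T_ge0 : 0 <= T.
Implicit Types (y z : R * R) (c t s r h : R) (p l : R * R) (w : seq (R * R)).
Local Notation flow := (flow M1 M2).
Local Notation mx := (mx M1 M2).
Local Notation KM := (KM M1 M2).
Local Notation G := (GM M1 M2 T).

(** [C1] bounds the second-order error of one arc and [C2] that of two consecutive arcs. The terms
    of [C2] come from the second arc, the first arc, and the displacement of the state between
    them. *)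
Definition C1 := 4 * KM ^+ 2 * G.
Definition C2 := C1 * G + C1 + 2 * KM ^+ 2 * G.

Lemma C1_ge0 : 0 <= C1.
Proof. by rewrite mulr_ge0 ?GM_ge0// mulr_ge0 ?sqr_ge0. Qed.

Lemma C2_ge0 : 0 <= C2.
Proof.
rewrite !addr_ge0 ?C1_ge0// mulr_ge0 ?C1_ge0 ?GM_ge0//.
by rewrite mulr_ge0 ?sqr_ge0.
Qed.

Lemma two_arc_expansion c c' s s' z : 0 <= c <= 1 -> 0 <= c' <= 1 -> 0 <= s -> 0 <= s' ->
  s + s' <= T ->
  n1 (sub (E (mx c') s' (E (mx c) s z))
          (lin 1 z 1 (lin s (act (mx c) z) s' (act (mx c') z)))) <=
  C2 * (s + s') ^+ 2 * n1 z.
Proof.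
move=> hc hc' s0 s'0 sT; set w := E (mx c) s z.
have hs : 0 <= s <= T by lra.
have hs' : 0 <= s' <= T by lra.
have h1 := E_second_order (T := T) M1 M2 w hc' hs'.
have h2 := E_second_order (T := T) M1 M2 z hc hs.
have h3 := E_first_order (T := T) M1 M2 z hc hs.
have h4 := E_bound (T := T) M1 M2 z hc hs.
rewrite -/w -/G in h1 h2 h3 h4; rewrite -/C1 in h1 h2.
set a := sub _ _ in h1; set b := sub _ _ in h2; set d := sub _ _ in h3.
have -> : sub (E (mx c') s' w) (lin 1 z 1 (lin s (act (mx c) z) s' (act (mx c') z))) =
    lin 1 a 1 (lin 1 b s' (act (mx c') d)).
  by rewrite /a /b /d /sub act_lin; apply: vec_eq; cbn [lin fst snd]; ring.
apply: le_trans (n1_lin _ _ _ _) _; rewrite normr1 !mul1r.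
have := n1_lin 1 b s' (act (mx c') d); rewrite normr1 mul1r (ger0_norm s'0) => h5.
have h6 := ler_wpM2l s'0 (n1_act_mx M1 M2 d hc').
have h7 := ler_wpM2l s'0 (ler_wpM2l (KM_ge0 M1 M2) h3).
have N := n1_ge0 z; have K0 := KM_ge0 M1 M2; have G0 := GM_ge0 M1 M2 T.
have h8 : C1 * s' ^+ 2 * n1 w <= C1 * G * s' ^+ 2 * n1 z.
  have -> : C1 * G * s' ^+ 2 * n1 z = C1 * s' ^+ 2 * (G * n1 z) by ring.
  by rewrite ler_wpM2l// mulr_ge0 ?sqr_ge0 ?C1_ge0.
have e1 : C1 * G * s' ^+ 2 * n1 z <= C1 * G * (s + s') ^+ 2 * n1 z.
  rewrite ler_wpM2r// ler_wpM2l ?mulr_ge0 ?C1_ge0// ler_sqr ?nnegrE//; lra.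
have e2 : C1 * s ^+ 2 * n1 z <= C1 * (s + s') ^+ 2 * n1 z.
  rewrite ler_wpM2r// ler_wpM2l ?C1_ge0// ler_sqr ?nnegrE//; lra.
have e3 : 2 * KM ^+ 2 * G * (s' * s) * n1 z <= 2 * KM ^+ 2 * G * (s + s') ^+ 2 * n1 z.
  rewrite ler_wpM2r// ler_wpM2l ?mulr_ge0 ?sqr_ge0//.
  have := mulr_ge0 s0 s'0; have := sqr_ge0 s; have := sqr_ge0 s'; rewrite !expr2; lra.
rewrite /C2; lra.
Qed.

Lemma unit_word_cat w1 w2 : unit_word (w1 ++ w2) = unit_word w1 && unit_word w2.
Proof. exact: all_cat. Qed.

(** Telescoping: each local error is carried to the end by the remaining word, whose growth is at
    most G however many arcs it has. *)
Lemma flow_chain N m (ys : nat -> R * R) (us : nat -> seq (R * R)) e :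
  let W := flatten [seq us k | k <- iota m N] in
  unit_word W -> dur W <= T ->
  (forall k, (m <= k < m + N)%N -> n1 (sub (ys k.+1) (flow (us k) (ys k))) <= e) ->
  n1 (sub (ys (m + N)%N) (flow W (ys m))) <= N%:R * (G * e).
Proof.
elim: N m => [|N IH] m /=.
  move=> _ _ _; rewrite addn0 mul0r /n1 /sub /=.
  by rewrite !mulN1r !mul1r !subrr !normr0 addr0.
rewrite unit_word_cat dur_cat flow_cat => /andP[u1 u2] dT h.
set W := flatten _ in u2 dT *.
have d1 := unit_word_dur u1; have d2 := unit_word_dur u2.
apply: le_trans (n1_triangle _ (flow W (ys m.+1)) _) _.
rewrite -natr1 mulrDl mul1r lerD//; last first.
- have -> : sub (flow W (ys m.+1)) (flow W (flow (us m) (ys m))) =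
      flow W (sub (ys m.+1) (flow (us m) (ys m))) by rewrite /sub flow_lin.
  have WT : dur W <= T by lra.
  apply: le_trans (flow_bound M1 M2 _ u2 WT) _.
  by rewrite ler_wpM2l ?GM_ge0// h//; lia.
- rewrite addnS -addSn; apply: IH => //; first lra.
  by move=> k hk; apply: h; lia.
Qed.

Lemma mx_average c c0 c1 da db z : (da + db) * c = da * c0 + db * c1 ->
  lin 1 z (da + db) (act (mx c) z) =
  lin 1 z 1 (lin da (act (mx c0) z) db (act (mx c1) z)).
Proof.
move=> cE; apply: vec_eq => /=.
  transitivity (z.1 +
    ((da + db) * c * m11 M1 + (da + db - (da + db) * c) * m11 M2) * z.1 +
    ((da + db) * c * m12 M1 + (da + db - (da + db) * c) * m12 M2) * z.2); first by ring.
  by rewrite cE; ring.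
transitivity (z.2 +
    ((da + db) * c * m21 M1 + (da + db - (da + db) * c) * m21 M2) * z.1 +
    ((da + db) * c * m22 M1 + (da + db - (da + db) * c) * m22 M2) * z.2); first by ring.
by rewrite cE; ring.
Qed.

(** Over one period the averaged arc and the two arcs agree to first order, so the local error is
    quadratic in the period; k periods with k (da + db) <= T leave an error linear in the period. *)
Lemma chattering c c0 c1 da db k y : 0 <= c <= 1 -> 0 <= c0 <= 1 -> 0 <= c1 <= 1 -> 0 <= da -> 0 <= db ->
  0 < da + db -> k%:R * (da + db) <= T ->
  (da + db) * c = da * c0 + db * c1 ->
  n1 (sub (E (mx c) (k%:R * (da + db)) y)
          (flow (flatten (nseq k [:: (c0, da); (c1, db)])) y)) <=
  T * (G * ((C1 + C2) * G)) * (da + db) * n1 y.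
Proof.
move=> hc hc0 hc1 da0 db0 d0 kT cE; set d := da + db in d0 kT cE *.
pose u := [:: (c0, da); (c1, db)].
have nseqE : flatten (nseq k u) = flatten [seq u | j <- iota 0 k].
  by congr flatten; elim: k 0%N {kT} => //= k IH m; rewrite -IH.
have uW n : unit_word (flatten (nseq n u)).
  by elim: n => //= n IH; rewrite hc0 hc1 da0 db0.
have dW n : dur (flatten (nseq n u)) = n%:R * d.
  elim: n => [|n IH]; first by rewrite /= dur_nil mul0r.
  by rewrite [LHS]dur_cat IH !dur_cons dur_nil /= addr0 -natr1; rewrite /d; ring.
pose ys j := E (mx c) (j%:R * d) y.
have d_le j : (j < k)%N -> j.+1%:R * d <= T.
  move=> jk; apply: le_trans kT.
  by apply: ler_wpM2r; [exact: ltW|rewrite ler_nat].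
have := @flow_chain k 0%N ys (fun=> u) ((C1 + C2) * d ^+ 2 * (G * n1 y)).
rewrite /= -nseqE dW => /(_ (uW k) kT); have -> : ys 0%N = y by rewrite /ys mul0r E0.
rewrite add0n => H.
apply: le_trans (H _) _.
  move=> j jk; have jd := d_le j jk.
  have j0 : 0 <= j%:R * d by rewrite mulr_ge0// ltW.
  have dT : d <= T by move: jd; rewrite -natr1; lra.
  set z := ys j; have -> : ys j.+1 = E (mx c) d z.
    by rewrite /z /ys -E_add -natr1 mulrDl mul1r addrC.
  set L := lin 1 z 1 (lin da (act (mx c0) z) db (act (mx c1) z)).
  apply: le_trans (n1_triangle _ L _) _.
  have hd : 0 <= d <= T by rewrite (ltW d0).
  have h1 := E_second_order (T := T) M1 M2 z hc hd.
  have h2 := two_arc_expansion z hc0 hc1 da0 db0 dT.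
  have LE : lin 1 z d (act (mx c) z) = L by exact: mx_average.
  rewrite LE -/G -/C1 in h1.
  have -> : n1 (sub L (flow u z)) = n1 (sub (flow u z) L).
    rewrite /n1 /sub; cbn [lin fst snd]; rewrite !mul1r !mulN1r.
    by rewrite distrC [X in _ + X]distrC.
  rewrite -/L -/d in h2.
  have zb : n1 z <= G * n1 y.
    by apply: E_bound => //; rewrite j0 /=; move: jd; rewrite -natr1; lra.
  have : (C1 + C2) * d ^+ 2 * n1 z <= (C1 + C2) * d ^+ 2 * (G * n1 y).
    by rewrite ler_wpM2l// mulr_ge0 ?sqr_ge0// addr_ge0 ?C1_ge0 ?C2_ge0.
  rewrite /= in h2 *; lra.
have -> : k%:R * (G * ((C1 + C2) * d ^+ 2 * (G * n1 y))) =
   (k%:R * d) * (G * ((C1 + C2) * G) * d * n1 y) by ring.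
have -> : T * (G * ((C1 + C2) * G)) * d * n1 y = T * (G * ((C1 + C2) * G) * d * n1 y) by ring.
apply: ler_wpM2r; last by [].
have G0 := GM_ge0 M1 M2 T; have C120 := addr_ge0 C1_ge0 C2_ge0.
exact: mulr_ge0 (mulr_ge0 (mulr_ge0 G0 (mulr_ge0 C120 G0)) (ltW d0)) (n1_ge0 y).
Qed.

End Chattering.

(** * Existence of minima over words of prescribed length *)

Section WordMinimum.
Variable R : realType.
Variables (M1 M2 : mat2 R) (T : R).
Hypothesis T_ge0 : 0 <= T.
Implicit Types (y z : R * R) (c t s r h : R) (p l : R * R) (w : seq (R * R)).
Local Notation flow := (flow M1 M2).
Local Notation mx := (mx M1 M2).
Local Notation KM := (KM M1 M2).
Local Notation G := (GM M1 M2 T).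

Lemma continuous_dominated (P : topologicalType) (f g : P -> R) (x : P) :
  (forall u, `|f x - f u| <= g u) -> g x = 0 -> {for x, continuous g} ->
  {for x, continuous f}.
Proof.
move=> fg g0 cg; apply/cvgrPdist_lt => e e0.
have /cvgrPdist_lt /(_ e e0) := cg; rewrite g0.
apply: filterS => u; rewrite sub0r normrN => gu.
exact: le_lt_trans (fg u) (le_lt_trans (ler_norm _) gu).
Qed.

(** Joint continuity: the variation in the state and in the control value is dominated by the
    Lipschitz estimates, and that in time by continuity at the fixed base point. *)
Lemma continuous_E (P : topologicalType) (c t z1 z2 : P -> R) (x : P) :
  (forall u, 0 <= c u <= 1) -> (forall u, 0 <= t u <= T) ->
  {for x, continuous c} -> {for x, continuous t} ->
  {for x, continuous z1} -> {for x, continuous z2} ->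
  {for x, continuous (fun u => (E (mx (c u)) (t u) (z1 u, z2 u)).1)} /\
  {for x, continuous (fun u => (E (mx (c u)) (t u) (z1 u, z2 u)).2)}.
Proof.
move=> hc ht cc ct cz1 cz2; pose z := (z1 x, z2 x).
pose g (pr : R * R -> R) u := G * (`|z1 u - z1 x| + `|z2 u - z2 x|) +
  2 * KM * G ^+ 2 * T * n1 z * `|c u - c x| +
  `|pr (E (mx (c x)) (t u) z) - pr (E (mx (c x)) (t x) z)|.
have gx pr : g pr x = 0 by rewrite /g !subrr normr0; ring.
have cg pr : continuous (fun s => pr (E (mx (c x)) s z)) -> {for x, continuous (g pr)}.
  move=> cpr; have cb (k : P -> R) a : {for x, continuous k} ->
      {for x, continuous (fun u => `|k u - a|)}.
    by move=> ck; apply: cvg_norm; apply: cvgB; [exact: ck|exact: cvg_cst].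
  apply: cvgD; [apply: cvgD|].
  - by apply: cvgM; [exact: cvg_cst|apply: cvgD; exact: cb].
  - by apply: cvgM; [exact: cvg_cst|exact: cb].
  - apply: (cb (fun u => pr (E (mx (c x)) (t u) z))).
    by apply: (@continuous_comp _ _ _ t (fun s => pr (E (mx (c x)) s z))); [exact: ct|exact: cpr].
have bnd u : n1 (sub (E (mx (c u)) (t u) (z1 u, z2 u)) (E (mx (c x)) (t u) z)) <=
    G * (`|z1 u - z1 x| + `|z2 u - z2 x|) + 2 * KM * G ^+ 2 * T * n1 z * `|c u - c x|.
  apply: le_trans (n1_triangle _ (E (mx (c u)) (t u) z) _) _; apply: lerD.
    have -> : sub (E (mx (c u)) (t u) (z1 u, z2 u)) (E (mx (c u)) (t u) z) =
        E (mx (c u)) (t u) (sub (z1 u, z2 u) z) by rewrite /sub E_lin.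
    apply: le_trans (E_bound M1 M2 _ (hc u) (ht u)) _; rewrite /n1 /sub /=.
    by rewrite !mul1r !mulN1r.
  have := E_lipschitz M1 M2 z (hc x) (hc u) (ht u); lra.
split; [apply: (continuous_dominated _ (gx fst) (cg fst _)) => [u|] |
        apply: (continuous_dominated _ (gx snd) (cg snd _)) => [u|]];
  try exact: continuous_E1; try exact: continuous_E2; rewrite -/z distrC.
- apply: le_trans (ler_distD (E (mx (c x)) (t u) z).1 _ _) _; apply: lerD => //.
  apply: le_trans (bnd u); apply: le_trans (n1_1 _).
  by rewrite /sub; cbn [lin fst snd]; rewrite mul1r mulN1r.
- apply: le_trans (ler_distD (E (mx (c x)) (t u) z).2 _ _) _; apply: lerD => //.
  apply: le_trans (bnd u); apply: le_trans (n1_2 _).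
  by rewrite /sub; cbn [lin fst snd]; rewrite mul1r mulN1r.
Qed.

Lemma continuous_flow (P : topologicalType) (I : Type) (c t : I -> P -> R) (l : seq I) y :
  (forall i u, 0 <= c i u <= 1) -> (forall i u, 0 <= t i u <= T) ->
  (forall i, continuous (c i)) -> (forall i, continuous (t i)) ->
  continuous (fun u => (flow [seq (c i u, t i u) | i <- l] y).1) /\
  continuous (fun u => (flow [seq (c i u, t i u) | i <- l] y).2).
Proof.
move=> hc ht cc ct.
elim/last_ind: l => [|l i [IH1 IH2]]; first by split=> u; exact: cvg_cst.
have eq u : flow [seq (c j u, t j u) | j <- rcons l i] y =
   E (mx (c i u)) (t i u) ((flow [seq (c j u, t j u) | j <- l] y).1,
                           (flow [seq (c j u, t j u) | j <- l] y).2).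
  by rewrite map_rcons -cats1 flow_cat /= -surjective_pairing.
have H x := @continuous_E P (c i) (t i) _ _ x (hc i) (ht i) (@cc i x) (@ct i x) (IH1 x) (IH2 x).
split.
  under [X in continuous X]eq_fun do rewrite eq.
  by move=> x; have [] := H x.
under [X in continuous X]eq_fun do rewrite eq.
by move=> x; have [] := H x.
Qed.

(** Truncation to [0, b]: it makes functions estimated only on an admissible range continuous
    everywhere. *)
Definition clamp (b x : R) : R := Num.max 0 (Num.min x b).

Lemma clamp_in b x : 0 <= b -> 0 <= clamp b x <= b.
Proof. by move=> b0; rewrite le_max lexx /= ge_max b0 ge_min lexx orbT. Qed.

Lemma clamp_id b x : 0 <= x <= b -> clamp b x = x.
Proof. by move=> /andP[x0 xb]; rewrite /clamp (min_idPl xb) (max_idPr x0). Qed.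

Lemma continuous_clamp b (P : topologicalType) (f : P -> R) : continuous f ->
  continuous (fun u => clamp b (f u)).
Proof.
move=> cf x; apply: (@continuous_max _ _ (cst 0) (fun u => Num.min (f u) b)).
  exact: cvg_cst.
by apply: (@continuous_min _ _ f (cst b)); [exact: cf|exact: cvg_cst].
Qed.

Lemma continuous_cost (P : topologicalType) (f : P -> R * R) :
  continuous (fun u => (f u).1) -> continuous (fun u => (f u).2) ->
  continuous (fun u => cost (f u)).
Proof.
move=> c1 c2 x; rewrite /cost; apply: cvgB; last by apply: cvgM; [exact: c1|exact: c2].
by apply: cvgD; rewrite expr2; [apply: cvgM; exact: c1|apply: cvgM; exact: c2].
Qed.

Definition pattern n (S : 'I_n -> set R) w :=
  [/\ size w = n, dur w = T & forall i : 'I_n, S i (nth 0 w i).1 /\ 0 <= (nth 0 w i).2].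

(** Words become row vectors listing the n control values and then the n durations; the pattern cuts
    out a compact set, on which clamping changes nothing. *)
Lemma word_minimum n (S : 'I_n -> set R) y :
  (forall i, compact (S i)) -> (forall i c, S i c -> 0 <= c <= 1) ->
  (exists w, pattern S w) ->
  exists2 w, pattern S w & forall w', pattern S w' -> cost (flow w y) <= cost (flow w' y).
Proof.
move=> cS S01 [w0 pw0].
pose c i (v : 'rV[R]_(n + n)) : R := v 0 (lshift n i).
pose t i (v : 'rV[R]_(n + n)) : R := v 0 (rshift n i).
pose word v := [seq (c i v, t i v) | i <- enum 'I_n].
pose B (j : 'I_(n + n)) : set R := match fintype.split j with inl i => S i | inr i => `[0, T]%classic end.
pose A := [set v : 'rV[R]_(n + n) | forall j, B j (v 0 j)] `&`
          [set v | \sum_(i < n) t i v = T].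
have c_cont i : continuous (c i) by exact: coord_continuous.
have t_cont i : continuous (t i) by exact: coord_continuous.
have cA : compact A.
  apply: compact_closedI.
    apply: rV_compact => j; rewrite /B; case: (fintype.split j) => i; first exact: cS.
    exact: segment_compact.
  apply: (@preimage_closed _ _ (fun v => \sum_(i < n) t i v) [set x | x = T]).
    move=> v _; have := @continuous_big _ 'I_n +%R 0 xpredT add_continuous _ (index_enum 'I_n) t (fun i _ => t_cont i).
    by move=> /(_ v).
  exact: closed_eq.
have wordP v i : nth 0 (word v) (nat_of_ord i) = (c i v, t i v).
  rewrite /word (nth_map i) ?nth_ord_enum// size_enum_ord.
  exact: ltn_ord.
have dur_word v : dur (word v) = \sum_(i < n) t i v.
  by rewrite /dur big_map big_enum.
have word_pattern v : A v <-> pattern S (word v).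
  split=> [[hB hs]|[_ hd hS]].
    split; [by rewrite size_map size_enum_ord|by rewrite dur_word|move=> i].
    rewrite wordP /=; have := hB (lshift n i); have := hB (rshift n i).
    rewrite /B (unsplitK (inl i)) (unsplitK (inr i)) /= in_itv /=.
    by move=> /andP[? _] ?.
  have hs : \sum_(i < n) t i v = T by rewrite -dur_word.
  split=> // j; rewrite /B; case: splitP => i ji.
    have -> : j = lshift n i by apply: val_inj.
    by have [] := hS i; rewrite wordP.
  have -> : j = rshift n i by apply: val_inj.
  have t_ge0 k : 0 <= t k v by have [_] := hS k; rewrite wordP.
  rewrite /= in_itv /= -/(t i v) t_ge0 -hs (bigD1 i)//= lerDl.
  by apply: sumr_ge0 => k _.
have word_surj w : size w = n -> exists v, word v = w.
  move=> sw; pose w1 (j : 'I_(n + n)) : R := match fintype.split j with inl i => (nth 0 w (nat_of_ord i)).1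
                                | inr i => (nth 0 w (nat_of_ord i)).2 end.
  exists (\row_(j < n + n) w1 j).
  apply: (@eq_from_nth _ 0); first by rewrite size_map size_enum_ord sw.
  move=> i; rewrite size_map size_enum_ord => iN.
  rewrite -[i]/(nat_of_ord (Ordinal iN)) wordP /c /t !mxE /w1.
  by rewrite (unsplitK (inl _)) (unsplitK (inr _)) /= -surjective_pairing.
have [v0 wv0] : exists v0, word v0 = w0 by apply: word_surj; case: pw0.
have v0A : A v0 by apply/word_pattern; rewrite wv0.
pose cc i (v : 'rV[R]_(n + n)) := clamp 1 (c i v).
pose ct i (v : 'rV[R]_(n + n)) := clamp T (t i v).
pose f v := cost (flow [seq (cc i v, ct i v) | i <- enum 'I_n] y).
have fE v : A v -> f v = cost (flow (word v) y).
  move=> Av; rewrite /f /word; congr (cost (flow _ _)).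
  apply/eq_map => i; have [hB _] := Av.
  have := hB (lshift n i); have := hB (rshift n i).
  rewrite /B (unsplitK (inl i)) (unsplitK (inr i)) /= in_itv /= => ht hc.
  by rewrite /cc /ct !clamp_id//; exact: S01 hc.
have f_cont : continuous f.
  have [] := @continuous_flow _ _ cc ct (enum 'I_n) y _ _ _ _.
  - by move=> i u; exact: clamp_in.
  - by move=> i u; exact: clamp_in.
  - by move=> i; exact: continuous_clamp.
  - by move=> i; exact: continuous_clamp.
  - by move=> h1 h2; exact: continuous_cost.
have [|v vA vmin] := @compact_EVT_min _ R f A _ cA (continuous_subspaceT f_cont).
  by exists v0.
rewrite inE in vA; exists (word v); first exact/word_pattern.
move=> w' pw'; have [v' wv'] : exists v', word v' = w' by apply: word_surj; case: pw'.
have v'A : A v' by apply/word_pattern; rewrite wv'.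
by rewrite -wv' -!fE//; apply: vmin; rewrite inE.
Qed.

End WordMinimum.

(** * The planar optimum *)

Section ScalarTimes.
Variable R : realType.
Implicit Types (A : mat2 R) (y z : R * R) (s t k : R).

Definition scalar_time A t := exists k, forall y, E A t y = scale k y.

Lemma scalar_time0 A : scalar_time A 0.
Proof. by exists 1 => y; rewrite E0 scale1. Qed.

Lemma scalar_timeD A s t : scalar_time A s -> scalar_time A t -> scalar_time A (s + t).
Proof.
by move=> [k hk] [l hl]; exists (k * l) => y; rewrite E_add hl E_scale hk scale_scale mulrC.
Qed.

Lemma scalar_time_fb A t : fb A t = 0 -> scalar_time A t.
Proof. by move=> h; exists (fa A t) => y; exact: E_scalar. Qed.

End ScalarTimes.

Section Nonattainment.
Variable R : realType.
Variables (M1 M2 : mat2 R) (T : R) (y0 : R * R).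
Implicit Types (y z : R * R) (c t s r h : R) (p l : R * R) (w : seq (R * R)).
Local Notation flow := (flow M1 M2).
Local Notation mx := (mx M1 M2).
Local Notation best := (best M1 M2 T y0).

Lemma cost_lipschitz y z : `|cost y - cost z| <= 2 * n1 (sub y z) * (n1 y + n1 z).
Proof.
have -> : cost y - cost z = (y.1 - z.1) * (y.1 + z.1 - z.2) + (y.2 - z.2) * (y.2 + z.2 - y.1).
  by rewrite /cost; ring.
apply: le_trans (ler_normD _ _) _; rewrite !normrM.
have -> : n1 (sub y z) = `|y.1 - z.1| + `|y.2 - z.2|.
  by rewrite /n1 /sub /= !mul1r !mulN1r.
set a := `|_ - _|; set b := `|y.2 - z.2|.
have h1 : `|y.1 + z.1 - z.2| <= n1 y + n1 z.
  by have := ler_normB (y.1 + z.1) z.2; have := ler_normD y.1 z.1; have := normr_ge0 y.2; rewrite /n1; lra.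
have h2 : `|y.2 + z.2 - y.1| <= n1 y + n1 z.
  by have := ler_normB (y.2 + z.2) y.1; have := ler_normD y.2 z.2; have := normr_ge0 z.1; rewrite /n1; lra.
have a0 : 0 <= a := normr_ge0 _; have b0 : 0 <= b := normr_ge0 _.
have := ler_wpM2l a0 h1; have := ler_wpM2l b0 h2.
have := mulr_ge0 (addr_ge0 a0 b0) (addr_ge0 (n1_ge0 y) (n1_ge0 z)); lra.
Qed.

Definition cswitch c0 i : R := if odd i then 1 - c0 else c0.

Lemma best_nth_type w i : best w -> (i < size w)%N -> (nth 0 w i).1 = cswitch (nth 0 w 0).1 i.
Proof.
move=> b; elim: i => // i IH iw; rewrite (best_alternate b iw) IH ?(ltnW iw)//.
by rewrite /cswitch /=; case: (odd i) => /=; ring.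
Qed.

Lemma seq_min_exists (l : seq R) : l != [::] -> exists2 m, m \in l & forall x, x \in l -> m <= x.
Proof.
elim: l => // a l IH _; have [->|l0] := eqVneq l [::].
  by exists a; rewrite ?mem_head// => x; rewrite inE => /eqP ->.
have [m ml mmin] := IH l0; have [am|ma] := leP a m.
  exists a; rewrite ?mem_head// => x; rewrite inE => /orP[/eqP ->//|/mmin].
  exact: le_trans am.
exists m; rewrite ?inE ?ml ?orbT// => x; rewrite inE => /orP[/eqP ->|/mmin//].
exact: ltW.
Qed.

(* Scalar excess times commute with everything and can be collected. *)
Lemma collect_excess (d : R -> R) w :
  all (fun p => is_bang p.1) w ->
  (forall p, p \in w -> d p.1 <= p.2 /\ scalar_time (mx p.1) (p.2 - d p.1)) ->
  exists e0 e1, [/\ 0 <= e0, 0 <= e1, scalar_time (mx 0) e0, scalar_time (mx 1) e1 &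
    dur w = e0 + e1 + dur [seq (p.1, d p.1) | p <- w] /\
    forall y, flow w y = E (mx 0) e0 (E (mx 1) e1 (flow [seq (p.1, d p.1) | p <- w] y))].
Proof.
elim: w => [|[c t] w IH] /=.
  move=> _ _; exists 0, 0; split=> //; try exact: scalar_time0.
  by rewrite !dur_nil !addr0; split=> // y; rewrite !E0.
move=> /andP[hc aw] H.
have [|e0 [e1 [e00 e10 sc0 sc1 [dE fE]]]] := IH aw.
  by move=> p pw; apply: H; rewrite inE pw orbT.
have [/= dt sct] := H (c, t) (mem_head _ _); have ge0 : 0 <= t - d c by rewrite subr_ge0.
have ecomm A s u y : scalar_time A s -> exists2 k, E A s u = scale k u & E A s y = scale k y.
  by move=> [k hk]; exists k.
have [k1 hk1] := sct; have [k2 hk2] := sc0; have [k3 hk3] := sc1.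
have tE y : E (mx c) t y = scale k1 (E (mx c) (d c) y) by rewrite -hk1 -E_add subrK.
case/orP: hc => /eqP cE; subst c.
  exists (t - d 0 + e0), e1; split=> //; [exact: addr_ge0|exact: scalar_timeD|split].
    by rewrite !dur_cons dE /=; ring.
  move=> y; rewrite fE tE E_add !flow_scale hk1 !hk2 !hk3 !scale_scale.
  by congr scale; ring.
exists e0, (t - d 1 + e1); split=> //; [exact: addr_ge0|exact: scalar_timeD|split].
  by rewrite !dur_cons dE /=; ring.
move=> y; rewrite fE tE E_add !flow_scale !hk3 hk1 !hk2 !scale_scale.
by congr scale; ring.
Qed.

Lemma alternating_word c0 (d : R -> R) w :
  (forall i, (i < size w)%N -> (nth 0 w i).1 = cswitch c0 i) ->
  [seq (p.1, d p.1) | p <- w] =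
  flatten (nseq (size w)./2 [:: (c0, d c0); (1 - c0, d (1 - c0))]) ++
  nseq (odd (size w)) (c0, d c0).
Proof.
have [n] := ubnP (size w); elim: n w => // n IH [|p [|p' w]] //= wn H.
  by have /= -> := H 0%N isT.
have /= -> := H 0%N isT; have /= -> := H 1%N isT.
rewrite negbK IH//.
  by move: wn; lia.
by move=> i iw; have /= -> := H i.+2 iw; rewrite /cswitch /= negbK.
Qed.

Hypothesis y0_neq0 : y0 != 0.

(** Telescopes [best_excess] along arcs of equal parity. Both signs are carried along because i may
    precede or follow j. *)
Lemma interior_difference w i j : best w -> (4 < size w)%N ->
  (0 < i)%N -> (i.+1 < size w)%N -> (0 < j)%N -> (j.+1 < size w)%N -> odd i = odd j ->
  scalar_time (mx (nth 0 w i).1) ((nth 0 w i).2 - (nth 0 w j).2).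
Proof.
move=> b n5 i0 iw j0 jw oij.
have typ k : (k.+1 < size w)%N -> odd k = odd i -> (nth 0 w k).1 = (nth 0 w i).1.
  by move=> kw ok; rewrite (best_nth_type b (ltnW kw)) (best_nth_type b (ltnW iw)) /cswitch ok.
have up m k : (0 < k)%N -> odd k = odd i -> ((k + m.*2).+1 < size w)%N ->
    scalar_time (mx (nth 0 w i).1) ((nth 0 w (k + m.*2)).2 - (nth 0 w k).2) /\
    scalar_time (mx (nth 0 w i).1) ((nth 0 w k).2 - (nth 0 w (k + m.*2)).2).
  move=> k0 ok; elim: m => [|m IH] kw.
    by rewrite addn0 subrr; split; exact: scalar_time0.
  rewrite doubleS !addnS in kw *; have [IH1 IH2] := IH (ltnW (ltnW kw)).
  have km0 : (0 < k + m.*2)%N by rewrite addn_gt0 k0.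
  have [e1 e2] := best_excess y0_neq0 b n5 km0 kw.
  rewrite typ in e1 e2; last by rewrite oddD odd_double addbF.
    split.
      rewrite -[X in scalar_time _ X](subrKA (nth 0 w (k + m.*2)).2).
      exact: scalar_timeD (scalar_time_fb e1) IH1.
    rewrite -[X in scalar_time _ X](subrKA (nth 0 w (k + m.*2)).2).
    exact: scalar_timeD IH2 (scalar_time_fb e2).
  exact/ltnW/ltnW.
have [ij|/ltnW ji] := leqP i j.
  have e : j = (i + (j - i)./2.*2)%N.
    have := odd_double_half (j - i); rewrite oddB// oij addbb add0n => ->.
    by rewrite subnKC.
  by rewrite e; have [] := up (j - i)./2 i i0 erefl; rewrite -?e.
have e : i = (j + (i - j)./2.*2)%N.
  have := odd_double_half (i - j); rewrite oddB// oij addbb add0n => ->.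
  by rewrite subnKC.
have [] := up (i - j)./2 j j0 (esym oij); rewrite -e//.
Qed.

End Nonattainment.

Section PlanarOptimum.
Variable R : realType.
Variables (M1 M2 : mat2 R) (T : R) (y0 : R * R).
Hypothesis y0_neq0 : y0 != 0.
Hypothesis T_ge0 : 0 <= T.
Implicit Types (y z : R * R) (c t s r h : R) (p l : R * R) (w : seq (R * R)).
Local Notation flow := (flow M1 M2).
Local Notation mx := (mx M1 M2).
Local Notation isbb := (isbb T).
Local Notation val := (val M1 M2 y0).
Local Notation best := (best M1 M2 T y0).
Local Notation G := (GM M1 M2 T).
Local Notation KM := (KM M1 M2).
Local Notation C1 := (C1 M1 M2 T).
Local Notation C2 := (C2 M1 M2 T).

(** The first summand is the error of the complete periods, the second that of an unpaired last
    arc. *)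
Definition C3 := T * (G * ((C1 + C2) * G)) + 4 * KM * G * G.

Lemma averaging c c0 c1 da db k (b : bool) z
    (w := flatten (nseq k [:: (c0, da); (c1, db)]) ++ nseq b (c0, da)) :
  0 <= c <= 1 -> 0 <= c0 <= 1 -> 0 <= c1 <= 1 -> 0 <= da -> 0 <= db -> 0 < da + db ->
  (da + db) * c = da * c0 + db * c1 -> dur w <= T ->
  k%:R * (da + db) <= T /\
  n1 (sub (E (mx c) (dur w) z) (flow w z)) <= C3 * (da + db) * n1 z.
Proof.
move=> hc hc0 hc1 da0 db0 d0 cE.
have dW n : dur (flatten (nseq n [:: (c0, da); (c1, db)])) = n%:R * (da + db).
  elim: n => [|n IH]; first by rewrite /= dur_nil mul0r.
  by rewrite [LHS]dur_cat IH !dur_cons dur_nil /= addr0 -natr1; ring.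
have uW n : unit_word (flatten (nseq n [:: (c0, da); (c1, db)])).
  by elim: n => //= n IH; rewrite hc0 hc1 da0 db0.
have K0 := KM_ge0 M1 M2; have G0 := GM_ge0 M1 M2 T; have N0 := n1_ge0 z.
have d0' := ltW d0.
have C30 : 0 <= 4 * KM * G * G by rewrite !mulr_ge0.
rewrite /w dur_cat dW; case: b {w} => /=; last first.
  rewrite dur_nil addr0 cats0 => kT; split=> //.
  apply: le_trans (chattering M1 M2 T_ge0 z hc hc0 hc1 da0 db0 d0 kT cE) _.
  by rewrite ler_wpM2r// ler_wpM2r// /C3 lerDl.
rewrite dur_cons dur_nil /= addr0 => kT.
have kd0 : 0 <= k%:R * (da + db) by rewrite mulr_ge0.
have kT' : k%:R * (da + db) <= T by lra.
split=> //; rewrite addrC E_add flow_cat /=.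
set u := E _ _ z; set v := flow _ z.
have ch := chattering M1 M2 T_ge0 z hc hc0 hc1 da0 db0 d0 kT' cE; rewrite -/u -/v in ch.
have hda : 0 <= da <= T by rewrite da0; lra.
have h1 := E_first_order M1 M2 u hc hda.
have h2 := E_first_order M1 M2 v hc0 hda; rewrite n1_subC in h2.
have hu : n1 u <= G * n1 z by apply: E_bound => //; rewrite kd0.
have hv : n1 v <= G * n1 z by apply: flow_bound; rewrite ?dW.
apply: le_trans (n1_triangle _ u _) _.
apply: le_trans (lerD h1 (n1_triangle _ v _)) _.
apply: le_trans (lerD (lexx _) (lerD ch h2)) _.
have A0 : 0 <= 2 * KM * G * da by rewrite !mulr_ge0.
have k1 := ler_wpM2l A0 hu; have k2 := ler_wpM2l A0 hv.
have k3 : 4 * KM * G * G * n1 z * da <= 4 * KM * G * G * n1 z * (da + db).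
  by rewrite ler_wpM2l ?lerDl// mulr_ge0.
rewrite /C3; lra.
Qed.

(** Three free values yield a control in [PC 2], and the final bang value a control in [B 0]. *)
Definition four_arc_set (i : 'I_4) : set R :=
  if (i < 3)%N then `[0, 1]%classic else [set 0; 1].
Definition four_arcs := pattern T four_arc_set.

Lemma four_arcsP c1 c2 c3 c4 t1 t2 t3 t4 :
  0 <= c1 <= 1 -> 0 <= c2 <= 1 -> 0 <= c3 <= 1 -> is_bang c4 ->
  0 <= t1 -> 0 <= t2 -> 0 <= t3 -> 0 <= t4 -> t1 + (t2 + (t3 + t4)) = T ->
  four_arcs [:: (c1, t1); (c2, t2); (c3, t3); (c4, t4)].
Proof.
move=> h1 h2 h3 h4 p1 p2 p3 p4 e; split=> //.
  by rewrite !dur_cons dur_nil /= addr0.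
have seg c : 0 <= c <= 1 -> `[0, 1]%classic c by rewrite /= in_itv.
case=> [[|[|[|[|//]]]]] i4 /=; rewrite /four_arc_set /=; split=> //; try exact: seg.
by case/orP: h4 => /eqP ->; [left|right].
Qed.

Lemma bang_unit c : is_bang c -> 0 <= c <= 1.
Proof. by case/orP => /eqP ->; rewrite ?lexx ler01. Qed.

Lemma bang_compl c : is_bang c -> is_bang (1 - c).
Proof. by case/orP => /eqP ->; rewrite /is_bang ?subr0 ?subrr eqxx ?orbT. Qed.

Lemma isbb_unit w : isbb w -> unit_word w.
Proof.
move=> /andP[/allP h _]; apply/allP => p /h /andP[hp ->].
by rewrite bang_unit.
Qed.

Lemma shortest_interior_arc w (b : bool) : (3 < size w)%N -> exists k,
  [/\ (0 < k)%N, (k.+1 < size w)%N, odd k = b & forall i, (0 < i)%N -> (i.+1 < size w)%N ->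
     odd i = b -> (nth 0 w k).2 <= (nth 0 w i).2].
Proof.
move=> n3; pose l := [seq i <- iota 1 (size w).-2 | odd i == b].
have lP i : (i \in l) = [&& odd i == b, (0 < i)%N & (i.+1 < size w)%N].
  by rewrite mem_filter mem_iota; case: (odd i == b) => //=; lia.
have l0 : [seq (nth 0 w i).2 | i <- l] != [::].
  have : (if b then 1%N else 2%N) \in l by rewrite lP; case: b {l lP}; rewrite /=; lia.
  by case: l {lP}.
have [m /mapP[k kl ->] kmin] := seq_min_exists l0.
move: kl; rewrite lP => /and3P[/eqP ok k0 kw]; exists k; split=> // i i0 iw oi.
by apply: kmin; apply: map_f; rewrite lP oi eqxx i0.
Qed.

(** The Lipschitz bound of the cost at endpoints of norm at most G * n1 y0, multiplied by the
    endpoint error per unit of period; the last factor T bounds the number of periods times the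
    period. *)
Definition C4 := 2 * (G * (C3 * (G * n1 y0))) * (G * n1 y0 + G * n1 y0) * T.

(* The scalar excess durations go to the first two arcs; the remaining interior
   alternates two shortest arcs, and is replaced by their average. *)
Lemma best_near_four_arcs w : best w -> (5 < size w)%N ->
  exists2 w4, four_arcs w4 & ((size w - 3)./2)%:R * (val w4 - val w) <= C4.
Proof.
move=> b n5; have n4 := ltnW n5; have n3 := ltnW n4.
have [k0 [k00 k0w ok0 k0min]] := shortest_interior_arc false n3.
have [k1 [k10 k1w ok1 k1min]] := shortest_interior_arc true n3.
pose c0 := (nth 0 w 0).1; pose c1 := 1 - c0.
have [hc0 _] := best_nth b (leq_trans (ltn0Sn 4) n4); rewrite -/c0 in hc0.
have hc1 : is_bang c1 := bang_compl hc0.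
have c10 : c1 != c0 by case/orP: hc0 => /eqP e; rewrite /c1 e ?subr0 ?subrr ?oner_eq0// eq_sym oner_eq0.
(* Interior arcs of even index have type [c0] and those of odd index type [c1], so [d] gives the
   shortest interior duration of each type. *)
pose d c := if c == c0 then (nth 0 w k0).2 else (nth 0 w k1).2.
have dc0 : d c0 = (nth 0 w k0).2 by rewrite /d eqxx.
have dc1 : d c1 = (nth 0 w k1).2 by rewrite /d (negbTE c10).
have D0 : 0 < d c0 by rewrite dc0; have [] := best_nth b (ltnW k0w).
have D1 : 0 < d c1 by rewrite dc1; have [] := best_nth b (ltnW k1w).
have intP i : (0 < i)%N -> (i.+1 < size w)%N ->
    d (nth 0 w i).1 <= (nth 0 w i).2 /\
    scalar_time (mx (nth 0 w i).1) ((nth 0 w i).2 - d (nth 0 w i).1).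
  move=> i0 iw; have ty := best_nth_type b (ltnW iw); rewrite -/c0 in ty.
  case oi : (odd i); rewrite /cswitch oi in ty.
    have -> : d (nth 0 w i).1 = (nth 0 w k1).2 by rewrite ty.
    by split; [exact: k1min|apply: (interior_difference y0_neq0 b n4) => //; rewrite ok1].
  have -> : d (nth 0 w i).1 = (nth 0 w k0).2 by rewrite ty.
  by split; [exact: k0min|apply: (interior_difference y0_neq0 b n4) => //; rewrite ok0].
have typ i : (i < size w)%N -> (nth 0 w i).1 = cswitch c0 i by move=> iw; exact: (best_nth_type b iw).
have bb : isbb w by case: b.
clearbody d c0.
case: w b n5 n4 n3 k0w k1w k0min k1min dc0 dc1 intP typ bb
  => [//|[a0 t0] [//|[a1 t1] w2]] b n5 n4 n3 k0w k1w _ _ _ _ intP typ bb.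
have /= a0E := typ 0%N isT; have /= a1E := typ 1%N isT; subst a0 a1.
case/lastP: w2 b n5 n4 n3 k0w k1w intP typ bb => [//|mid xl] b n5 _ _ _ _ intP typ bb.
have midP i : (i < size mid)%N -> nth 0 mid i = nth 0 [:: (c0, t0), (c1, t1) & rcons mid xl] i.+2.
  by move=> im; rewrite /= nth_rcons im.
have size_w : size [:: (c0, t0), (c1, t1) & rcons mid xl] = (size mid).+3.
  by rewrite /= size_rcons.
rewrite size_w in n5 intP typ.
have mid_typ i : (i < size mid)%N -> (nth 0 mid i).1 = cswitch c0 i.
  move=> im; have i2 : (i.+2 < (size mid).+3)%N by rewrite !ltnS ltnW.
  by rewrite (midP i im) (typ _ i2) /cswitch /= negbK.
have mid_exc p : p \in mid -> d p.1 <= p.2 /\ scalar_time (mx p.1) (p.2 - d p.1).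
  by move=> /(nthP 0)[i im <-]; rewrite (midP i im); apply: intP.
have mid_bang : all (fun p => is_bang p.1) mid.
  apply/(all_nthP 0) => j jm; rewrite (mid_typ j jm) /cswitch.
  by case: (odd j).
have [e0 [e1 [e00 e10 sc0 sc1 [dE fE]]]] := collect_excess mid_bang mid_exc.
(* [collect_excess] sorts the excess by the values 0 and 1; it is relabelled by the types of the
   first and second arc, which will absorb it. *)
have [ea [eb [ea0 eb0 sca scb [abE fab]]]] : exists ea eb,
    [/\ 0 <= ea, 0 <= eb, scalar_time (mx c0) ea, scalar_time (mx c1) eb & ea + eb = e0 + e1 /\
     forall y, flow mid y = E (mx c0) ea (E (mx c1) eb (flow [seq (p.1, d p.1) | p <- mid] y))].
  case/orP: hc0 => /eqP cE.
    exists e0, e1; rewrite /c1 cE subr0; split=> //.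
  exists e1, e0; rewrite /c1 cE subrr; split=> //; split=> [|y]; first exact: addrC.
  have [ka hka] := sc0; have [kb hkb] := sc1.
  by rewrite fE !hka !hkb !scale_scale mulrC.
rewrite (alternating_word d mid_typ) -/c1 in dE fab.
set mid' := flatten _ ++ _ in dE fab.
have um' : unit_word mid'.
  rewrite /mid' unit_word_cat; apply/andP; split.
    by elim: (size mid)./2 => //= n ->; rewrite !bang_unit// !ltW.
  by case: (odd _) => //=; rewrite bang_unit// ltW.
have dm' := unit_word_dur um'.
have [/= /andP[al /eqP dT] _ _] := b.
move: al; rewrite /= all_rcons /arc_ok /= => /and3P[/andP[_ t00] /andP[_ t10] /andP[/andP[hxl txl] _]].
have dT' : t0 + ea + (t1 + eb + (dur mid' + xl.2)) = T.
  rewrite -dT !dur_cons -cats1 dur_cat dur_cons dur_nil dE /=; lra.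
have dmT : dur mid' <= T by lra.
have xlT : 0 <= xl.2 <= T by apply/andP; split; lra.
have headT : t0 + ea + (t1 + eb) <= T by lra.
(* The time average of the control over one period of the reduced interior. *)
pose c := (d c0 * c0 + d c1 * c1) / (d c0 + d c1).
have dd0 : 0 < d c0 + d c1 by exact: addr_gt0.
have cE : (d c0 + d c1) * c = d c0 * c0 + d c1 * c1 by rewrite /c; field; exact: lt0r_neq0.
have hc : 0 <= c <= 1.
  rewrite /c divr_ge0 ?(ltW dd0)//=; last first.
    have /andP[? _] := bang_unit hc0; have /andP[? _] := bang_unit hc1.
    by rewrite addr_ge0// mulr_ge0// ltW.
  have /andP[_ ?] := bang_unit hc0; have /andP[_ ?] := bang_unit hc1.
  by rewrite ler_pdivrMr// mul1r lerD// ler_piMr// ltW.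
pose w4 := [:: (c0, t0 + ea); (c1, t1 + eb); (c, dur mid'); xl].
exists w4.
  rewrite /w4; case: xl hxl txl dT' {b intP midP size_w typ dT bb w4 xlT} => cl tl /= hxl txl dT'.
  by apply: four_arcsP => //; (exact: bang_unit || exact: addr_ge0).
pose z := E (mx c1) (t1 + eb) (E (mx c0) (t0 + ea) y0).
have fw4 : flow w4 y0 = E (mx xl.1) xl.2 (E (mx c) (dur mid') z) by [].
have fw : flow [:: (c0, t0), (c1, t1) & rcons mid xl] y0 = E (mx xl.1) xl.2 (flow mid' z).
  rewrite -cats1 /= flow_cat fab /= /z; congr E.
  have [ka hka] := sca; have [kb hkb] := scb.
  rewrite hka hkb ![_ + ea]addrC ![_ + eb]addrC !E_add hka hkb !(E_scale, flow_scale, scale_scale).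
  by rewrite mulrC.
have [kd est] := averaging (k := (size mid)./2) (b := odd (size mid)) z hc (bang_unit hc0) (bang_unit hc1)
  (ltW D0) (ltW D1) dd0 cE dmT.
rewrite -/mid' in est.
have G0 := GM_ge0 M1 M2 T; have N0 := n1_ge0 y0.
have C30 : 0 <= C3.
  have K40 : 0 <= 4 * KM by rewrite mulr_ge0 ?KM_ge0.
  have C120 := addr_ge0 (C1_ge0 M1 M2 T) (C2_ge0 M1 M2 T).
  exact: addr_ge0 (mulr_ge0 T_ge0 (mulr_ge0 G0 (mulr_ge0 C120 G0))) (mulr_ge0 (mulr_ge0 K40 G0) G0).
have zb : n1 z <= G * n1 y0.
  apply: (@flow_bound _ M1 M2 T [:: (c0, t0 + ea); (c1, t1 + eb)]).
    by rewrite /unit_word /= !bang_unit// !addr_ge0.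
  by rewrite !dur_cons dur_nil /= addr0.
have diff : n1 (sub (flow w4 y0) (flow [:: (c0, t0), (c1, t1) & rcons mid xl] y0)) <=
    G * (C3 * (G * n1 y0)) * (d c0 + d c1).
  rewrite fw4 fw; set u := E _ (dur mid') z; set v := flow mid' z.
  have -> : sub (E (mx xl.1) xl.2 u) (E (mx xl.1) xl.2 v) = E (mx xl.1) xl.2 (sub u v).
    by rewrite /sub E_lin.
  apply: le_trans (E_bound M1 M2 _ (bang_unit hxl) xlT) _.
  rewrite -mulrA ler_wpM2l//; apply: le_trans est _.
  have -> : C3 * (G * n1 y0) * (d c0 + d c1) = C3 * (d c0 + d c1) * (G * n1 y0) by ring.
  by rewrite ler_wpM2l// mulr_ge0// ltW.
have u4 : unit_word w4.
  by rewrite /unit_word /= hc dm' txl !bang_unit//= !addr_ge0.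
have b4 : n1 (flow w4 y0) <= G * n1 y0.
  by apply: flow_bound => //; rewrite /w4 !dur_cons dur_nil /= addr0 dT'.
have bw : n1 (flow [:: (c0, t0), (c1, t1) & rcons mid xl] y0) <= G * n1 y0.
  by apply: flow_bound; [exact: isbb_unit|rewrite dT].
(* The first two arcs and the last one are not part of the averaged interior. *)
have -> : ((size (rcons mid xl)).+2 - 3 = size mid)%N by rewrite size_rcons !subSS subn0.
set f4 := flow w4 y0 in diff b4; set f := flow [:: _, _ & _] y0 in diff bw.
change (((size mid)./2)%:R * (cost f4 - cost f) <= C4).
have cl := le_trans (ler_norm _) (cost_lipschitz f4 f).
have cl2 : 2 * n1 (sub f4 f) * (n1 f4 + n1 f) <=
    2 * (G * (C3 * (G * n1 y0)) * (d c0 + d c1)) * (G * n1 y0 + G * n1 y0).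
  by apply: ler_pM; rewrite ?mulr_ge0 ?addr_ge0 ?n1_ge0 ?ler_wpM2l ?lerD.
apply: le_trans (ler_wpM2l (ler0n _ _) (le_trans cl cl2)) _.
have -> : (size mid)./2%:R * (2 * (G * (C3 * (G * n1 y0)) * (d c0 + d c1)) * (G * n1 y0 + G * n1 y0)) =
    2 * (G * (C3 * (G * n1 y0))) * (G * n1 y0 + G * n1 y0) * ((size mid)./2%:R * (d c0 + d c1)) by ring.
have B0 : 0 <= G * n1 y0 := mulr_ge0 G0 N0.
apply: ler_wpM2l kd.
exact: mulr_ge0 (mulr_ge0 (ler0n _ 2) (mulr_ge0 G0 (mulr_ge0 C30 B0))) (addr_ge0 B0 B0).
Qed.

End PlanarOptimum.

Section PlanarOptimumExists.
Variable R : realType.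
Variables (M1 M2 : mat2 R) (T : R) (y0 : R * R).
Hypothesis y0_neq0 : y0 != 0.
Hypothesis T_ge0 : 0 <= T.
Implicit Types (y z : R * R) (c t s r h : R) (p l : R * R) (w : seq (R * R)).
Local Notation flow := (flow M1 M2).
Local Notation isbb := (isbb T).
Local Notation val := (val M1 M2 y0).
Local Notation best := (best M1 M2 T y0).
Local Notation C4 := (C4 M1 M2 T y0).

Lemma pad_word w n : isbb w -> (size w <= n)%N ->
  exists w', [/\ isbb w', size w' = n & flow w' y0 = flow w y0].
Proof.
move=> /andP[al dT] wn; exists (w ++ nseq (n - size w) (0, 0)).
have ok0 m : all (@arc_ok R) (nseq m (0, 0)) by rewrite all_nseq /arc_ok /is_bang /= eqxx lexx orbT.
have d0 m : dur (nseq m ((0, 0) : R * R)) = 0.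
  by elim: m => [|m IH]; rewrite ?dur_nil// [LHS]dur_cons IH addr0.
have f0 m y : flow (nseq m (0, 0)) y = y.
  by elim: m y => // m IH y; rewrite /= E0; exact: IH.
split; last by rewrite flow_cat f0.
  by rewrite /isbb all_cat al ok0 dur_cat d0 addr0.
by rewrite size_cat size_nseq subnKC.
Qed.

(** Padding with arcs of duration 0 reduces words of at most n arcs to the compact pattern of
    exactly n. A minimiser with as few arcs as possible is then strictly better than every shorter
    word. *)
Lemma shortest_minimum n : (0 < n)%N -> exists w,
  [/\ best w, (size w <= n)%N & forall w', isbb w' -> (size w' <= n)%N -> val w <= val w'].
Proof.
move=> n0; pose Pn m := `[< exists w, [/\ isbb w, size w = m &
  forall w', isbb w' -> (size w' <= n)%N -> val w <= val w'] >].
have bbP w : pattern T (fun _ : 'I_n => [set 0; 1] : set R) w <-> isbb w /\ size w = n.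
  split=> [[sz d H]|[/andP[al /eqP d] sz]].
    split=> //; rewrite /isbb d eqxx andbT; apply/(all_nthP 0) => i.
    rewrite sz => iN; have [h1 h2] := H (Ordinal iN).
    by rewrite /arc_ok h2 andbT /is_bang; case: h1 => -> ; rewrite eqxx ?orbT.
  split=> // i; have /andP[h1 ->] := all_nthP 0 al i (eq_ind_r (fun m => (i < m)%N) (ltn_ord i) sz).
  by split=> //; case/orP: h1 => /eqP ->; [left|right].
have [w /bbP[wb wn] wmin] : exists2 w, pattern T (fun _ : 'I_n => [set 0; 1] : set R) w &
    forall w', pattern T (fun _ : 'I_n => [set 0; 1] : set R) w' -> val w <= val w'.
  apply: (@word_minimum R M1 M2 T T_ge0 _ _ y0).
  - by move=> _; apply: finite_compact; exact: finite_set2.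
  - by move=> _ c [] ->; rewrite lexx ler01.
  - have [|w' [b' s' _]] := @pad_word [:: (0, T)] n _ n0.
      by rewrite /isbb /= /arc_ok /is_bang /= eqxx T_ge0 dur_cons dur_nil /= addr0.
    by exists w'; apply/bbP.
have wmin' w' : isbb w' -> (size w' <= n)%N -> val w <= val w'.
  move=> b' s'; have [w1 [b1 s1 f1]] := pad_word b' s'.
  by rewrite /val -f1; apply: wmin; apply/bbP.
have exP : exists m, Pn m by exists n; apply/asboolP; exists w.
have [m /asboolP[v [vb vm vmin]] mmin] := ex_minnP exP.
have mn : (m <= n)%N by apply: mmin; apply/asboolP; exists w.
exists v; split=> //; last by rewrite vm.
split=> // w' b' s'; first by apply: vmin => //; rewrite (leq_trans s')// vm.
rewrite ltNge; apply/negP => le.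
have : (m <= size w')%N.
  apply: mmin; apply/asboolP; exists w'; split=> // w1 b1 s1.
  exact: le_trans le (vmin _ b1 s1).
by rewrite -vm leqNgt s'.
Qed.

(* If some bang-bang word beats all four-arc words, then the best words beating it
   have bounded size, so that bang-bang words have a global minimum. *)
Lemma planar_optimum :
  (exists2 w, four_arcs T w & forall w', isbb w' -> val w <= val w') \/
  (exists w, [/\ best w, (4 < size w)%N & forall w', isbb w' -> val w <= val w']).
Proof.
have z01 : 0 <= (0 : R) <= 1 by rewrite lexx ler01.
have bang0 : is_bang (0 : R) by rewrite /is_bang eqxx.
have [w4 p4 min4] : exists2 w, four_arcs T w & forall w', four_arcs T w' -> val w <= val w'.
  apply: (@word_minimum R M1 M2 T T_ge0 _ _ y0).
  - move=> i; rewrite /four_arc_set; case: ifP => _; first exact: segment_compact.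
    by apply: finite_compact; exact: finite_set2.
  - move=> i c; rewrite /four_arc_set; case: ifP => _; first by rewrite /= in_itv.
    by case=> ->; rewrite lexx ler01.
  - exists [:: (0, 0); (0, 0); (0, 0); (0, T)]; apply: four_arcsP => //.
    by rewrite !add0r.
have [h4|/existsNP[w0 /not_implyP[b0 /negP]]] := pselect (forall w', isbb w' -> val w4 <= val w').
  by left; exists w4.
rewrite -ltNge => lt0; right.
(* Beyond [N0] arcs the number of periods exceeds [C4] divided by the gap, contradicting
   [best_near_four_arcs]; the 5 ensures that this lemma applies. *)
pose N0 := (maxn 5 (Num.truncn (C4 / (val w4 - val w0))).+1.*2.+3)%N.
have size_best w : best w -> val w <= val w0 -> (size w <= N0)%N.
  move=> bw lew; rewrite leqNgt; apply/negP => Nw.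
  have n5 : (5 < size w)%N by rewrite (leq_ltn_trans _ Nw)// leq_maxl.
  have [w4' p4' est] := best_near_four_arcs y0_neq0 T_ge0 bw n5.
  have eta : 0 < val w4 - val w0 by rewrite subr_gt0.
  have est2 : ((size w - 3)./2)%:R * (val w4 - val w0) <= C4.
    apply: le_trans est; apply: ler_wpM2l; first exact: ler0n.
    by apply: lerB => //; exact: min4.
  rewrite -ler_pdivlMr// in est2.
  have tr := truncnS_gt (C4 / (val w4 - val w0)).
  have := le_lt_trans est2 tr; rewrite ltr_nat.
  have : ((Num.truncn (C4 / (val w4 - val w0))).+1.*2.+3 < size w)%N.
    by rewrite (leq_ltn_trans _ Nw)// leq_maxr.
  set K := Num.truncn _; clearbody K; clear; move: (size w) => n; lia.
pose N := maxn N0 (maxn 1 (size w0)).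
have [|w [bw wN wmin]] := @shortest_minimum N; first by rewrite !leq_max orbT.
have w0w : val w <= val w0 by apply: wmin => //; rewrite !leq_max leqnn !orbT.
(* A best word [v] for a length bound admitting w' is no worse than [w0], so it has at most [N0]
   arcs and [w] was already compared with it. *)
have glob w' : isbb w' -> val w <= val w'.
  move=> b'; have [|v [bv vN vmin]] := @shortest_minimum (maxn N (size w')).
    by rewrite !leq_max orbT.
  apply: le_trans (vmin w' b' _); last by rewrite leq_maxr.
  apply: wmin; first by case: bv.
  apply: leq_trans (size_best v bv _) _; last by rewrite leq_maxl.
  by apply: le_trans w0w; apply: vmin; [case: bw|rewrite (leq_trans wN)// leq_maxl].
(* With at most four arcs, [w] could be padded to a member of the four-arc family, whose minimum is
   above the value of [w0]. *)
exists w; split=> //; rewrite ltnNge; apply/negP => w4s.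
have wb : isbb w by case: bw.
have [w1 [b1 s1 f1]] := pad_word wb w4s.
have : val w4 <= val w1.
  apply: min4; have [/andP[al /eqP d]] := b1.
  case: w1 {f1 b1} s1 al d => [//|[c1 t1] [//|[c2 t2] [//|[c3 t3] [//|[c4 t4] [|//]]]]] _.
  rewrite /= !dur_cons dur_nil /arc_ok /= addr0.
  move=> /and5P[/andP[? ?] /andP[? ?] /andP[? ?] /andP[? ?] _] dT.
  by apply: four_arcsP => //; exact: bang_unit.
by rewrite /val f1 leNgt (le_lt_trans w0w lt0).
Qed.

End PlanarOptimumExists.

(** * Measurable controls *)

Section LebesgueIntervals.
Variable R : realType.
Local Notation mu := (@completed_lebesgue_measure R).
Implicit Types (f g : R -> R) (a b M : R).

Lemma borel_lebesgue_measurable (D : set (measurableTypeR R)) :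
  measurable D -> measurable (D : set (lebesgueType R)).
Proof. exact: sub_caratheodory. Qed.

Lemma itv_lebesgue_measurable (i : interval R) : measurable ([set` i] : set (lebesgueType R)).
Proof. by apply: borel_lebesgue_measurable; exact: measurable_itv. Qed.

Lemma borel_measurable_on (D : set R) f :
  measurable (D : set (measurableTypeR R)) ->
  measurable_fun (D : set (measurableTypeR R)) f -> lebesgue_measurable_on D f.
Proof.
move=> mD mf _ Y mY; apply: borel_lebesgue_measurable; exact: mf.
Qed.

Lemma mu_itv (i : interval R) : mu [set` i] = @lebesgue_measure R [set` i].
Proof. by []. Qed.

Lemma mu_co a b : a <= b -> fine (mu `[a, b[%classic) = b - a.
Proof.
move=> ab; rewrite mu_itv lebesgue_measure_itv /= lte_fin.
case: ltP => [//|ba]; rewrite /=; apply/eqP; rewrite eq_sym subr_eq0.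
by rewrite eq_le ab ba.
Qed.

Lemma mu_cc1 b : fine (mu `[b, b]%classic) = 0.
Proof. by rewrite mu_itv lebesgue_measure_itv /= ltxx. Qed.

Lemma mu_itv_fin (a b : R) (x y : bool) : (mu [set` Interval (BSide x a) (BSide y b)] < +oo)%E.
Proof.
rewrite mu_itv lebesgue_measure_itv /=; case: ifP => _; last exact: ltry.
by rewrite -EFinB ltry.
Qed.

Lemma bounded_integrable (i : interval R) f M : (mu [set` i] < +oo)%E ->
  lebesgue_measurable_on [set` i] f -> (forall s, s \in i -> `|f s| <= M) ->
  mu.-integrable [set` i] (EFin \o f).
Proof.
move=> ifin mf fM; apply: measurable_bounded_integrable => //.
  exact: itv_lebesgue_measurable.
exists M; split; first exact: num_real.
by move=> N MN s si; apply: le_trans (ltW MN); apply: fM.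
Qed.

(** The class of all integrands below: stable under sums and products, and integrable on bounded
    intervals. *)
Definition bounded_measurable (i : interval R) f :=
  lebesgue_measurable_on [set` i] f /\ exists M, forall s, s \in i -> `|f s| <= M.

Lemma lebesgue_measurable_sub (D D' : set R) f :
  measurable (D' : set (lebesgueType R)) -> D `<=` D' ->
  lebesgue_measurable_on D' f -> lebesgue_measurable_on D f.
Proof. by move=> mD' DD' mf; exact: (measurable_funS mD' DD' mf). Qed.

Lemma bounded_measurable_sub (i j : interval R) f : (i <= j)%O ->
  bounded_measurable j f -> bounded_measurable i f.
Proof.
move=> ij [mf [M fM]]; have ij' := subitvP ij; split.
  by apply: lebesgue_measurable_sub mf; [exact: itv_lebesgue_measurable|].
by exists M => s si; apply: fM; exact: ij'.
Qed.

Lemma bm_integrable a b (x y : bool) f :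
  bounded_measurable (Interval (BSide x a) (BSide y b)) f ->
  mu.-integrable [set` Interval (BSide x a) (BSide y b)] (EFin \o f).
Proof. by move=> [mf [M fM]]; apply: bounded_integrable fM => //; exact: mu_itv_fin. Qed.

Lemma bm_cst (i : interval R) a : bounded_measurable i (fun=> a).
Proof. by split; [exact: measurable_cst|exists `|a|]. Qed.

Lemma bmD (i : interval R) f g : bounded_measurable i f -> bounded_measurable i g ->
  bounded_measurable i (fun s => f s + g s).
Proof.
move=> [mf [M fM]] [mg [N gN]]; split; first exact: measurable_funD.
by exists (M + N) => s si; apply: le_trans (ler_normD _ _) _; rewrite lerD ?fM ?gN.
Qed.

Lemma bmM (i : interval R) f g : bounded_measurable i f -> bounded_measurable i g ->
  bounded_measurable i (fun s => f s * g s).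
Proof.
move=> [mf [M fM]] [mg [N gN]]; split; first exact: measurable_funM.
by exists (M * N) => s si; rewrite normrM ler_pM ?fM ?gN.
Qed.

Lemma bmZ (i : interval R) a f : bounded_measurable i f ->
  bounded_measurable i (fun s => a * f s).
Proof. by move=> bf; apply: bmM => //; exact: bm_cst. Qed.

Lemma bmB (i : interval R) f g : bounded_measurable i f -> bounded_measurable i g ->
  bounded_measurable i (fun s => f s - g s).
Proof.
move=> bf bg; under eq_fun do rewrite -mulN1r.
by apply: bmD => //; exact: bmZ.
Qed.

Lemma bm_mix (i : interval R) f a b : bounded_measurable i f ->
  bounded_measurable i (fun s => f s * a + (1 - f s) * b).
Proof.
move=> bf; apply: bmD; apply: bmM; [exact: bf|exact: bm_cst| |exact: bm_cst].
by apply: bmB; [exact: bm_cst|exact: bf].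
Qed.

Lemma Rintegral_le_bound a b M f : a <= b -> bounded_measurable `[a, b[ f ->
  (forall s, s \in `[a, b[ -> `|f s| <= M) ->
  `|\int[mu]_(s in `[a, b[) f s| <= M * (b - a).
Proof.
move=> ab bf fM; have itf := bm_integrable bf.
apply: le_trans (le_normr_Rintegral (itv_lebesgue_measurable _) itf) _.
rewrite -(mu_co ab) -Rintegral_cst; last exact: itv_lebesgue_measurable.
apply: le_Rintegral => //; first exact: itv_lebesgue_measurable.
- exact: integrable_norm.
- exact: bm_integrable (bm_cst _ _).
Qed.

Lemma Rintegral_split a b c f : a <= b -> b <= c -> bounded_measurable `[a, c[ f ->
  \int[mu]_(s in `[a, c[) f s =
  \int[mu]_(s in `[a, b[) f s + \int[mu]_(s in `[b, c[) f s.
Proof.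
move=> ab bc bf.
have e : `[a, c[%classic = `[a, b[%classic `|` `[b, c[%classic :> set R.
  by apply: itv_bndbnd_setU; rewrite bnd_simp.
rewrite e Rintegral_setU//.
- exact: itv_lebesgue_measurable.
- exact: itv_lebesgue_measurable.
- by rewrite -e; exact: bm_integrable.
- apply/disj_setPS => s [] /=; rewrite !in_itv /= => /andP[_ sb] /andP[bs _].
  by move: (lt_le_trans sb bs); rewrite ltxx.
Qed.

Lemma Rintegral_cc_co a b f : a <= b -> bounded_measurable `[a, b] f ->
  \int[mu]_(s in `[a, b]) f s = \int[mu]_(s in `[a, b[) f s.
Proof.
move=> ab bf.
have e : `[a, b]%classic = `[a, b[%classic `|` `[b, b]%classic :> set R.
  by apply: itv_bndbnd_setU; rewrite bnd_simp.
rewrite e Rintegral_setU//.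
- have itf : mu.-integrable `[b, b] (EFin \o f).
    apply: bm_integrable; apply: bounded_measurable_sub bf.
    by rewrite subitvE !bnd_simp ?ab ?lexx.
  have := le_normr_Rintegral (itv_lebesgue_measurable _) itf.
  have [_ [M fM]] := bf.
  have : \int[mu]_(s in `[b, b]) `|f s| <= \int[mu]_(s in `[b, b]) M.
    apply: le_Rintegral => //; first exact: itv_lebesgue_measurable.
    + exact: integrable_norm.
    + exact: bm_integrable (bm_cst _ _).
    + by move=> s /=; rewrite in_itv /= => /andP[bs sb]; apply: fM; rewrite in_itv /= sb (le_trans ab).
  rewrite Rintegral_cst; last exact: itv_lebesgue_measurable.
  rewrite mu_cc1 mulr0 => h1 h2.
  have : `|\int[mu]_(s in `[b, b]) f s| <= 0 := le_trans h2 h1.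
  by rewrite normr_le0 => /eqP ->; rewrite addr0.
- exact: itv_lebesgue_measurable.
- exact: itv_lebesgue_measurable.
- by rewrite -e; exact: bm_integrable.
- apply/disj_setPS => s [] /=; rewrite !in_itv /= => /andP[_ sb] /andP[bs _].
  by move: (lt_le_trans sb bs); rewrite ltxx.
Qed.

Lemma Rintegral_co_cst a b c : a <= b -> \int[mu]_(s in `[a, b[) c = c * (b - a).
Proof. by move=> ab; rewrite Rintegral_cst ?mu_co//; exact: itv_lebesgue_measurable. Qed.

Lemma Rintegral_coD a b f g : bounded_measurable `[a, b[ f -> bounded_measurable `[a, b[ g ->
  \int[mu]_(s in `[a, b[) (f s + g s) =
  \int[mu]_(s in `[a, b[) f s + \int[mu]_(s in `[a, b[) g s.
Proof.
move=> bf bg; apply: RintegralD; [exact: itv_lebesgue_measurable|exact: bm_integrable..].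
Qed.

Lemma Rintegral_coB a b f g : bounded_measurable `[a, b[ f -> bounded_measurable `[a, b[ g ->
  \int[mu]_(s in `[a, b[) (f s - g s) =
  \int[mu]_(s in `[a, b[) f s - \int[mu]_(s in `[a, b[) g s.
Proof.
move=> bf bg; apply: RintegralB; [exact: itv_lebesgue_measurable|exact: bm_integrable..].
Qed.

Lemma Rintegral_coZ a b c f : bounded_measurable `[a, b[ f ->
  \int[mu]_(s in `[a, b[) (c * f s) = c * \int[mu]_(s in `[a, b[) f s.
Proof.
move=> bf; apply: RintegralZl; [exact: itv_lebesgue_measurable|exact: bm_integrable].
Qed.

(** Cutting [a, b] into N equal steps bounds the total increment by C (b - a)^2 / N. *)
Lemma quadratic_increments_const (H : R -> R) a b C : a <= b ->
  (forall r r', a <= r -> r <= r' -> r' <= b -> `|H r' - H r| <= C * (r' - r) ^+ 2) ->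
  H b = H a.
Proof.
move=> ab hH; apply/eqP; rewrite -subr_eq0 -normr_eq0 eq_le normr_ge0 andbT leNgt.
apply/negP => e0; set e := `|_| in e0.
have D0 : 0 <= C * (b - a) ^+ 2 by apply: le_trans (hH a b _ _ _); rewrite ?lexx.
pose N := (Num.truncn (C * (b - a) ^+ 2 / e)).+1.
have N0 : 0 < N%:R :> R by rewrite ltr0n.
pose h := (b - a) / N%:R.
have h0 : 0 <= h by rewrite divr_ge0 ?subr_ge0// ltW.
have bE : b = a + N%:R * h by rewrite /h mulrC divfK ?gt_eqF//; ring.
have step k : (k <= N)%N -> `|H (a + k%:R * h) - H a| <= k%:R * (C * h ^+ 2).
  elim: k => [|k IH] kN; first by rewrite !mul0r addr0 subrr normr0.
  have k1 : a <= a + k%:R * h by rewrite lerDl mulr_ge0.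
  have k2 : a + k%:R * h <= a + k.+1%:R * h by rewrite lerD2l ler_wpM2r// ler_nat.
  have k3 : a + k.+1%:R * h <= b by rewrite bE lerD2l ler_wpM2r// ler_nat.
  have := hH _ _ k1 k2 k3; have := IH (ltnW kN).
  have -> : a + k.+1%:R * h - (a + k%:R * h) = h by rewrite -natr1; ring.
  have := ler_distD (H (a + k%:R * h)) (H (a + k.+1%:R * h)) (H a).
  by rewrite -natr1; lra.
have := step N (leqnn N); rewrite -bE -/e.
have -> : N%:R * (C * h ^+ 2) = C * (b - a) ^+ 2 / N%:R by rewrite /h; field; exact: lt0r_neq0.
rewrite ler_pdivlMr// => le1.
have := truncnS_gt (C * (b - a) ^+ 2 / e); rewrite -/N ltr_pdivrMr// => lt1; lra.
Qed.

(** Between r and r' the integral and [F] both grow by f r (r' - r) up to L (r' - r)^2, so their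
    difference has quadratic increments. *)
Lemma FTC_lipschitz (F f : R -> R) a b L : a <= b -> 0 <= L ->
  (forall s : R, is_derive s 1 F (f s)) -> bounded_measurable `[a, b[ f ->
  (forall r s, a <= r -> r <= s -> s <= b -> `|f s - f r| <= L * (s - r)) ->
  \int[mu]_(s in `[a, b[) f s = F b - F a.
Proof.
move=> ab L0 dF bf lip.
pose H r := \int[mu]_(s in `[a, r[) f s - F r.
suff : H b = H a.
  have z0 : \int[mu]_(s in `[a, a[) f s = 0 by rewrite set_itvco0 Rintegral_set0.
  rewrite /H z0 sub0r => /(congr1 (fun x => x + F b)).
  by rewrite subrK addrC => ->.
apply: (@quadratic_increments_const _ _ _ (2 * L)) => // r r' ar rr' rb.
have bf' : bounded_measurable `[a, r'[ f.
  by apply: bounded_measurable_sub bf; rewrite subitvE !bnd_simp ?lexx ?rb.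
have bf2 : bounded_measurable `[r, r'[ f.
  by apply: bounded_measurable_sub bf'; rewrite subitvE !bnd_simp ?ar ?lexx.
rewrite /H (Rintegral_split ar rr' bf').
have [xi /andP[rxi xir] e] := mean_value dF rr'.
have i1 : `|\int[mu]_(s in `[r, r'[) (f s - f r)| <= L * (r' - r) * (r' - r).
  apply: Rintegral_le_bound => //; first by apply: bmB => //; exact: bm_cst.
  move=> s; rewrite in_itv /= => /andP[rs sr'].
  apply: le_trans (lip _ _ ar rs _) _; first by rewrite (le_trans (ltW sr')).
  by rewrite ler_wpM2l// lerB// ltW.
rewrite Rintegral_coB ?Rintegral_co_cst// in i1; last exact: bm_cst.
have i2 : `|f xi - f r| <= L * (r' - r).
  apply: le_trans (lip _ _ ar rxi (le_trans xir rb)) _.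
  by rewrite ler_wpM2l// lerB.
have i3 : `|(f xi - f r) * (r' - r)| <= L * (r' - r) * (r' - r).
  by rewrite normrM [X in _ * X <= _]ger0_norm ?subr_ge0// ler_wpM2r ?subr_ge0.
set I0 := \int[mu]_(s in `[a, r[) _; set I1 := \int[mu]_(s in `[r, r'[) _ in i1 *.
have -> : I0 + I1 - F r' - (I0 - F r) = (I1 - f r * (r' - r)) - (f xi - f r) * (r' - r).
  by move: e; lra.
apply: le_trans (ler_normB _ _) _; rewrite expr2; lra.
Qed.

End LebesgueIntervals.

(** * Reduction from three coordinates to the plane *)

Section ThreeToTwo.
Variable R : realType.
Variables A1 A2 : 'M[R]_3.
Hypothesis sumA1 : zero_row_sums A1.
Hypothesis sumA2 : zero_row_sums A2.
Implicit Types (x : 'cV[R]_3) (a b : R).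

Definition o0 : 'I_3 := Ordinal (isT : (0 < 3)%N).
Definition o1 : 'I_3 := Ordinal (isT : (1 < 3)%N).
Definition o2 : 'I_3 := Ordinal (isT : (2 < 3)%N).

Lemma sum3 (F : 'I_3 -> R) : \sum_(j < 3) F j = F o0 + F o1 + F o2.
Proof.
by rewrite !big_ord_recr big_ord0 /= add0r; congr (F _ + F _ + F _); apply: val_inj.
Qed.

(** Zero row sums put the constant vectors in the kernel; this is the matrix induced on the quotient
    by them, in the coordinates [proj]. *)
Definition planar (A : 'M[R]_3) := Mat2
  (A o0 o0 - A o2 o0) (A o0 o1 - A o2 o1) (A o1 o0 - A o2 o0) (A o1 o1 - A o2 o1).

Definition proj x : R * R := (x o0 0 - x o2 0, x o1 0 - x o2 0).

Lemma V_cost x : V x = 2 / 3 * cost (proj x).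
Proof. by rewrite /V !sum3 /cost /proj /=; field. Qed.

Lemma mulmx3 (A : 'M[R]_3) x i :
  (A *m x) i 0 = A i o0 * x o0 0 + A i o1 * x o1 0 + A i o2 * x o2 0.
Proof. by rewrite mxE sum3. Qed.

Lemma third_column (A : 'M[R]_3) i : zero_row_sums A -> A i o2 = - A i o0 - A i o1.
Proof. by move=> /(_ i); rewrite sum3 => h; lra. Qed.

Lemma velocityE a b x i : ((a *: A1 + b *: A2) *m x) i 0 =
  (a * A1 i o0 + b * A2 i o0) * (proj x).1 + (a * A1 i o1 + b * A2 i o1) * (proj x).2.
Proof.
rewrite mulmx3 !mxE (third_column i sumA1) (third_column i sumA2) /proj /=; ring.
Qed.

Local Notation mx := (mx (planar A1) (planar A2)).

Lemma planar_velocity1 a b x : a + b = 1 ->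
  ((a *: A1 + b *: A2) *m x) o0 0 - ((a *: A1 + b *: A2) *m x) o2 0 =
  (act (mx a) (proj x)).1.
Proof.
move=> ab; have -> : b = 1 - a by rewrite -ab addrC addKr.
by rewrite !velocityE /=; ring.
Qed.

Lemma planar_velocity2 a b x : a + b = 1 ->
  ((a *: A1 + b *: A2) *m x) o1 0 - ((a *: A1 + b *: A2) *m x) o2 0 =
  (act (mx a) (proj x)).2.
Proof.
move=> ab; have -> : b = 1 - a by rewrite -ab addrC addKr.
by rewrite !velocityE /=; ring.
Qed.

End ThreeToTwo.

Section ContinuousBounded.
Variable R : realType.

Lemma continuous_bounded_measurable (f : R -> R) (a b : R) :
  {within `[a, b], continuous f} -> bounded_measurable `[a, b] f.
Proof.
move=> cf; split.
  apply: borel_measurable_on; first exact: measurable_itv.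
  by apply: subspace_continuous_measurable_fun => //; exact: measurable_itv.
have /compact_bounded[M [_ hM]] := continuous_compact cf (@segment_compact _ a b).
exists (M + 1) => s sab; apply: (hM (M + 1)); first by rewrite ltrDl.
by exists s.
Qed.

End ContinuousBounded.

(** * Bang-bang words bound all measurable controls from below *)

Section LowerBound.
Variable R : realType.
Variables (A1 A2 : 'M[R]_3) (x0 : 'cV[R]_3) (T : R).
Hypothesis sumA1 : zero_row_sums A1.
Hypothesis sumA2 : zero_row_sums A2.
Hypothesis T_ge0 : 0 <= T.
Variables (u : R -> 'cV[R]_2) (x : R -> 'cV[R]_3).
Hypothesis adm : admissible T u.
Hypothesis traj : trajectory A1 A2 x0 T u x.
Local Notation mu := (@completed_lebesgue_measure R).
Local Notation M1 := (planar A1).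
Local Notation M2 := (planar A2).
Local Notation mx := (mx M1 M2).
Local Notation flow := (flow M1 M2).
Local Notation KM := (KM M1 M2).
Local Notation G := (GM M1 M2 T).

Let y t := proj (x t).
Let u1 t := u t 0 0.
Let F1 s := (act (mx (u1 s)) (y s)).1.
Let F2 s := (act (mx (u1 s)) (y s)).2.

Lemma control_in s : 0 <= s <= T -> 0 <= u1 s <= 1.
Proof.
move=> sT; have [_ /(_ s)] := adm; rewrite in_itv /= => /(_ sT)[h0 h1 h].
by rewrite /u1 h0 -h lerDl.
Qed.

Lemma control_bm i : bounded_measurable `[0, T] (fun t => u t i 0).
Proof.
have [mu_ hu] := adm; split; first exact: mu_.
exists 1 => s /hu[h0 h1 h].
have : i = 0 \/ i = 1.
  by case: i => [[|[|//]]] i2; [left|right]; apply: val_inj.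
by case=> ->; rewrite ger0_norm// -h ?lerDl ?lerDr.
Qed.

Lemma state_bm i : bounded_measurable `[0, T] (fun t => x t i 0).
Proof.
apply: continuous_bounded_measurable => t; have [cx _] := traj.
exact: (cvg_comp _ _ (cx t) (@coord_continuous _ _ _ i 0 (x t))).
Qed.

Lemma y1_bm : bounded_measurable `[0, T] (fun t => (y t).1).
Proof. by apply: bmB; exact: state_bm. Qed.

Lemma y2_bm : bounded_measurable `[0, T] (fun t => (y t).2).
Proof. by apply: bmB; exact: state_bm. Qed.

Lemma mx_bm (z1 z2 : R -> R) (a b c d : R) : bounded_measurable `[0, T] z1 ->
  bounded_measurable `[0, T] z2 ->
  bounded_measurable `[0, T] (fun s => (u1 s * a + (1 - u1 s) * b) * z1 s +
                                       (u1 s * c + (1 - u1 s) * d) * z2 s).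
Proof.
move=> h1 h2; have hu : bounded_measurable `[0, T] u1 := control_bm 0.
by apply: bmD; apply: bmM => //; exact: bm_mix.
Qed.

Lemma velocity_bm i : bounded_measurable `[0, T]
  (fun s => ((u s 0 0 *: A1 + u s 1 0 *: A2) *m x s) i 0).
Proof.
under eq_fun do rewrite velocityE//.
have mix (a b : R) : bounded_measurable `[0, T] (fun s => u s 0 0 * a + u s 1 0 * b).
  by apply: bmD; apply: bmM; [exact: control_bm|exact: bm_cst|exact: control_bm|exact: bm_cst].
by apply: bmD; apply: bmM; [exact: mix|exact: y1_bm|exact: mix|exact: y2_bm].
Qed.

Lemma y_integral t : 0 <= t <= T ->
  (y t).1 = (proj x0).1 + \int[mu]_(s in `[0, t[) F1 s /\
  (y t).2 = (proj x0).2 + \int[mu]_(s in `[0, t[) F2 s.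
Proof.
move=> /andP[t0 tT]; have [_ hx] := traj; have [_ hu] := adm.
have tin : t \in `[0, T] by rewrite in_itv /= t0.
have sub : (`[0, t] <= `[0, T])%O by rewrite subitvE !bnd_simp ?tT ?lexx.
have vb i := bounded_measurable_sub sub (velocity_bm i).
have hE s : s \in `[0, t] -> u s 0 0 + u s 1 0 = 1.
  by move=> st; have [] := hu s (subitvP sub st).
have F1_bm : bounded_measurable `[0, T] F1 by apply: mx_bm; [exact: y1_bm|exact: y2_bm].
have F2_bm : bounded_measurable `[0, T] F2 by apply: mx_bm; [exact: y1_bm|exact: y2_bm].
split.
  rewrite -Rintegral_cc_co//; last exact: bounded_measurable_sub F1_bm.
  rewrite /y /proj /= !(hx t tin) opprD addrACA; congr (_ + _).
  rewrite -RintegralB; [|exact: itv_lebesgue_measurable|exact: bm_integrable|exact: bm_integrable].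
  by apply: eq_Rintegral => s; rewrite inE /= => /hE h; rewrite planar_velocity1.
rewrite -Rintegral_cc_co//; last exact: bounded_measurable_sub F2_bm.
rewrite /y /proj /= !(hx t tin) opprD addrACA; congr (_ + _).
rewrite -RintegralB; [|exact: itv_lebesgue_measurable|exact: bm_integrable|exact: bm_integrable].
by apply: eq_Rintegral => s; rewrite inE /= => /hE h; rewrite planar_velocity2.
Qed.

Lemma F1_bm : bounded_measurable `[0, T] F1.
Proof. by apply: mx_bm; [exact: y1_bm|exact: y2_bm]. Qed.

Lemma F2_bm : bounded_measurable `[0, T] F2.
Proof. by apply: mx_bm; [exact: y1_bm|exact: y2_bm]. Qed.

Lemma sub_co t t' : 0 <= t -> t' <= T -> (`[t, t'[ <= `[0, T])%O.
Proof. by move=> t0 tT; rewrite subitvE !bnd_simp t0 tT. Qed.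

Lemma y_increment t t' : 0 <= t -> t <= t' -> t' <= T ->
  (y t').1 - (y t).1 = \int[mu]_(s in `[t, t'[) F1 s /\
  (y t').2 - (y t).2 = \int[mu]_(s in `[t, t'[) F2 s.
Proof.
move=> t0 tt' tT; have t'0 := le_trans t0 tt'.
have [|-> ->] := @y_integral t; first by rewrite t0 (le_trans tt').
have [|-> ->] := @y_integral t'; first by rewrite t'0.
have s1 := sub_co (lexx 0) tT.
split.
  rewrite (Rintegral_split t0 tt' (bounded_measurable_sub s1 F1_bm)); lra.
rewrite (Rintegral_split t0 tt' (bounded_measurable_sub s1 F2_bm)); lra.
Qed.

Lemma y_bounded : exists2 Y, 0 <= Y & forall s, 0 <= s <= T -> n1 (y s) <= Y.
Proof.
have [_ [a ha]] := y1_bm; have [_ [b hb]] := y2_bm.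
exists (a + b) => [|s sT].
  have zin : (0 : R) \in `[0, T] by rewrite in_itv /= lexx.
  by rewrite addr_ge0// (le_trans (normr_ge0 _) (ha 0 zin), le_trans (normr_ge0 _) (hb 0 zin)).
by rewrite /n1 lerD ?ha ?hb// in_itv.
Qed.

(** U is the integral of the control over the step. With the state frozen at time t the increment is
    exactly the stated combination, and freezing costs O(h^2) because the state is Lipschitz. *)
Lemma euler_step Y t h : (forall s, 0 <= s <= T -> n1 (y s) <= Y) -> 0 <= t -> 0 <= h -> t + h <= T ->
  exists2 U, 0 <= U <= h &
   n1 (sub (y (t + h)) (lin 1 (y t) 1 (lin U (act (mx 1) (y t)) (h - U) (act (mx 0) (y t))))) <=
   4 * KM ^+ 2 * Y * h ^+ 2.
Proof.
move=> hY t0 h0 thT; set z := y t.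
have tth : t <= t + h by rewrite lerDl.
have hs := sub_co t0 thT.
have inT s : s \in `[t, t + h[ -> 0 <= s <= T /\ t <= s.
  rewrite in_itv /= => /andP[ts sth]; rewrite ts (le_trans t0 ts)/=.
  by split=> //; exact: le_trans (ltW sth) thT.
have K0 := KM_ge0 M1 M2.
have Y0 : 0 <= Y.
  by apply: le_trans (hY t _); rewrite ?n1_ge0// t0 (le_trans tth).
have u_bm : bounded_measurable `[t, t + h[ u1 := bounded_measurable_sub hs (control_bm 0).
have hh : t + h - t = h by rewrite addrC addKr.
exists (\int[mu]_(s in `[t, t + h[) u1 s).
  apply/andP; split.
    by apply: Rintegral_ge0 => s /inT[/control_in/andP[]].
  apply: le_trans (ler_norm _) _; rewrite -[leRHS]mul1r -[X in _ <= 1 * X]hh.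
  apply: Rintegral_le_bound => // s /inT[/control_in/andP[? ?] _].
  by rewrite ger0_norm.
set U := Rintegral _ _ _.
have near s : t <= s -> s <= t + h -> n1 (sub (y s) z) <= 2 * (KM * Y) * h.
  move=> ts sth; have sT := le_trans sth thT.
  have bF r : r \in `[t, s[ -> n1 (act (mx (u1 r)) (y r)) <= KM * Y.
    rewrite in_itv /= => /andP[tr rs]; have r0 : 0 <= r <= T.
      by rewrite (le_trans t0 tr) (le_trans (ltW rs)).
    apply: le_trans (n1_act_mx _ _ _ (control_in r0)) _.
    by rewrite ler_wpM2l// hY.
  have [e1 e2] := y_increment t0 ts sT.
  have s1 := sub_co t0 sT.
  have i1 := Rintegral_le_bound ts (bounded_measurable_sub s1 F1_bm)
    (fun r rin => le_trans (n1_1 _) (bF r rin)).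
  have i2 := Rintegral_le_bound ts (bounded_measurable_sub s1 F2_bm)
    (fun r rin => le_trans (n1_2 _) (bF r rin)).
  rewrite -e1 in i1; rewrite -e2 in i2.
  rewrite /n1 /sub; cbn [lin fst snd]; rewrite !mul1r !mulN1r.
  have : KM * Y * (s - t) <= KM * Y * h.
    by rewrite ler_wpM2l ?mulr_ge0// lerBlDl.
  by move: i1 i2; rewrite -/z; lra.
have diff s : s \in `[t, t + h[ ->
    n1 (act (mx (u1 s)) (sub (y s) z)) <= KM * (2 * (KM * Y) * h).
  move=> sin; have [sT ts] := inT s sin.
  apply: le_trans (n1_act_mx _ _ _ (control_in sT)) _.
  rewrite ler_wpM2l//; apply: near => //.
  by move: sin; rewrite in_itv /= => /andP[_ /ltW].
have [e1 e2] := y_increment t0 tth thT.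
have cbm (a b c d : R) : bounded_measurable `[t, t + h[ (fun s =>
    (u1 s * a + (1 - u1 s) * b) * z.1 + (u1 s * c + (1 - u1 s) * d) * z.2).
  by apply: bounded_measurable_sub hs _; apply: mx_bm; exact: bm_cst.
have affine (a b : R) : \int[mu]_(s in `[t, t + h[) (a * u1 s + b) = a * U + b * h.
  rewrite Rintegral_coD ?Rintegral_coZ ?Rintegral_co_cst ?hh//; last exact: bm_cst.
  exact: bmZ.
have c1 : \int[mu]_(s in `[t, t + h[) (act (mx (u1 s)) z).1 =
    (lin U (act (mx 1) z) (h - U) (act (mx 0) z)).1.
  transitivity (\int[mu]_(s in `[t, t + h[) (((act M1 z).1 - (act M2 z).1) * u1 s + (act M2 z).1)).
    by apply: eq_Rintegral => s _ /=; ring.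
  by rewrite affine /=; ring.
have c2 : \int[mu]_(s in `[t, t + h[) (act (mx (u1 s)) z).2 =
    (lin U (act (mx 1) z) (h - U) (act (mx 0) z)).2.
  transitivity (\int[mu]_(s in `[t, t + h[) (((act M1 z).2 - (act M2 z).2) * u1 s + (act M2 z).2)).
    by apply: eq_Rintegral => s _ /=; ring.
  by rewrite affine /=; ring.
have d1 : `|\int[mu]_(s in `[t, t + h[) (F1 s - (act (mx (u1 s)) z).1)| <= KM * (2 * (KM * Y) * h) * h.
  rewrite -[X in _ <= _ * X]hh; apply: Rintegral_le_bound => //.
    by apply: bmB; [exact: bounded_measurable_sub hs F1_bm|exact: cbm].
  move=> s /diff; apply: le_trans; apply: le_trans (n1_1 _).
  by rewrite le_eqVlt; apply/orP; left; apply/eqP; congr (`|_|); rewrite /F1 /sub act_lin /=; ring.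
have d2 : `|\int[mu]_(s in `[t, t + h[) (F2 s - (act (mx (u1 s)) z).2)| <= KM * (2 * (KM * Y) * h) * h.
  rewrite -[X in _ <= _ * X]hh; apply: Rintegral_le_bound => //.
    by apply: bmB; [exact: bounded_measurable_sub hs F2_bm|exact: cbm].
  move=> s /diff; apply: le_trans; apply: le_trans (n1_2 _).
  by rewrite le_eqVlt; apply/orP; left; apply/eqP; congr (`|_|); rewrite /F2 /sub act_lin /=; ring.
rewrite Rintegral_coB in d1; [|exact: bounded_measurable_sub hs F1_bm|exact: cbm].
rewrite Rintegral_coB in d2; [|exact: bounded_measurable_sub hs F2_bm|exact: cbm].
rewrite c1 -e1 -/z in d1; rewrite c2 -e2 -/z in d2.
have -> : 4 * KM ^+ 2 * Y * h ^+ 2 = KM * (2 * (KM * Y) * h) * h + KM * (2 * (KM * Y) * h) * h by ring.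
apply: le_trans (lerD d1 d2); rewrite le_eqVlt; apply/orP; left; apply/eqP.
rewrite /n1 /sub; set l := lin U _ _ _; cbn [lin fst snd].
by rewrite !mul1r !mulN1r !opprD !addrA.
Qed.

Lemma le_of_le_div (a b D : R) : 0 <= D ->
  (forall N : nat, a - b <= D / N.+1%:R) -> a <= b.
Proof.
move=> D0 H; rewrite -subr_le0 leNgt; apply/negP => e0.
have := H (Num.truncn (D / (a - b))); rewrite ler_pdivlMr ?ltr0n// => le1.
have := truncnS_gt (D / (a - b)); rewrite ltr_pdivrMr// => lt1.
by have := le_lt_trans le1 lt1; rewrite mulrC ltxx.
Qed.

(* Over each short interval, follow A1 and then A2 for the times prescribed by
   the average of the control. *)
Lemma measurable_lower_bound m :
  (forall w, isbb T w -> m <= cost (flow w (proj x0))) -> m <= cost (proj (x T)).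
Proof.
move=> hm; have [Y Y0 hY] := y_bounded.
have G0 := GM_ge0 M1 M2 T; have K0 := KM_ge0 M1 M2; have C20 := C2_ge0 M1 M2 T.
(* Local error per h^2: the Euler step, plus the expansion of the two arcs that imitate it. *)
pose e0 : R := 4 * KM ^+ 2 * Y + C2 M1 M2 T * Y.
have e00 : 0 <= e0 by rewrite addr_ge0 ?mulr_ge0 ?sqr_ge0.
(* N local errors e0 h^2 with h = T / N, amplified by G, give an endpoint error G e0 T^2 / N; the
   other factors come from [cost_lipschitz]. *)
pose D := 2 * (G * e0 * T ^+ 2) * (Y + G * Y).
have GY0 : 0 <= Y + G * Y by rewrite addr_ge0 ?mulr_ge0.
have D0 : 0 <= D by rewrite /D !mulr_ge0 ?sqr_ge0.
apply: (le_of_le_div D0) => n; set N := n.+1.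
have N0 : 0 < N%:R :> R by rewrite ltr0n.
pose h := T / N%:R.
have h0 : 0 <= h by rewrite divr_ge0// ltW.
have TE : T = N%:R * h by rewrite /h mulrC divfK ?gt_eqF.
have kh k : (k <= N)%N -> 0 <= k%:R * h <= T.
  by move=> kN; rewrite mulr_ge0//= [leRHS]TE ler_wpM2r// ler_nat.
pose step k (r : R) := 0 <= r <= h /\
   n1 (sub (y (k%:R * h + h)) (lin 1 (y (k%:R * h)) 1
      (lin r (act (mx 1) (y (k%:R * h))) (h - r) (act (mx 0) (y (k%:R * h)))))) <=
   4 * KM ^+ 2 * Y * h ^+ 2.
have [U hU] : {U : nat -> R & forall k, (k < N)%N -> step k (U k)}.
  apply: (@choice _ _ (fun k r => (k < N)%N -> step k r)) => k.
  have [kN|kN] := boolP (k < N)%N; last by exists 0.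
  have /andP[k0 _] := kh k (ltnW kN); have /andP[_ k1] := kh k.+1 kN.
  have kht : k%:R * h + h <= T by move: k1; rewrite -natr1 mulrDl mul1r.
  by have [Uk Ukh est] := euler_step hY k0 h0 kht; exists Uk.
pose us (k : nat) : seq (R * R) := [:: (1, U k); (0, h - U k)].
pose ys k := y (k%:R * h).
pose W := flatten [seq us k | k <- iota 0 N].
have okW k j : (j + k <= N)%N -> all (@arc_ok R) (flatten [seq us i | i <- iota j k]) /\
     dur (flatten [seq us i | i <- iota j k]) = k%:R * h.
  elim: k j => [|k IH] j; first by rewrite /= dur_nil mul0r.
  rewrite addnS => jN; have [|IH1 IH2] := IH j.+1; first by rewrite addSn.
  have [|/andP[u0 uh] _] := hU j; first by rewrite (leq_trans _ jN)// ltnS leq_addr.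
  rewrite /= !dur_cons IH1 IH2 -natr1 /arc_ok /is_bang /= !eqxx orbT u0 subr_ge0 uh /=.
  by split=> //; ring.
have [aW dW] := okW N 0%N (leqnn N); rewrite -/W in aW dW.
have bbW : isbb T W by rewrite /isbb aW dW -TE eqxx.
have uW : unit_word W by exact: isbb_unit bbW.
have dWT : dur W <= T by rewrite dW -TE.
have ch := @flow_chain _ M1 M2 T T_ge0 N 0%N ys us (e0 * h ^+ 2) uW dWT.
have yT : ys N = proj (x T) by rewrite /ys -TE.
have y0E : ys 0%N = proj x0.
  rewrite /ys mul0r; have [|h1 h2] := @y_integral 0; first by rewrite lexx.
  by apply: vec_eq; rewrite ?h1 ?h2 set_itvco0 Rintegral_set0 addr0.
have {}ch : n1 (sub (proj (x T)) (flow W (proj x0))) <= N%:R * (G * (e0 * h ^+ 2)).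
  rewrite -yT -y0E; apply: ch => k kN.
  have [/andP[u0 uh] est] := hU k kN.
  have -> : ys k.+1 = y (k%:R * h + h) by rewrite /ys -natr1 mulrDl mul1r.
  set z := y (k%:R * h) in est *.
  have zY : n1 z <= Y by apply: hY; apply: kh; exact: ltnW.
  have z01 : 0 <= (0 : R) <= 1 by rewrite lexx ler01.
  have z11 : 0 <= (1 : R) <= 1 by rewrite lexx ler01.
  have hU0 : 0 <= h - U k by rewrite subr_ge0.
  have hT : U k + (h - U k) <= T.
    by rewrite addrC subrK TE ler_peMl// ler1n.
  have := @two_arc_expansion _ M1 M2 T 1 0 (U k) (h - U k) z z11 z01 u0 hU0 hT.
  rewrite n1_subC [U k + _]addrC subrK => est2.
  apply: le_trans (n1_triangle _ _ _) _; apply: le_trans (lerD est est2) _.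
  have : C2 M1 M2 T * h ^+ 2 * n1 z <= C2 M1 M2 T * h ^+ 2 * Y.
    by rewrite ler_wpM2l// mulr_ge0 ?sqr_ge0.
  rewrite /e0; lra.
have b1 : n1 (proj (x T)) <= Y by apply: hY; rewrite lexx T_ge0.
have b2 : n1 (flow W (proj x0)) <= G * Y.
  apply: le_trans (flow_bound M1 M2 _ uW dWT) _; rewrite ler_wpM2l// -y0E.
  by apply: hY; rewrite mul0r lexx.
have := cost_lipschitz (flow W (proj x0)) (proj (x T)); rewrite n1_subC => cl.
have := hm W bbW => mW; have cl1 := le_trans (ler_norm _) cl.
apply: le_trans (lerB mW (lexx _)) (le_trans cl1 _).
have -> : D / N%:R = 2 * (N%:R * (G * (e0 * h ^+ 2))) * (G * Y + Y).
  by rewrite /D /h; field; exact: lt0r_neq0.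
by apply: ler_pM; rewrite ?mulr_ge0 ?addr_ge0 ?n1_ge0// ?ler_wpM2l// lerD.
Qed.

End LowerBound.

(** * Trajectories of words *)

Section Trajectory.
Variable R : realType.
Local Notation mu := (@completed_lebesgue_measure R).

Lemma bm_switch (i : interval R) (f g : R -> R) c :
  bounded_measurable i f -> bounded_measurable i g ->
  bounded_measurable i (fun t => if t < c then f t else g t).
Proof.
move=> [mf [M fM]] [mg [N gN]]; split.
  have mi := itv_lebesgue_measurable i.
  have mlt : measurable_fun ([set` i] : set (lebesgueType R)) (fun t : R => t < c).
    apply: (@measurable_fun_ltr _ (lebesgueType R) R); last exact: measurable_cst.
    by apply: borel_measurable_on; [exact: measurable_itv|exact: measurable_id].
  apply: (measurable_fun_if mi mlt).
  - by apply: lebesgue_measurable_sub mf => // t [].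
  - by apply: lebesgue_measurable_sub mg => // t [].
exists (Num.max M N) => s si; case: ifP => _; rewrite le_max ?fM ?gN ?orbT//.
Qed.

Lemma within_continuous_col n (D : set R) (x : R -> 'cV[R]_n) :
  (forall i, {within D, continuous (fun t => x t i 0)}) -> {within D, continuous x}.
Proof.
move=> cx t A [P hP PA]; rewrite /nbhs/=.
have h i : \forall s \near nbhs (t : subspace D), P i 0 (x s i 0).
  by apply: (cx i t); exact: hP.
have : \forall s \near nbhs (t : subspace D), forall i, P i 0 (x s i 0).
  exact: filter_forall.
by apply: filterS => s hs; apply: PA => i j; rewrite (ord1 j).
Qed.

Lemma within_continuous_primitive (f : R -> R) T c : 0 <= T -> bounded_measurable `[0, T] f ->
  {within `[0, T], continuous (fun t => c + \int[mu]_(s in `[0, t[) f s)}.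
Proof.
move=> T0 bf; have [_ [M fM]] := bf.
(* Clamping the upper limit extends the primitive to a function on the whole line that is dominated
   by M times the clamped distance. *)
pose z t := c + \int[mu]_(s in `[0, clamp T t[) f s.
have cz : continuous z.
  have lip r s : 0 <= r -> r <= s -> s <= T ->
     `|\int[mu]_(v in `[0, s[) f v - \int[mu]_(v in `[0, r[) f v| <= M * (s - r).
    move=> r0 rs sT.
    rewrite (Rintegral_split r0 rs); last first.
      by apply: bounded_measurable_sub bf; rewrite subitvE !bnd_simp ?lexx ?sT.
    rewrite addrAC subrr add0r; apply: Rintegral_le_bound => //.
      by apply: bounded_measurable_sub bf; rewrite subitvE !bnd_simp ?r0 ?sT.
    move=> v; rewrite in_itv /= => /andP[rv vs]; apply: fM.
    by rewrite in_itv /= (le_trans r0 rv) (le_trans (ltW vs)).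
  move=> t; apply: (@continuous_dominated _ _ z (fun s => M * `|clamp T t - clamp T s|)).
  - move=> s; rewrite /z opprD addrACA subrr add0r.
    have /andP[t0 tT] := clamp_in t T0; have /andP[s0 sT] := clamp_in s T0.
    have [ts|/ltW st] := leP (clamp T t) (clamp T s).
      rewrite distrC [X in _ * X]distrC [X in _ * X]ger0_norm ?subr_ge0//; exact: lip.
    rewrite [X in _ * X]ger0_norm ?subr_ge0//; exact: lip.
  - by rewrite subrr normr0 mulr0.
  - apply: cvgM; first exact: cvg_cst.
    apply: cvg_norm; apply: cvgB; first exact: cvg_cst.
    by have := @continuous_clamp R T _ id (fun=> cvg_id) t.
apply: (@subspace_eq_continuous _ `[0, T]%classic _ z); last exact: continuous_subspaceT.
by move=> t; rewrite inE /= in_itv /= => h; rewrite /z clamp_id.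
Qed.
End Trajectory.

Section WordTrajectory.
Variable R : realType.
Variables M1 M2 : mat2 R.
Local Notation mu := (@completed_lebesgue_measure R).
Local Notation mx := (mx M1 M2).
Local Notation flow := (flow M1 M2).
Local Notation KM := (KM M1 M2).
Implicit Types (w : seq (R * R)) (S t : R) (y : R * R).

(* S is the initial time and cl the value after the last arc. *)
Fixpoint ctrl S w cl t : R :=
  if w is p :: w' then if t < S + p.2 then p.1 else ctrl (S + p.2) w' cl t else cl.

Fixpoint path_of S w y t : R * R :=
  if w is p :: w' then
    if t < S + p.2 then E (mx p.1) (t - S) y
    else path_of (S + p.2) w' (E (mx p.1) p.2 y) t
  else y.

Lemma ctrl_bm (i : interval R) S w cl : bounded_measurable i (ctrl S w cl).
Proof.
elim: w S => [|p w IH] S /=; first exact: bm_cst.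
by apply: bm_switch; [exact: bm_cst|exact: IH].
Qed.

Lemma ctrl_unit S w cl t : unit_word w -> 0 <= cl <= 1 -> 0 <= ctrl S w cl t <= 1.
Proof.
elim: w S => [|p w IH] S //= /andP[/andP[p1 _] uw] hcl.
by case: ifP => // _; exact: IH.
Qed.

Lemma E_bm a b B S y : bounded_measurable `[a, b] (fun t => (E B (t - S) y).1) /\
  bounded_measurable `[a, b] (fun t => (E B (t - S) y).2).
Proof.
have cB : continuous (fun t : R => t - S).
  by move=> t; apply: cvgB; [exact: cvg_id|exact: cvg_cst].
split; apply: continuous_bounded_measurable; apply: continuous_subspaceT => t.
  apply: (@continuous_comp _ _ _ (fun t : R => t - S) (fun r => (E B r y).1)); first exact: cB.
  exact: continuous_E1.
apply: (@continuous_comp _ _ _ (fun t : R => t - S) (fun r => (E B r y).2)); first exact: cB.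
exact: continuous_E2.
Qed.

Lemma path_bm a b S w y : bounded_measurable `[a, b] (fun t => (path_of S w y t).1) /\
  bounded_measurable `[a, b] (fun t => (path_of S w y t).2).
Proof.
elim: w S y => [|p w IH] S y /=; first by split; exact: bm_cst.
have [e1 e2] := E_bm a b (mx p.1) S y.
have [h1 h2] := IH (S + p.2) (E (mx p.1) p.2 y).
split; first by under eq_fun do rewrite (fun_if fst); exact: bm_switch.
by under eq_fun do rewrite (fun_if snd); exact: bm_switch.
Qed.

Lemma velocity_word_bm a b S w cl y k1 k2 k3 k4 : bounded_measurable `[a, b]
  (fun s => (ctrl S w cl s * k1 + (1 - ctrl S w cl s) * k2) * (path_of S w y s).1 +
            (ctrl S w cl s * k3 + (1 - ctrl S w cl s) * k4) * (path_of S w y s).2).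
Proof.
have hu := ctrl_bm `[a, b] S w cl; have [h1 h2] := path_bm a b S w y.
by apply: bmD; apply: bmM => //; exact: bm_mix.
Qed.

Lemma path_end S w y : unit_word w -> path_of S w y (S + dur w) = flow w y.
Proof.
elim: w S y => [|p w IH] S y //= /andP[_ uw].
rewrite dur_cons addrA ltNge lerDl unit_word_dur//=; exact: IH.
Qed.

Lemma arc_integral c T S t y : 0 <= c <= 1 -> S <= t -> t - S <= T ->
  \int[mu]_(s in `[S, t[) (act (mx c) (E (mx c) (s - S) y)).1 = (E (mx c) (t - S) y).1 - y.1 /\
  \int[mu]_(s in `[S, t[) (act (mx c) (E (mx c) (s - S) y)).2 = (E (mx c) (t - S) y).2 - y.2.
Proof.
move=> hc St tT; have [e1 e2] := E_bm S t (mx c) S y.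
have K0 := KM_ge0 M1 M2; have G0 := GM_ge0 M1 M2 T.
have bm (k1 k2 : R) : bounded_measurable `[S, t[
    (fun s => k1 * (E (mx c) (s - S) y).1 + k2 * (E (mx c) (s - S) y).2).
  by apply: bounded_measurable_sub (bmD (bmZ k1 e1) (bmZ k2 e2)); rewrite subitvE !bnd_simp.
have L0 : 0 <= KM * (2 * KM * GM M1 M2 T * (GM M1 M2 T * n1 y)).
  by rewrite !mulr_ge0 ?n1_ge0.
have lip r s : S <= r -> r <= s -> s <= t ->
   n1 (sub (act (mx c) (E (mx c) (s - S) y)) (act (mx c) (E (mx c) (r - S) y))) <=
   KM * (2 * KM * GM M1 M2 T * (GM M1 M2 T * n1 y)) * (s - r).
  move=> Sr rs st; have rT : 0 <= r - S <= T.
    by rewrite subr_ge0 Sr (le_trans _ tT)// lerD2r (le_trans rs).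
  have sT : 0 <= s - r <= T by rewrite subr_ge0 rs (le_trans _ tT)// lerB.
  rewrite /sub -act_lin; apply: le_trans (n1_act_mx _ _ _ hc) _.
  rewrite -[leRHS]mulrA ler_wpM2l//.
  have -> : s - S = (s - r) + (r - S) by ring.
  rewrite E_add; apply: le_trans (E_first_order _ _ _ hc sT) _.
  have -> : 2 * KM * GM M1 M2 T * (GM M1 M2 T * n1 y) * (s - r) =
            2 * KM * GM M1 M2 T * (s - r) * (GM M1 M2 T * n1 y) by ring.
  rewrite ler_wpM2l ?mulr_ge0//; first by case/andP: sT.
  exact: E_bound.
have d_shift (f : R -> R) (df s : R) : is_derive (s - S) 1 f df ->
    is_derive s 1 (fun r => f (r - S)) df.
  move=> hf; eapply is_derive_eq.
    by eapply is_derive_comp; [exact: hf|derive_rules].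
  by cbv beta; ring.
have e0 : E (mx c) (S - S) y = y by rewrite subrr E0.
split.
  rewrite -{3}e0; apply: (@FTC_lipschitz _ (fun s => (E (mx c) (s - S) y).1) _ S t _ St L0).
  - by move=> s; have [d _] := d_E (mx c) (s - S) y; exact: d_shift d.
  - exact: bm.
  - move=> r s Sr rs st; apply: le_trans (lip r s Sr rs st); apply: le_trans (n1_1 _).
    by rewrite /sub; cbn [lin fst snd]; rewrite mul1r mulN1r.
rewrite -{3}e0; apply: (@FTC_lipschitz _ (fun s => (E (mx c) (s - S) y).2) _ S t _ St L0).
- by move=> s; have [_ d] := d_E (mx c) (s - S) y; exact: d_shift d.
- exact: bm.
- move=> r s Sr rs st; apply: le_trans (lip r s Sr rs st); apply: le_trans (n1_2 _).
  by rewrite /sub; cbn [lin fst snd]; rewrite mul1r mulN1r.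
Qed.

(** Induction on the arcs, splitting the integral at each junction. The half-open interval stops
    before the end of the word, so the closing value [cl] is arbitrary. *)
Lemma path_integral S w cl y t : unit_word w -> S <= t -> t <= S + dur w ->
  (path_of S w y t).1 = y.1 + \int[mu]_(s in `[S, t[) (act (mx (ctrl S w cl s)) (path_of S w y s)).1 /\
  (path_of S w y t).2 = y.2 + \int[mu]_(s in `[S, t[) (act (mx (ctrl S w cl s)) (path_of S w y s)).2.
Proof.
elim: w S y => [|p w IH] S y.
  rewrite dur_nil addr0 => _ St tS; have -> : t = S by apply/eqP; rewrite eq_le St tS.
  by rewrite set_itvco0 !Rintegral_set0 !addr0.
move=> up St; have /andP[/andP[p1 p2] uw] := up; rewrite dur_cons addrA => tT.
have [tp|pt] := ltP t (S + p.2).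
  have ts : t - S <= p.2 by rewrite lerBlDl ltW.
  have [i1 i2] := arc_integral y p1 St ts.
  rewrite /= tp; split.
    rewrite -[LHS](subrK y.1) -i1 addrC; congr (_ + _).
    apply: eq_Rintegral => s; rewrite inE /= in_itv /= => /andP[_ st].
    by rewrite (lt_trans st tp).
  rewrite -[LHS](subrK y.2) -i2 addrC; congr (_ + _).
  apply: eq_Rintegral => s; rewrite inE /= in_itv /= => /andP[_ st].
  by rewrite (lt_trans st tp).
have Sp : S <= S + p.2 by rewrite lerDl.
have pp : S + p.2 - S <= p.2 by rewrite addrAC subrr add0r.
have [i1 i2] := arc_integral y p1 Sp pp.
have [j1 j2] := IH (S + p.2) (E (mx p.1) p.2 y) uw pt tT.
have pE : path_of S (p :: w) y t = path_of (S + p.2) w (E (mx p.1) p.2 y) t.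
  by rewrite /= ltNge pt.
have sub1 : (`[S, t[ <= `[S, t])%O by rewrite subitvE !bnd_simp.
have v1 := bounded_measurable_sub sub1 (velocity_word_bm S t S (p :: w) cl y
  (m11 M1) (m11 M2) (m12 M1) (m12 M2)).
have v2 := bounded_measurable_sub sub1 (velocity_word_bm S t S (p :: w) cl y
  (m21 M1) (m21 M2) (m22 M1) (m22 M2)).
rewrite pE; split.
  rewrite j1 (Rintegral_split Sp pt v1) addrA; congr (_ + _).
    transitivity (y.1 + \int[mu]_(s in `[S, S + p.2[) (act (mx p.1) (E (mx p.1) (s - S) y)).1).
      by rewrite i1 [S + _]addrC addrK addrC subrK.
    congr (_ + _); apply: eq_Rintegral => s; rewrite inE /= in_itv /= => /andP[_ st].
    by rewrite st.
  apply: eq_Rintegral => s; rewrite inE /= in_itv /= => /andP[ps _].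
  by rewrite ltNge ps.
rewrite j2 (Rintegral_split Sp pt v2) addrA; congr (_ + _).
  transitivity (y.2 + \int[mu]_(s in `[S, S + p.2[) (act (mx p.1) (E (mx p.1) (s - S) y)).2).
    by rewrite i2 [S + _]addrC addrK addrC subrK.
  congr (_ + _); apply: eq_Rintegral => s; rewrite inE /= in_itv /= => /andP[_ st].
  by rewrite st.
apply: eq_Rintegral => s; rewrite inE /= in_itv /= => /andP[ps _].
by rewrite ltNge ps.
Qed.

End WordTrajectory.

Section WordTrajectory3.
Variable R : realType.
Variables (A1 A2 : 'M[R]_3) (x0 : 'cV[R]_3).
Hypothesis sumA1 : zero_row_sums A1.
Hypothesis sumA2 : zero_row_sums A2.
Variables (T : R) (w : seq (R * R)) (cl : R).
Hypothesis w_unit : unit_word w.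
Hypothesis dur_w : dur w = T.
Hypothesis cl_unit : 0 <= cl <= 1.
Local Notation mu := (@completed_lebesgue_measure R).
Local Notation M1 := (planar A1).
Local Notation M2 := (planar A2).
Local Notation flow := (flow M1 M2).
Local Notation u := (ctrl 0 w cl).
Let y := path_of M1 M2 0 w (proj x0).

Let speed i s := (u s * A1 i o0 + (1 - u s) * A2 i o0) * (y s).1 +
                 (u s * A1 i o1 + (1 - u s) * A2 i o1) * (y s).2.
(** The lift to three coordinates: velocities depend only on the planar path, so they can be
    integrated before the state is known to project onto it. *)
Let x t : 'cV[R]_3 := \col_i (x0 i 0 + \int[mu]_(s in `[0, t[) speed i s).

Let speed_bm i a b : bounded_measurable `[a, b] (speed i).
Proof. exact: velocity_word_bm. Qed.

Let speed_co i t : bounded_measurable `[0, t[ (speed i).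
Proof.
by apply: bounded_measurable_sub (speed_bm i 0 t); rewrite subitvE !bnd_simp ?lexx.
Qed.

Let projE t : 0 <= t <= T -> proj (x t) = y t.
Proof.
move=> /andP[t0 tT]; have [|e1 e2] := @path_integral _ M1 M2 0 w cl (proj x0) t w_unit t0.
  by rewrite add0r dur_w.
apply: vec_eq.
  rewrite e1 /proj !mxE /= opprD addrACA -Rintegral_coB//; congr (_ + _).
  by apply: eq_Rintegral => s _; rewrite /speed /=; ring.
rewrite e2 /proj !mxE /= opprD addrACA -Rintegral_coB//; congr (_ + _).
by apply: eq_Rintegral => s _; rewrite /speed /=; ring.
Qed.

Lemma word_admissible : admissible T (control_of u).
Proof.
split=> [i|t _]; last first.
  rewrite !mxE /=; have /andP[u0 u1] := ctrl_unit 0 t w_unit cl_unit.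
  by rewrite u0 subr_ge0 u1 addrC subrK.
have [mu_ _] := ctrl_bm `[0, T] 0 w cl.
have -> : (fun t => control_of u t i 0) = (fun t => if i == 0 then u t else 1 - u t).
  by apply/funext => t; rewrite mxE.
case: (i == 0) => //.
by case: (bmB (bm_cst `[0, T] 1) (ctrl_bm `[0, T] 0 w cl)).
Qed.

Lemma word_trajectory : exists2 z, trajectory A1 A2 x0 T (control_of u) z &
  proj (z T) = flow w (proj x0).
Proof.
have T0 : 0 <= T by rewrite -dur_w unit_word_dur.
exists x; last first.
  by rewrite projE ?T0 ?lexx// /y -dur_w -[X in path_of _ _ _ _ _ X]add0r path_end.
split.
  apply: within_continuous_col => i.
  have -> : (fun t => x t i 0) = (fun t => x0 i 0 + \int[mu]_(s in `[0, t[) speed i s).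
    by apply/funext => t; rewrite mxE.
  exact: within_continuous_primitive.
move=> t; rewrite in_itv /= => /andP[t0 tT] i.
rewrite mxE -Rintegral_cc_co//; congr (_ + _); apply: eq_Rintegral => s.
rewrite inE /= in_itv /= => /andP[s0 st].
by rewrite velocityE// projE ?s0 ?(le_trans st)// /control_of !mxE.
Qed.

End WordTrajectory3.

(** * Control classes *)

Section ControlClasses.
Variable R : realType.
Implicit Types (w : seq (R * R)) (S T t c v : R) (p : R * R).

Lemma ctrl_ge S w c t : unit_word w -> S + dur w <= t -> ctrl S w c t = c.
Proof.
elim: w S => [|p w IH] S //= /andP[_ uw]; rewrite dur_cons addrA => h.
by rewrite ltNge (le_trans _ h) ?lerDl ?unit_word_dur//=; exact: IH.
Qed.

Lemma ctrl_rcons S w p c t : unit_word (rcons w p) ->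
  ctrl S (rcons w p) c t = if t < S + dur (rcons w p) then ctrl S w p.1 t else c.
Proof.
elim: w S => [|q w IH] S /=; first by rewrite dur_cons dur_nil addr0.
move=> /andP[_ uw]; rewrite dur_cons addrA IH//.
case: ltP => // tq; have -> : t < S + q.2 + dur (rcons w p) => //.
by apply: lt_le_trans tq _; rewrite lerDl unit_word_dur.
Qed.

Lemma ctrl_rcons_same S w p t : unit_word (rcons w p) ->
  ctrl S (rcons w p) p.1 t = ctrl S w p.1 t.
Proof.
move=> uwp; have /andP[p2 uw] : ((0 <= p.1 <= 1) && (0 <= p.2)) && unit_word w.
  by move: uwp; rewrite /unit_word all_rcons.
rewrite ctrl_rcons//; case: ltP => // h; rewrite ctrl_ge//.
apply: le_trans h; rewrite -cats1 dur_cat lerD2l lerDl dur_cons dur_nil addr0.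
by case/andP: p2.
Qed.

Lemma ctrl_scalar_control S w c T : 0 <= T -> unit_word w -> 0 <= c <= 1 ->
  scalar_control T (ctrl S w c).
Proof.
by move=> T0 uw hc; split=> // [|t _]; [case: (ctrl_bm `[0, T] S w c)|exact: ctrl_unit].
Qed.

Fixpoint breakpoints S w : seq R :=
  if w is p :: w' then (S + p.2) :: breakpoints (S + p.2) w' else [::].

Lemma size_breakpoints S w : size (breakpoints S w) = size w.
Proof. by elim: w S => //= p w IH S; rewrite IH. Qed.

Lemma ctrl_constant_between S w c a b : a <= b ->
  (forall r, r \in breakpoints S w -> r \notin `[a, b]) -> ctrl S w c a = ctrl S w c b.
Proof.
move=> ab; elim: w S => [|p w IH] S //= h.
have := h _ (mem_head _ _); rewrite in_itv /= negb_and -!ltNge => hp.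
have -> : (a < S + p.2) = (b < S + p.2).
  apply/idP/idP => [ap|]; last exact: le_lt_trans.
  by case/orP: hp => // pa; have := lt_trans ap pa; rewrite ltxx.
by case: ifP => // _; apply: IH => r hr; apply: h; rewrite inE hr orbT.
Qed.

Lemma ctrl_locally_constant S w c t : t \notin breakpoints S w ->
  \forall s \near t, ctrl S w c s = ctrl S w c t.
Proof.
elim: w S => [|p w IH] S /=; first by move=> _; exists 1 => /=; rewrite ?ltr01.
rewrite inE negb_or => /andP[tp /IH h]; have [tlt|] := ltP t (S + p.2).
  by near=> s; have -> : s < S + p.2 by near: s; exact: lt_nbhsl.
rewrite le_eqVlt eq_sym (negPf tp) /= => tgt; near=> s.
have st : S + p.2 < s by near: s; exact: lt_nbhsr.
by rewrite ltNge (ltW st) /=; near: s; exact: h.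
Unshelve. all: by end_near. Qed.

(** The closing value acts as one more piece: a word of k arcs has k breakpoints and up to k + 1
    values. Away from the breakpoints the control is locally constant. *)
Lemma ctrl_PC w c T k : 0 <= T -> unit_word w -> 0 <= c <= 1 -> (size w <= k)%N ->
  PC k T (ctrl 0 w c).
Proof.
move=> T0 uw hc wk; split; first exact: ctrl_scalar_control.
  by exists (breakpoints 0 w) => a b _ ab _; exact: ctrl_constant_between.
apply: card_le_trans (card_image_le (nth 0 (breakpoints 0 w)) _); apply: subset_card_le.
move=> t [_ disc]; have [tb|tb] := boolP (t \in breakpoints 0 w).
  exists (index t (breakpoints 0 w)) => /=; last exact: nth_index.
  by rewrite (leq_trans _ wk)// -(size_breakpoints 0 w) index_mem.
exfalso; apply: disc; apply: cvg_within_filter.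
apply: cvg_near_cst; exact: ctrl_locally_constant.
Qed.

Lemma bang_B0 c T : 0 <= T -> is_bang c -> B 0 T (fun=> c).
Proof.
move=> T0 hc; split; last by move=> t _; case/orP: hc => /eqP ->; [left|right].
exact: (@ctrl_PC [::] c T 0%N T0 isT (bang_unit hc)).
Qed.

Lemma ctrl_concat w p c t : unit_word (rcons w p) ->
  ctrl 0 (rcons w p) c t = concat (dur (rcons w p)) (fun=> c) (ctrl 0 w p.1) t.
Proof. by move=> uw; rewrite ctrl_rcons// add0r. Qed.

Lemma four_arcs_W T w : four_arcs T w ->
  exists2 c, unit_word w /\ 0 <= c <= 1 & W T (ctrl 0 w c).
Proof.
case: w => [|[c1 t1] [|[c2 t2] [|[c3 t3] [|[c4 t4] [|? ?]]]]] [] // _ dw h.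
have seg (c : R) : `[0, 1]%classic c -> 0 <= c <= 1 by rewrite /= in_itv.
have := h (Ordinal (isT : (0 < 4)%N)); rewrite /four_arc_set /= => -[/seg h1 p1].
have := h (Ordinal (isT : (1 < 4)%N)); rewrite /four_arc_set /= => -[/seg h2 p2].
have := h (Ordinal (isT : (2 < 4)%N)); rewrite /four_arc_set /= => -[/seg h3 p3].
have := h (Ordinal (isT : (3 < 4)%N)); rewrite /four_arc_set /= => -[h4 p4].
have b4 : is_bang c4 by case: h4 => ->; rewrite /is_bang eqxx ?orbT.
have h4' := bang_unit b4.
have uw : unit_word [:: (c1, t1); (c2, t2); (c3, t3); (c4, t4)].
  by rewrite /unit_word /= h1 h2 h3 h4' p1 p2 p3 p4.
have uw3 : unit_word [:: (c1, t1); (c2, t2); (c3, t3)].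
  by rewrite /unit_word /= h1 h2 h3 p1 p2 p3.
exists c4; first by [].
(* The third value serves as closing value of a word with only two breakpoints, as [PC 2] demands;
   the fourth arc is the factor in [B 0]. *)
right; exists (dur [:: (c1, t1); (c2, t2); (c3, t3)]), t4, (ctrl 0 [:: (c1, t1); (c2, t2)] c3), (fun=> c4).
split.
- by rewrite -dw !dur_cons dur_nil /=; ring.
- left; apply: ctrl_PC => //; first exact: unit_word_dur.
  by rewrite /unit_word /= h1 h2 p1 p2.
- by left; exact: bang_B0.
- move=> t _; have := @ctrl_rcons_same 0 [:: (c1, t1); (c2, t2); (c3, t3)] (c4, t4) t uw.
  move=> /= ->; exact: (@ctrl_concat [:: (c1, t1); (c2, t2)] (c3, t3) c4 t uw3).
Qed.

Definition periodic_duration (d0 d1 d2 : R) (k : nat) : R :=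
  if k is 0%N then d0 else if odd k then d1 else d2.

Definition periodic_word v d0 d1 d2 k : seq (R * R) :=
  [seq (cswitch v i, periodic_duration d0 d1 d2 i) | i <- iota 0 k].

Lemma periodic_wordS v d0 d1 d2 k : periodic_word v d0 d1 d2 k.+1 =
  rcons (periodic_word v d0 d1 d2 k) (cswitch v k, periodic_duration d0 d1 d2 k).
Proof. by rewrite /periodic_word -addn1 iotaD map_cat cats1. Qed.

Lemma is_bang_cswitch v i : is_bang v -> is_bang (cswitch v i).
Proof. by rewrite /cswitch; case: ifP => // _; exact: bang_compl. Qed.

Lemma periodic_word_BP v d0 d1 d2 k T : is_bang v -> 0 < d0 -> 0 < d1 -> 0 < d2 ->
  0 <= T -> T <= dur (periodic_word v d0 d1 d2 k) ->
  BP T (ctrl 0 (periodic_word v d0 d1 d2 k) (cswitch v k)).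
Proof.
move=> hv d0_gt0 d1_gt0 d2_gt0 T0 Tk.
pose d := periodic_duration d0 d1 d2; pose w := periodic_word v d0 d1 d2.
have d_gt0 i : 0 < d i by case: i => //= i; case: ifP.
have uw i : unit_word (w i).
  apply/allP => p /mapP[j _ ->] /=; rewrite (ltW (d_gt0 j)) andbT.
  exact/bang_unit/is_bang_cswitch.
split; first by apply: ctrl_scalar_control => //; exact/bang_unit/is_bang_cswitch.
(* The n-th switch comes at the end of arc n, so [tau n] adds up n + 1 durations. *)
pose tau n := dur (w n.+1).
have tauS n : tau n.+1 = tau n + d n.+1.
  by rewrite /tau /w periodic_wordS -cats1 dur_cat dur_cons dur_nil addr0.
have tau_lt n : tau n < tau n.+1 by rewrite tauS ltrDl.
have tau_le m n : (m <= n)%N -> tau m <= tau n.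
  by move=> mn; apply: (homo_leq (@lexx _ _) (@le_trans _ _) (fun i => ltW (tau_lt i)) mn).
have tau0 : tau 0%N = d0 by rewrite /tau /w /periodic_word /= dur_cons dur_nil addr0.
pose u t := if `[< exists n, odd n /\ tau n <= t < tau n.+1 >] || (t < tau 0%N) then v else 1 - v.
have u0 t : t < tau 0%N -> u t = v by move=> h; rewrite /u h orbT.
have uS n t : tau n <= t < tau n.+1 -> u t = if odd n then v else 1 - v.
  move=> /andP[nt tn]; rewrite /u ltNge (le_trans (tau_le 0%N n _) nt)//= orbF.
  case: ifPn => [/asboolP[m [om /andP[mt tm]]]|/asboolPn h].
    suff -> : n = m by rewrite om.
    apply/eqP; rewrite eqn_leq; apply/andP; split; rewrite leqNgt; apply/negP => /tau_le h.
      by have := le_lt_trans (le_trans h nt) tm; rewrite ltxx.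
    by have := le_lt_trans (le_trans h mt) tn; rewrite ltxx.
  by case: ifP => // on; exfalso; apply: h; exists n; rewrite nt tn.
exists u.
  exists tau, v; split.
  - by rewrite tau0.
  - exact: tau_lt.
  - by move=> n; rewrite !tauS /d /=; rewrite negbK; ring.
  - by case/orP: hv => /eqP ->; [left|right].
  - by split=> [t /andP[_]|]; [exact: u0|exact: uS].
(* The closing value is that of the next arc of the infinite pattern, so the agreement persists at
   the right end of [0, T]. *)
have agree i t : (t < tau i) -> ctrl 0 (w i) (cswitch v i) t = u t.
  elim: i => [|i IH] ti; first by rewrite u0.
  rewrite /w periodic_wordS ctrl_rcons; last by have := uw i.+1; rewrite /w periodic_wordS.
  rewrite -periodic_wordS add0r; case: ltP => [/IH//|it].
  rewrite (@uS i t); last by rewrite it.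
  by rewrite /cswitch /=; case: odd.
move=> t; rewrite in_itv /= => /andP[_ tT]; apply: agree.
apply: le_lt_trans tT (le_lt_trans Tk _).
rewrite /tau /w periodic_wordS -cats1 dur_cat dur_cons dur_nil addr0 ltrDl; exact: d_gt0.
Qed.

End ControlClasses.

(** * From planar minimisers to controls in the required class *)

Section Synthesis.
Variable R : realType.
Implicit Types (w : seq (R * R)) (T : R).

Lemma best_W (M1 M2 : mat2 R) T y0 w : y0 != 0 -> best M1 M2 T y0 w -> (4 < size w)%N ->
  (forall w', isbb T w' -> val M1 M2 y0 w <= val M1 M2 y0 w') ->
  exists2 c, unit_word w /\ 0 <= c <= 1 & W T (ctrl 0 w c).
Proof.
move=> y0_neq0 bw w4 wmin; have [bb _ _] := bw; have uw := isbb_unit bb.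
have [/allP aw /eqP dw] := andP bb.
have pos i : (i < size w)%N -> 0 < (nth 0 w i).2.
  move=> iw; apply: (@best_pos _ M1 M2 T y0 (take i w) _ (drop i.+1 w)).
  by rewrite -drop_nth// cat_take_drop.
pose v := (nth 0 w 0).1.
have hv : is_bang v by case/andP: (aw _ (mem_nth 0 (ltn_trans (isT : (0 < 4)%N) w4))).
pose d1 := (nth 0 w 1).2; pose d2 := (nth 0 w 2).2.
(* The first three durations define the pattern; from index 3 on, an arc other than the last repeats
   the one two places earlier. *)
have per k : (k.+1 < size w)%N -> (nth 0 w k).2 = periodic_duration (nth 0 w 0).2 d1 d2 k.
  elim/ltn_ind: k => -[|[|[|k]]] IH // kw.
  rewrite (@global_best_periodic _ M1 M2 T y0 y0_neq0 w k.+1)// IH//=; last by lia.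
  by rewrite negbK.
case/lastP: w => [//|w q] in bw w4 wmin bb uw aw dw pos v hv d1 d2 per *.
rewrite size_rcons in w4 per pos.
have wE : w = periodic_word v (nth 0 (rcons w q) 0).2 d1 d2 (size w).
  apply: (@eq_from_nth _ 0); first by rewrite size_map size_iota.
  move=> i iw; rewrite (nth_map 0%N) ?size_iota// nth_iota// add0n -per// nth_rcons iw.
  rewrite [LHS]surjective_pairing; congr (_, _).
  have := @best_nth_type _ M1 M2 T y0 (rcons w q) i bw.
  by rewrite size_rcons nth_rcons iw => ->//; rewrite ltnW.
have qE : q.1 = cswitch v (size w).
  have := @best_nth_type _ M1 M2 T y0 (rcons w q) (size w) bw.
  by rewrite size_rcons nth_rcons ltnn eqxx => ->.
have [uq q2] : 0 <= q.1 <= 1 /\ 0 <= q.2.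
  by move: uw; rewrite /unit_word all_rcons => /andP[/andP[]].
have uw' : unit_word w by move: uw; rewrite /unit_word all_rcons => /andP[].
exists q.1; first by [].
(* The last arc may have any duration, so it is split off as the factor in [B 0]; the free first arc
   is allowed by [BP]. *)
left; exists (dur w), q.2, (ctrl 0 w q.1), (fun=> q.1); split.
- by rewrite -dw -cats1 dur_cat dur_cons dur_nil addr0.
- left; rewrite [in X in ctrl 0 X _]wE qE; apply: periodic_word_BP => //.
  + by apply: pos.
  + by apply: pos; lia.
  + by apply: pos; lia.
  + exact: unit_word_dur.
  + by rewrite -wE.
- by left; apply: bang_B0 => //; rewrite qE; exact: is_bang_cswitch.
- move=> t _; rewrite ctrl_rcons_same// /concat; case: ltP => // h.
  by rewrite ctrl_ge// add0r.
Qed.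

Lemma planar_optimum_W (M1 M2 : mat2 R) T y0 : 0 <= T ->
  exists w c, [/\ unit_word w, dur w = T, 0 <= c <= 1, W T (ctrl 0 w c) &
    forall w', isbb T w' -> val M1 M2 y0 w <= val M1 M2 y0 w'].
Proof.
(* From the planar origin every word has cost 0, so any four-arc word is a minimiser. *)
move=> T0; have [y0E|y0_neq0] := eqVneq y0 0.
  have z01 : 0 <= (0 : R) <= 1 by rewrite lexx ler01.
  have wT : four_arcs T [:: (0, 0); (0, 0); (0, 0); (0, T)].
    by apply: four_arcsP; rewrite ?add0r ?/is_bang ?eqxx.
  have [c [uw hc] hW] := four_arcs_W wT; have [_ dw _] := wT.
  exists [:: (0, 0); (0, 0); (0, 0); (0, T)], c; split=> // w' _.
  have e : y0 = scale 0 y0 by rewrite /scale y0E !mul0r.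
  rewrite {1}/val e flow_scale /cost /= !mul0r expr0n addr0 subrr; exact: cost_ge0.
have [[w wT wmin]|[w [bw w4 wmin]]] := planar_optimum M1 M2 y0_neq0 T0.
  by have [c [uw hc] hW] := four_arcs_W wT; exists w, c; split=> //; case: wT.
have [c [uw hc] hW] := best_W y0_neq0 bw w4 wmin.
by exists w, c; split=> //; case: bw => /andP[_ /eqP].
Qed.

End Synthesis.

Theorem theorem4 (R : realType) (A1 A2 : 'M[R]_3)
    (metzA1 : metzler A1) (sumA1 : zero_row_sums A1)
    (metzA2 : metzler A2) (sumA2 : zero_row_sums A2)
    (x0 : 'cV[R]_3) (T : R) (T_ge0 : 0 <= T) :
  exists u1 : R -> R,
    optimal A1 A2 x0 T (control_of u1) /\ W T u1.
Proof.
have [w [c [uw dw hc hW wmin]]] := planar_optimum_W (planar A1) (planar A2) (proj x0) T_ge0.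
exists (ctrl 0 w c); split=> //; split; first exact: word_admissible.
have [x xtraj xT] := word_trajectory x0 sumA1 sumA2 c uw dw.
exists x => // v y hv hy; rewrite !V_cost ler_wpM2l ?divr_ge0 ?ler0n// xT.
exact: (measurable_lower_bound sumA1 sumA2 T_ge0 hv hy).
Qed.
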